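(* Let $A$ be a bounded normal operator on an infinite-dimensional Hilbert space $\mathcal{H}$, let $(\mathcal{L}_n)\in\Lambda$, let $z\in\sigma(A)\backslash\mathcal{Q}(\sigma_{\mathrm{ess}}(A))$, put $\varepsilon_n=\delta(\mathcal{L}(\{z,\overline z\}),\mathcal{L}_n)$, and fix an admissible radius $r$ with circle $\Gamma$ (as defined in the context). For a sequence $z_n\in\sigma(S_n)$ with $z_n\to z$, and for either choice of sign $\pm$, set $$\gamma_n(z_n)=\min\{\|(A-z_n)\phi\|:\phi\in\mathcal{M}_n^\pm(\{z\},r),\ \|\phi\|=1\}.$$ Then $\mathrm{dist}[z_n,\sigma(A)]\le\gamma_n(z_n)=\mathcal{O}(\varepsilon_n)$, and for all sufficiently large $n\in\mathbb{N}$ we have $|z_n-z|\le\gamma_n(z_n)$.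
   Context: $\sigma(A)$, $\sigma_{\mathrm{dis}}(A)$, $\sigma_{\mathrm{ess}}(A)$ denote spectrum, discrete spectrum and essential spectrum. $(\mathcal{L}_n)\in\Lambda$ means: each $\mathcal{L}_n$ is a finite-dimensional subspace of $\mathcal{H}$ and the orthogonal projections $P_n$ onto $\mathcal{L}_n$ converge strongly to $I$. $\delta(\mathcal{L},\mathcal{M})=\sup_{\psi\in\mathcal{L},\|\psi\|=1}\mathrm{dist}[\psi,\mathcal{M}]$. $\mathcal{L}(\{z,\overline z\})$ is the linear span of the eigenspaces of $A$ for those of $z,\overline z$ that belong to $\sigma_{\mathrm{dis}}(A)$. For compact $\Sigma\subset\mathbb{C}$: $\Sigma_w=\{(\lambda-w)(\overline\lambda-w):\lambda\in\Sigma\}$ and $\mathcal{Q}(\Sigma)=\{w\in\mathbb{C}:0\in\mathrm{conv}(\Sigma_w)\}$, where $\mathrm{conv}$ is the closed convex hull. $S_n=\begin{pmatrix}P_n(A+A^* )&-P_nA^*A\\ I&0\end{pmatrix}$ on $\mathcal{L}_n\oplus\mathcal{L}_n$. Admissible $r,\Gamma$: $\Gamma$ is the circle with center $z$ and radius $r>0$, where $r<\mathrm{dist}\big[z,\big(\mathcal{Q}(\sigma_{\mathrm{ess}}(A))\cup\sigma(A)\cup\sigma(A^* )\big)\backslash\{z\}\big]$, $\Gamma\cap\mathbb{R}=\varnothing$ if $z\notin\mathbb{R}$, and $\Gamma$ does not pass through $0$ if $z\in\mathbb{R}$. $\mathcal{M}_n(\{z\},r)$ is the spectral subspace of $S_n$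 associated with the eigenvalues of $S_n$ enclosed by $\Gamma$. With $P_+\begin{pmatrix}u\\ v\end{pmatrix}=u$ and $P_-\begin{pmatrix}u\\ v\end{pmatrix}=v$, set $\mathcal{M}_n^\pm(\{z\},r)=\{P_\pm x:x\in\mathcal{M}_n(\{z\},r)\}$. The quantity $\gamma_n(z_n)$ is defined for those (all sufficiently large) $n$ for which this space is non-zero. *)

(* Defs.v *)
From HB Require Import structures.
From mathcomp Require Import all_boot all_order all_algebra.
From mathcomp Require Import sesquilinear complex.
From mathcomp Require Import all_classical all_reals all_analysis.

Set Implicit Arguments.
Unset Strict Implicit.
Unset Printing Implicit Defensive.

Import Order.TTheory GRing.Theory Num.Theory.
Import numFieldNormedType.Exports.

Local Open Scope classical_set_scope.
Local Open Scope ring_scope.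
Local Open Scope complex_scope.

(* Norms of complex normed spaces are elements of R[i] lying on the
   nonnegative real axis; nrm is the same quantity read in R. *)
Definition nrm (R : realType) (V : normedZmodType R[i]) (x : V) : R :=
  complex.Re `|x|.

(* Equal to 0, not +oo, when S is empty. *)
Definition set_dist (R : realType) (V : normedZmodType R[i])
    (x : V) (S : set V) : R :=
  inf [set nrm (x - y) | y in S].

Definition lspan (R : realType) (V : lmodType R[i]) (E : set V) : set V :=
  [set v | exists (m : nat) (c : 'I_m -> R[i]) (e : 'I_m -> V),
     (forall i, E (e i)) /\ v = \sum_i c i *: e i].

Definition findim_subspace (R : realType) (V : lmodType R[i]) (M : set V) :=
  exists s : seq V, M = lspan [set` s].

(* The sup is taken in R: it is 0 when L = {0}. *)
Definition gap (R : realType) (V : normedModType R[i]) (L M : set V) : R :=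
  sup [set set_dist x M | x in [set x | L x /\ nrm x = 1]].

(* Scalars t of R[i] with 0 <= t <= 1 are real, so that convex_set over R[i]
   is convexity in the real plane. *)
Definition closed_conv (R : realType) (S : set R[i]) : set R[i] :=
  smallest [set X : set R[i]^o | closed X /\ convex_set X] S.

Definition Sigma_ (R : realType) (w : R[i]) (Sigma : set R[i]) : set R[i] :=
  [set (l - w) * (Num.conj l - w) | l in Sigma].

Definition quad_hull (R : realType) (Sigma : set R[i]) : set R[i] :=
  [set w | closed_conv (Sigma_ w Sigma) 0].

Definition bounded_on (R : realType) (V : normedModType R[i])
    (M : set V) (T : V -> V) :=
  exists k : R, forall x, M x -> nrm (T x) <= k * nrm x.

(* Resolvent set and spectrum of T viewed as an operator on the invariant
   subspace M. *)
Definition resolvent_set_on (R : realType) (V : normedModType R[i])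
    (M : set V) (T : V -> V) : set R[i] :=
  [set l | exists B : V -> V, bounded_on M B /\
     forall x, M x ->
       [/\ M (B x), B (T x - l *: x) = x & T (B x) - l *: B x = x]].

Definition spectrum_on (R : realType) (V : normedModType R[i])
    (M : set V) (T : V -> V) : set R[i] :=
  ~` resolvent_set_on M T.

Definition spectrum (R : realType) (V : normedModType R[i]) (T : V -> V) :
    set R[i] :=
  spectrum_on setT T.

Definition eigenspace_of (R : realType) (V : lmodType R[i])
    (T : V -> V) (l : R[i]) : set V :=
  [set u | T u = l *: u].

(* Isolated points of the spectrum which are eigenvalues of finite
   multiplicity. For normal operators the geometric multiplicity used here is
   the algebraic one. *)
Definition discrete_spectrum (R : realType) (V : normedModType R[i])
    (T : V -> V) : set R[i] :=
  [set l | [/\ isolated (spectrum T : set R[i]^o) l,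
               exists2 u, eigenspace_of T l u & u != 0
             & findim_subspace (eigenspace_of T l)]].

Definition essential_spectrum (R : realType) (V : normedModType R[i])
    (T : V -> V) : set R[i] :=
  spectrum T `\` discrete_spectrum T.

Definition discrete_eigenspan (R : realType) (V : normedModType R[i])
    (T : V -> V) (D : set R[i]) : set V :=
  lspan (\bigcup_(l in D `&` discrete_spectrum T) eigenspace_of T l).

(* Span of the root vectors in M for the eigenvalues lying in D; this is the
   range of the Riesz projection since M is finite-dimensional. *)
Definition spectral_subspace (R : realType) (V : normedModType R[i])
    (M : set V) (T : V -> V) (D : set R[i]) : set V :=
  lspan [set x | M x /\ exists (l : R[i]) (k : nat),
    [/\ spectrum_on M T l, D l & iter k (fun y => T y - l *: y) x = 0]].

Section Hilbert.
Variables (R : realType) (H : completeNormedModType R[i]).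
Variable dot : {dot H for Num.conj}.

(* The values of xget are the unique elements with the stated property; they
   exist for bounded A (Riesz), respectively for finite-dimensional L. *)
Definition adjoint (A : H -> H) (v : H) : H :=
  xget 0 [set w | forall u, dot (A u) v = dot u w].

Definition orthproj (L : set H) (u : H) : H :=
  xget 0 [set v | L v /\ forall w, L w -> dot (u - v) w = 0].

Definition normal_op (A : H -> H) :=
  forall u, A (adjoint A u) = adjoint A (A u).

Definition Lambda (L : nat -> set H) :=
  (forall n, findim_subspace (L n)) /\
  (forall u, (fun n => orthproj (L n) u) @ \oo --> u).

(* The block operator is used on the subspace L `*` L of H * H only. The norm
   of H * H is the max norm, equivalent to the Hilbert norm. *)
Definition quad_block (A : H -> H) (L : set H) (x : H * H) : H * H :=
  (orthproj L (A x.1 + adjoint A x.1) - orthproj L (adjoint A (A x.2)), x.1).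

Definition quad_spectrum (A : H -> H) (L : set H) : set R[i] :=
  spectrum_on (L `*` L) (quad_block A L).

Definition circle (z : R[i]) (r : R) : set R[i] := [set w | nrm (w - z) = r].

Definition enclosed (z : R[i]) (r : R) : set R[i] := [set w | nrm (w - z) < r].

(* The set whose distance to z bounds r is nonempty whenever z is outside
   quad_hull (essential_spectrum A) and H is infinite-dimensional. *)
Definition admissible_radius (A : H -> H) (z : R[i]) (r : R) :=
  [/\ 0 < r,
      r < set_dist z ((quad_hull (essential_spectrum A) `|` spectrum A
                        `|` spectrum (adjoint A)) `\ z),
      complex.Im z != 0 -> circle z r `&` range (fun t : R => t%:C) = set0
    & complex.Im z = 0 -> ~ circle z r 0].

Definition Mspace (A : H -> H) (L : set H) (z : R[i]) (r : R) : set (H * H) :=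
  spectral_subspace (L `*` L) (quad_block A L) (enclosed z r).

(* true stands for the sign +, false for the sign -. *)
Definition Mspace_pm (s : bool) (A : H -> H) (L : set H) (z : R[i]) (r : R) :
    set H :=
  [set (if s then x.1 else x.2) | x in Mspace A L z r].

Definition residuals (A : H -> H) (M : set H) (w : R[i]) : set R :=
  [set nrm (A phi - w *: phi) | phi in [set phi | M phi /\ nrm phi = 1]].

End Hilbert.

(* Main.v *)
(* Write T(l) = (A^* - l)(A - l). The eigenvectors of S_n at l are the pairs (l v, v) with
   P_n T(l) v = 0. As z is outside Q(sigma_ess(A)), there is w such that Re (w T(z)) is
   bounded below by a positive constant off a finite-dimensional reducing subspace spanned
   by eigenvectors of A. Hence P_n T(l) is bounded below on L_n, uniformly in n, for l near
   z and away from z, so that the resolvent of S_n is bounded uniformly in n on a small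
   square around z.
   For a unit eigenvector u of A at z, (S_n - z)(z P_n u, P_n u) = (- P_n T(z) P_n u, 0) has
   norm O(eps_n). The maximum principle, in the quotient by the spectral subspace, transfers
   the resolvent bound from the square to z, and the pair (z P_n u, P_n u) is therefore at
   distance O(eps_n) from M_n(z, r), which gives the trial vector phi.
   Finally, an eigenvector v_n for z_n is O(eps_n)-close to E = L({z, conj z}), where T(z_n)
   acts as the scalar (conj z - z_n)(z - z_n); testing with P_n of its E-component shows that
   this scalar is O(eps_n^2), whence |z_n - z| = O(eps_n), also for real z, where it is a
   square. *)
Require Import Defs.
From HB Require Import structures.
From mathcomp Require Import all_boot all_order all_algebra.
From mathcomp Require Import sesquilinear complex.
From mathcomp Require Import all_classical all_reals all_analysis.
From mathcomp Require Import ring lra.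

Set Implicit Arguments.
Unset Strict Implicit.
Unset Printing Implicit Defensive.
Import Order.TTheory GRing.Theory Num.Theory.
Import numFieldNormedType.Exports.
Local Open Scope classical_set_scope.
Local Open Scope ring_scope.
Local Open Scope complex_scope.

(** * Subspaces and spans *)

(** Functional calculus and contour integrals are replaced by elementary devices. The first is
    [spectral_lower_bound]: a lower bound for the real part of a polynomial on the approximate point
    spectrum passes to the form of that polynomial in A and its adjoint. Distances to the spectrum,
    gaps at isolated points and coercivity are instances for suitable polynomials. The obstacle is
    that eigenvalues of S_n may cluster at z, in unknown number and with Jordan blocks, so that the
    resolvent is controlled only at a positive distance from z. A residual O(eps_n) at z still gives
    a distance O(eps_n), because the resolvent is replaced by that of a matrix without eigenvalues
    inside the square, which differs from it only modulo the spectral subspace. The maximum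
    principle for it is proved by a mean over four points. The inequality |z_n - z| <= gamma_n rests
    on z being isolated: for large n no other point of the approximate point spectrum is nearer to
    z_n. *)

Section Span.
Variables (R : realType) (V : lmodType R[i]).
Implicit Types (M E F : set V) (u v w x y : V) (s t : seq V).

Definition subsp M := M 0 /\ forall c u v, M u -> M v -> M (c *: u + v).

Lemma subspZ M c u : subsp M -> M u -> M (c *: u).
Proof. by move=> [M0 hM] Mu; rewrite -(addr0 (_ *: _)); exact: hM. Qed.
Lemma subspD M u v : subsp M -> M u -> M v -> M (u + v).
Proof. by move=> [M0 hM] Mu Mv; rewrite -(scale1r u); exact: hM. Qed.
Lemma subspB M u v : subsp M -> M u -> M v -> M (u - v).
Proof. by move=> sM Mu Mv; rewrite addrC -scaleN1r; exact: sM.2. Qed.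
Lemma subsp_sum M (I : Type) (r : seq I) (P : pred I) (F : I -> V) :
  subsp M -> (forall i, P i -> M (F i)) -> M (\sum_(i <- r | P i) F i).
Proof.
by move=> sM MF; elim/big_rec: _ => [|i x Pi Mx]; [exact: sM.1|exact: subspD (MF _ Pi) Mx].
Qed.

Lemma subsp_lspan E : subsp (lspan E).
Proof.
split; first by exists 0%N, (fun=> 0), (fun=> 0); split; [case|rewrite big_ord0].
move=> c u v [m [a [f [Ef ->]]]] [n [b [g [Eg ->]]]].
exists (m + n)%N, (fun i => match fintype.split i with inl j => c * a j | inr j => b j end),
  (fun i => match fintype.split i with inl j => f j | inr j => g j end).
split; first by move=> i; case: fintype.split.
rewrite big_split_ord /= scaler_sumr; congr (_ + _); apply: eq_bigr => i _.
  by rewrite (unsplitK (inl _ i)) scalerA.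
by rewrite (unsplitK (inr _ i)).
Qed.

Lemma sub_lspan E x : E x -> lspan E x.
Proof.
by move=> Ex; exists 1%N, (fun=> 1), (fun=> x); split=> //; rewrite big_ord1 scale1r.
Qed.

Lemma lspan_sub E M : subsp M -> E `<=` M -> lspan E `<=` M.
Proof.
move=> sM EM x [m [c [f [Ef ->]]]]; apply: subsp_sum => // i _.
by apply: subspZ => //; exact/EM/Ef.
Qed.

Lemma lspanS E F : E `<=` F -> lspan E `<=` lspan F.
Proof.
by move=> EF; apply: lspan_sub (subsp_lspan F) _ => x /EF; exact: sub_lspan.
Qed.

Lemma subsp_findim M : findim_subspace M -> subsp M.
Proof. by move=> [s ->]; exact: subsp_lspan. Qed.

Lemma lspan_nil : lspan [set` [::] : seq V] = [set 0].
Proof.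
apply/seteqP; split; last by move=> _ ->; exact: (subsp_lspan _).1.
apply: lspan_sub => [|x //]; split=> // c u v -> ->; by rewrite scaler0 addr0.
Qed.

Lemma lspan_cons x s u :
  lspan [set` x :: s] u <-> exists c v, lspan [set` s] v /\ u = c *: x + v.
Proof.
split; last first.
  move=> [c [v [sv ->]]]; apply: (subsp_lspan _).2.
    by apply: sub_lspan => /=; rewrite mem_head.
  by apply: lspanS sv => y /= ys; rewrite inE ys orbT.
move: u; apply: lspan_sub => [|y /=].
  split; first by exists 0, 0; rewrite scale0r addr0; split=> //; exact: (subsp_lspan _).1.
  move=> c _ _ [a [v [sv ->]]] [b [w [sw ->]]].
  exists (c * a + b), (c *: v + w); split; first exact: (subsp_lspan _).2.
  by rewrite scalerDr scalerDl scalerA addrACA.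
rewrite inE => /predU1P[->|ys].
  by exists 1, 0; rewrite scale1r addr0; split=> //; exact: (subsp_lspan _).1.
by exists 0, y; rewrite scale0r add0r; split=> //; exact: sub_lspan.
Qed.

(** Induction on the generators: if M is not inside [lspan s], it contains some u with nonzero
    x-coefficient. Subtracting multiples of u brings every vector of M into the intersection with
    [lspan s], which the induction covers. *)
Lemma findim_sub s M : subsp M -> M `<=` lspan [set` s] -> findim_subspace M.
Proof.
elim: s M => [|x s IH] M sM Ms.
  exists [::]; rewrite lspan_nil; apply/seteqP; split; last by move=> _ ->; exact: sM.1.
  by move=> y /Ms; rewrite lspan_nil.
have [||t Mt] := IH (M `&` lspan [set` s]).
- have [ss hs] := subsp_lspan [set` s].
  by split=> [|c u v [Mu su] [Mv sv]]; split; [exact: sM.1| |exact: sM.2|exact: hs].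
- by move=> u [].
have [Ms'|] := pselect (M `<=` lspan [set` s]); first exact: IH.
move=> /existsNP[u /not_implyP[Mu su]].
have /lspan_cons[c [v [sv uE]]] := Ms _ Mu.
have c0 : c != 0 by apply/eqP => c0; apply: su; rewrite uE c0 scale0r add0r.
exists (u :: t); apply/seteqP; split; last first.
  apply: lspan_sub => // y /=; rewrite inE => /predU1P[-> //|yt].
  by have : lspan [set` t] y by [exact: sub_lspan]; rewrite -Mt => -[].
move=> y My; have /lspan_cons[d [w [sw yE]]] := Ms _ My.
apply/lspan_cons; exists (d / c), (y - (d / c) *: u); split; last by rewrite addrC subrK.
rewrite -Mt; split; first by apply: subspB => //; exact: subspZ.
rewrite yE uE scalerDr scalerA divfK // opprD addrACA subrr add0r.
by apply: (subspB (subsp_lspan _)) => //; apply: (subspZ _ (subsp_lspan _)).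
Qed.

Lemma findim_bigcup (I : choiceType) (D : set I) (E : I -> set V) (r : seq I) :
  D `<=` [set` r] -> (forall i, D i -> findim_subspace (E i)) ->
  findim_subspace (lspan (\bigcup_(i in D) E i)).
Proof.
move=> Dr hE.
have [f hf] : exists f : I -> seq V, forall i, D i -> E i = lspan [set` f i].
  have /choice[f hf] : forall i, exists s, D i -> E i = lspan [set` s].
    move=> i; have [Di|nDi] := pselect (D i); last by exists [::].
    by have [s ->] := hE _ Di; exists s.
  by exists f.
apply: (@findim_sub (flatten [seq f i | i <- r])); first exact: subsp_lspan.
apply: lspan_sub (subsp_lspan _) _ => x [i Di Eix].
rewrite (hf _ Di) in Eix; apply: lspanS Eix => y /= yf.
by apply/flatten_mapP; exists i => //; exact: Dr.
Qed.

End Span.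

(** * Norm and inner product *)

Section Nrm.
Variable R : realType.
Local Notation C := R[i].

Section Normed.
Variable V : normedZmodType C.
Implicit Types x y : V.

Lemma nrmE x : (nrm x)%:C = `|x|.
Proof. by rewrite /nrm RRe_real // normr_real. Qed.

Lemma nrm_ge0 x : 0 <= nrm x.
Proof. by rewrite -ler0c nrmE normr_ge0. Qed.

Lemma nrm0 : nrm (0 : V) = 0.
Proof. by rewrite /nrm normr0. Qed.

Lemma nrm_eq0 x : (nrm x == 0) = (x == 0).
Proof. by rewrite -(normr_eq0 x) -nrmE (inj_eq (@complexI R)). Qed.

Lemma nrm_gt0 x : (0 < nrm x) = (x != 0).
Proof. by rewrite lt_neqAle nrm_ge0 andbT eq_sym nrm_eq0. Qed.

Lemma nrmD x y : nrm (x + y) <= nrm x + nrm y.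
Proof. by rewrite -lecR rmorphD /= !nrmE ler_normD. Qed.

Lemma nrmN x : nrm (- x) = nrm x.
Proof. by rewrite /nrm normrN. Qed.

Lemma nrmB x y : nrm (x - y) <= nrm x + nrm y.
Proof. by rewrite -(nrmN y) nrmD. Qed.

Lemma nrmBC x y : nrm (x - y) = nrm (y - x).
Proof. by rewrite -nrmN opprB. Qed.

Lemma nrm_subD x y w : nrm (x - w) <= nrm (x - y) + nrm (y - w).
Proof. by rewrite (_ : x - w = (x - y) + (y - w)) ?nrmD // addrA subrK. Qed.

Lemma nrm_lerB x y : nrm x - nrm y <= nrm (x + y).
Proof.
rewrite lerBlDr -{1}(addrK y x); apply: le_trans (nrmD _ _) _.
by rewrite nrmN.
Qed.

Lemma nrm_sum (I : Type) (r : seq I) (P : pred I) (F : I -> V) :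
  nrm (\sum_(i <- r | P i) F i) <= \sum_(i <- r | P i) nrm (F i).
Proof.
elim/big_rec2 : _ => [|i y1 y2 _ H]; first by rewrite nrm0.
by apply: le_trans (nrmD _ _) _; rewrite lerD2l.
Qed.

End Normed.

Lemma nrm_real (a : R) : nrm a%:C = `|a|.
Proof. by rewrite /nrm normc_def /= expr0n addr0 sqrtr_sqr. Qed.

Lemma nrmc_sqr (c : C) : nrm c ^+ 2 = complex.Re c ^+ 2 + complex.Im c ^+ 2.
Proof. by rewrite /nrm normc_def /= sqr_sqrtr // addr_ge0 // sqr_ge0. Qed.

Lemma nrmM (c d : C) : nrm (c * d) = nrm c * nrm d.
Proof. by apply/complexI; rewrite rmorphM /= !nrmE normrM. Qed.

Lemma nrm1 : nrm (1 : C) = 1.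
Proof. by rewrite (nrm_real 1) normr1. Qed.

Lemma nrmX (c : C) k : nrm (c ^+ k) = nrm c ^+ k.
Proof. by elim: k => [|k IH]; rewrite ?expr0 ?nrm1 // !exprS nrmM IH. Qed.

Lemma nrmV (c : C) : nrm c^-1 = (nrm c)^-1.
Proof. by apply/complexI; rewrite fmorphV /= !nrmE normfV. Qed.

Lemma nrm_conj (c : C) : nrm (Num.conj c) = nrm c.
Proof. by rewrite /nrm norm_conjC. Qed.

Lemma Re_le_nrm (c : C) : complex.Re c <= nrm c.
Proof.
rewrite (le_trans (ler_norm _)) // -(@ler_pXn2r _ 2) ?nnegrE ?nrm_ge0 //.
by rewrite nrmc_sqr real_normK ?num_real // lerDl sqr_ge0.
Qed.

Lemma Im_le_nrm (c : C) : complex.Im c <= nrm c.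
Proof.
rewrite (le_trans (ler_norm _)) // -(@ler_pXn2r _ 2) ?nnegrE ?nrm_ge0 //.
by rewrite nrmc_sqr real_normK ?num_real // lerDr sqr_ge0.
Qed.

Lemma nrm_conj_sqr (c : C) : c * Num.conj c = (nrm c ^+ 2)%:C.
Proof. by rewrite -sqr_normc -nrmE -rmorphXn. Qed.

Lemma nrmc_le (c : C) : nrm c <= `|complex.Re c| + `|complex.Im c|.
Proof.
rewrite -(@ler_pXn2r _ 2) ?nnegrE ?nrm_ge0 ?addr_ge0 // nrmc_sqr sqrrD.
by rewrite !real_normK ?num_real // lerD2r lerDl mulrn_wge0 // mulr_ge0.
Qed.

Lemma ReD (c d : C) : complex.Re (c + d) = complex.Re c + complex.Re d.
Proof. by case: c d => [a b] []. Qed.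
Lemma ImD (c d : C) : complex.Im (c + d) = complex.Im c + complex.Im d.
Proof. by case: c d => [a b] []. Qed.
Lemma ReN (c : C) : complex.Re (- c) = - complex.Re c.
Proof. by case: c. Qed.
Lemma ImN (c : C) : complex.Im (- c) = - complex.Im c.
Proof. by case: c. Qed.
Lemma ReM (c d : C) :
  complex.Re (c * d) = complex.Re c * complex.Re d - complex.Im c * complex.Im d.
Proof. by case: c d => [a b] []. Qed.
Lemma Re_conj (c : C) : complex.Re (Num.conj c) = complex.Re c.
Proof. by case: c. Qed.
Lemma conj_real (a : R) : Num.conj a%:C = a%:C :> C.
Proof. exact: conjc_real. Qed.
Lemma conjM (c d : C) : Num.conj (c * d) = Num.conj c * Num.conj d.
Proof. exact: rmorphM. Qed.
Lemma conjD (c d : C) : Num.conj (c + d) = Num.conj c + Num.conj d.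
Proof. exact: rmorphD. Qed.
Lemma conjN (c : C) : Num.conj (- c) = - Num.conj c.
Proof. exact: rmorphN. Qed.
Lemma ReZ (a : R) (c : C) : complex.Re (a%:C * c) = a * complex.Re c.
Proof. by rewrite ReM /= mul0r subr0. Qed.

Lemma nrmZ (V : normedModType C) (c : C) (x : V) : nrm (c *: x) = nrm c * nrm x.
Proof. by apply/complexI; rewrite rmorphM /= !nrmE normrZ. Qed.

Lemma nrmZr (V : normedModType C) (a : R) (x : V) :
  nrm (a%:C *: x) = `|a| * nrm x.
Proof. by rewrite nrmZ nrm_real. Qed.

End Nrm.

(** * Inner product: Cauchy-Schwarz, parallelogram law, orthogonality from minimality *)

Section Hilb.
Variables (R : realType) (H : completeNormedModType R[i]).
Variable dot : {dot H for Num.conj}.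
Hypothesis dot_norm : forall u : H, dot u u = `|u| ^+ 2.
Local Notation C := R[i].
Local Notation Re := complex.Re.
Local Notation Im := complex.Im.
Implicit Types u v w x y : H.

Lemma dotC u v : dot u v = Num.conj (dot v u).
Proof. by rewrite (hermC _ u v) expr0 mul1r. Qed.

Lemma dotDl u v w : dot (u + v) w = dot u w + dot v w.
Proof. exact: linearDl. Qed.
Lemma dotNl u w : dot (- u) w = - dot u w.
Proof. exact: linearNl. Qed.
Lemma dotBl u v w : dot (u - v) w = dot u w - dot v w.
Proof. exact: linearBl. Qed.
Lemma dotZl c u w : dot (c *: u) w = c * dot u w.
Proof. exact: linearZl_LR. Qed.
Lemma dot0l w : dot 0 w = 0.
Proof. exact: linear0l. Qed.
Lemma dotDr u v w : dot w (u + v) = dot w u + dot w v.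
Proof. exact: linearDr. Qed.
Lemma dotNr u w : dot w (- u) = - dot w u.
Proof. exact: linearNr. Qed.
Lemma dotBr u v w : dot w (u - v) = dot w u - dot w v.
Proof. exact: linearBr. Qed.
Lemma dotZr c u w : dot w (c *: u) = Num.conj c * dot w u.
Proof. exact: linearZr_LR. Qed.
Lemma dot0r w : dot w 0 = 0.
Proof. exact: linear0r. Qed.

Lemma dotuu u : dot u u = (nrm u ^+ 2)%:C.
Proof. by rewrite dot_norm -nrmE -rmorphXn. Qed.

Lemma Re_dotuu u : Re (dot u u) = nrm u ^+ 2.
Proof. by rewrite dotuu. Qed.

Lemma Re_dotC u v : Re (dot u v) = Re (dot v u).
Proof. by rewrite dotC Re_conj. Qed.

Lemma nrm_sqrD u v :
  nrm (u + v) ^+ 2 = nrm u ^+ 2 + nrm v ^+ 2 + 2 * Re (dot u v).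
Proof.
rewrite -!Re_dotuu !(dotDl, dotDr) !ReD (Re_dotC v u); ring.
Qed.

Lemma nrm_sqrB u v :
  nrm (u - v) ^+ 2 = nrm u ^+ 2 + nrm v ^+ 2 - 2 * Re (dot u v).
Proof. by rewrite nrm_sqrD nrmN dotNr ReN mulrN. Qed.

Lemma parallelogram u v :
  nrm (u + v) ^+ 2 + nrm (u - v) ^+ 2 = 2 * (nrm u ^+ 2 + nrm v ^+ 2).
Proof. rewrite nrm_sqrD nrm_sqrB; ring. Qed.

Lemma nrm_sqr_orth u v : dot u v = 0 -> nrm (u + v) ^+ 2 = nrm u ^+ 2 + nrm v ^+ 2.
Proof. by move=> uv; rewrite nrm_sqrD uv /= mulr0 addr0. Qed.

Lemma Re_conj_div (d : C) (q : R) : Re (Num.conj (d / q%:C) * d) = nrm d ^+ 2 / q.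
Proof.
rewrite -fmorphV conjM conj_real mulrAC (mulrC _ d) nrm_conj_sqr -rmorphM.
by [].
Qed.

Lemma cauchy_schwarz u v : nrm (dot u v) <= nrm u * nrm v.
Proof.
have [->|v0] := eqVneq v 0; first by rewrite dot0r !nrm0 mulr0.
have vp : 0 < nrm v by rewrite nrm_gt0.
rewrite -(@ler_pXn2r _ 2) ?nnegrE ?mulr_ge0 ?nrm_ge0 //.
pose a := dot u v / (nrm v ^+ 2)%:C.
have := sqr_ge0 (nrm (u - a *: v)).
rewrite nrm_sqrB dotZr nrmZ.
have -> : Re (Num.conj a * dot u v) = nrm (dot u v) ^+ 2 / nrm v ^+ 2.
  exact: Re_conj_div.
rewrite /a nrmM nrmV nrm_real ger0_norm ?sqr_ge0 // => h.
have : 0 <= (nrm u ^+ 2 - nrm (dot u v) ^+ 2 / nrm v ^+ 2) * nrm v ^+ 2.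
  rewrite mulr_ge0 ?sqr_ge0 //; apply: le_trans h _; rewrite le_eqVlt.
  apply/orP; left; apply/eqP; field; exact: lt0r_neq0.
rewrite mulrBl divfK ?expf_neq0 ?lt0r_neq0 // subr_ge0 exprMn; exact.
Qed.

Lemma Re_dot_le u v : Re (dot u v) <= nrm u * nrm v.
Proof. exact: le_trans (Re_le_nrm _) (cauchy_schwarz _ _). Qed.

Lemma dot_ext u v : (forall w, dot w u = dot w v) -> u = v.
Proof.
move=> h; apply/eqP; rewrite -subr_eq0 -nrm_eq0 -sqrf_eq0 -Re_dotuu.
by rewrite dotBr h subrr.
Qed.

(** The variation c = - dot p v / |v|^2 lowers the squared norm of p by |dot p v|^2 / |v|^2. *)
Lemma orth_of_min p v : (forall c : C, nrm p <= nrm (p + c *: v)) -> dot p v = 0.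
Proof.
move=> h; have [->|v0] := eqVneq v 0; first by rewrite dot0r.
have vp : 0 < nrm v by rewrite nrm_gt0.
apply/eqP; rewrite -nrm_eq0; apply/eqP.
have hv : nrm v ^+ 2 != 0 by rewrite expf_neq0 ?lt0r_neq0.
have := h (- (dot p v / (nrm v ^+ 2)%:C)).
rewrite -(@ler_pXn2r _ 2) ?nnegrE ?nrm_ge0 // scaleNr nrm_sqrB dotZr nrmZ.
rewrite Re_conj_div nrmM nrmV nrm_real ger0_norm ?sqr_ge0 //.
have -> : nrm p ^+ 2 + (nrm (dot p v) / nrm v ^+ 2 * nrm v) ^+ 2 -
  2 * (nrm (dot p v) ^+ 2 / nrm v ^+ 2) =
  nrm p ^+ 2 - nrm (dot p v) ^+ 2 / nrm v ^+ 2 by field; rewrite lt0r_neq0.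
rewrite lerBrDl addrC -lerBrDl subrr pmulr_lle0 ?invr_gt0 ?exprn_gt0 // => h2.
by apply/eqP; rewrite -sqrf_eq0 eq_le h2 sqr_ge0.
Qed.

End Hilb.

(** * Riesz representation and adjoints *)

Lemma le_eps (R : realType) (a b : R) :
  (forall e : R, 0 < e -> a <= b + e) -> a <= b.
Proof. by move=> h; apply/ler_addgt0Pr => e /h. Qed.

Section Complete.
Variables (R : realType) (V : normedModType R[i]).

Lemma gt0_complexE (e : R[i]) : 0 < e -> exists2 a : R, 0 < a & e = a%:C.
Proof. by case: e => a b; rewrite ltcE /= => /andP[/eqP -> a0]; exists a. Qed.

Lemma nrm_lt (x : V) (a : R) : (`|x| < a%:C) = (nrm x < a).
Proof. by rewrite -nrmE ltcR. Qed.

Lemma nrm_cvgP (T : Type) (F : set_system T) {FF : Filter F} (f : T -> V) (l : V) :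
  f @ F --> l <-> (forall e : R, 0 < e -> \forall t \near F, nrm (l - f t) < e).
Proof.
split=> [/cvgrPdist_lt h e e0|h].
  have /h : 0 < e%:C :> R[i] by rewrite ltcR.
  by apply: filterS => t; rewrite nrm_lt.
apply/cvgrPdist_lt => _ /gt0_complexE[a a0 ->].
by apply: filterS (h _ a0) => t; rewrite nrm_lt.
Qed.

Lemma nrm_cvgnP (f : nat -> V) (l : V) :
  f @ \oo --> l <->
  (forall e : R, 0 < e -> exists N, forall n, (N <= n)%N -> nrm (l - f n) < e).
Proof.
split=> [/nrm_cvgP h e /h[N _ hN]|h]; first by exists N => n /hN.
by apply/nrm_cvgP => e /h[N hN]; exists N.
Qed.

End Complete.

Lemma nrm_complete (R : realType) (V : completeNormedModType R[i]) (f : nat -> V) :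
  (forall e : R, 0 < e ->
     exists N, forall m n, (N <= m)%N -> (N <= n)%N -> nrm (f m - f n) < e) ->
  exists p : V, f @ \oo --> p.
Proof.
move=> h; apply/cvg_ex/cauchy_cvgP/cauchy_exP => _ /gt0_complexE[a a0 ->].
have [N hN] := h _ a0; exists (f N), N => // n /= Nn.
by rewrite -ball_normE /= nrm_lt hN.
Qed.

Section Hilb2.
Variables (R : realType) (H : completeNormedModType R[i]).
Variable dot : {dot H for Num.conj}.
Hypothesis dot_norm : forall u : H, dot u u = `|u| ^+ 2.
Local Notation C := R[i].
Local Notation Re := complex.Re.
Local Notation Im := complex.Im.
Implicit Types u v w x y : H.

(** S need not be closed, so p is only a limit of points of S. Stability under midpoints suffices:
    by the parallelogram law every minimizing sequence is Cauchy. It serves for the hyperplane in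
    [riesz] and for a range that is not known to be closed in [isolated_bound]. *)
Lemma min_norm_point (S : set H) :
  S !=set0 -> (forall u v, S u -> S v -> S ((2^-1)%:C *: (u + v))) ->
  exists p, (forall e, 0 < e -> exists2 x, S x & nrm (p - x) < e) /\
            (forall x, S x -> nrm p <= nrm x).
Proof.
move=> [s0 Ss0] mid.
pose B := [set nrm x | x in S]; pose m := inf B.
have infB : has_inf B.
  split; first by exists (nrm s0), s0.
  by exists 0 => _ [x _ <-]; exact: nrm_ge0.
have m0 : 0 <= m by apply: lb_le_inf; [by exists (nrm s0), s0|move=> _ [x _ <-]; exact: nrm_ge0].
have mle x : S x -> m <= nrm x by move=> Sx; apply: ge_inf; [exact: infB.2|exists x].
(* The right-hand side is 4 (m + e)^2 - 4 m^2: the midpoint lies in S, so that |u + v| >= 2 m. *)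
have key (e : R) u v : 0 <= e -> S u -> S v -> nrm u <= m + e -> nrm v <= m + e ->
    nrm (u - v) ^+ 2 <= 8 * m * e + 4 * e ^+ 2.
  move=> e0 Su Sv hu hv; have := mle _ (mid _ _ Su Sv).
  rewrite nrmZr ger0_norm ?invr_ge0 // ler_pdivlMl // => huv.
  have := parallelogram dot_norm u v.
  have : nrm u ^+ 2 <= (m + e) ^+ 2 by rewrite ler_pXn2r ?nnegrE ?nrm_ge0 ?addr_ge0.
  have : nrm v ^+ 2 <= (m + e) ^+ 2 by rewrite ler_pXn2r ?nnegrE ?nrm_ge0 ?addr_ge0.
  have : (2 * m) ^+ 2 <= nrm (u + v) ^+ 2.
    by rewrite ler_pXn2r ?nnegrE ?nrm_ge0 ?mulr_ge0.
  nra.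
have ex n : exists x, S x /\ nrm x <= m + n.+1%:R^-1.
  have : 0 < n.+1%:R^-1 :> R by rewrite invr_gt0.
  by move=> /(inf_adherent)/(_ infB)[_ [x Sx <-]] /ltW hx; exists x.
have [f hf] := choice ex.
have small (e : R) : 0 < e -> exists N, forall n, (N <= n)%N ->
    8 * m * n.+1%:R^-1 + 4 * n.+1%:R^-1 ^+ 2 < e.
  move=> e0; have K0 : 0 < e / (8 * m + 4) by rewrite divr_gt0 // ltr_wpDl ?mulr_ge0.
  have [N _ hN] := near_infty_natSinv_lt (PosNum K0).
  exists N => n /hN /=; rewrite ltr_pdivlMr ?ltr_wpDl ?mulr_ge0 //.
  apply: le_lt_trans; rewrite mulrDr mulrC; apply: lerD => //.
  rewrite mulrC ler_pM2r // expr2 ler_piMl ?invr_ge0 //.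
  by rewrite invf_le1 // ler1n.
have [p /nrm_cvgnP cp] : exists p : H, f @ \oo --> p.
  apply: nrm_complete => e e0; have [N hN] := small _ (exprn_gt0 2 e0).
  exists N => i j Ni Nj; rewrite -(@ltr_pXn2r _ 2) ?nnegrE ?nrm_ge0 ?(ltW e0) //.
  apply: le_lt_trans (hN N _) => //.
  apply: key; rewrite ?invr_ge0 //; [exact: (hf i).1|exact: (hf j).1| |].
    apply: le_trans (hf i).2 _; rewrite lerD2l lef_pV2 ?posrE // ler_nat ltnS //.
  apply: le_trans (hf j).2 _; rewrite lerD2l lef_pV2 ?posrE // ler_nat ltnS //.
exists p; split=> [e /cp[N hN]|x Sx].
  by exists (f N); [exact: (hf N).1|exact: hN].
apply: le_trans (mle _ Sx); apply: le_eps => e e0.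
have [N hN] := cp _ (divr_gt0 e0 (ltr0n _ 2)).
have e2 : 0 < e / 2 by rewrite divr_gt0.
have [N' _ hN'] := near_infty_natSinv_lt (PosNum e2).
pose n := maxn N N'; have h1 := hN n (leq_maxl _ _).
have /= h2 := hN' n (leq_maxr _ _).
rewrite -(subrK (f n) p); apply: le_trans (nrmD _ _) _.
apply: le_trans (lerD (ltW h1) (hf n).2) _.
by rewrite addrCA lerD2l {2}(splitr e) lerD2l; exact: ltW h2.
Qed.

Definition bounded_functional (f : H -> C) :=
  exists2 k : R, 0 <= k & forall u, nrm (f u) <= k * nrm u.

(** The representing vector is p / |p|^2, with p the point of least norm in the hyperplane f = 1:
    the kernel of f is orthogonal to p. As p is only a limit of points of the hyperplane, f p = 1
    comes from the boundedness of f. *)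
Lemma riesz (f : H -> C) : (forall c u v, f (c *: u + v) = c * f u + f v) ->
  bounded_functional f -> exists w, forall u, f u = dot u w.
Proof.
move=> lin [k k0 fk].
have f0 : f 0 = 0 by have := lin (-1) 0 0; rewrite scaler0 addr0 mulN1r addNr.
have fZ c u : f (c *: u) = c * f u by have := lin c u 0; rewrite f0 !addr0.
have fD u v : f (u + v) = f u + f v by have := lin 1 u v; rewrite scale1r mul1r.
have [fz|] := pselect (forall u, f u = 0).
  by exists 0 => u; rewrite dot0r fz.
move=> /existsNP[u0 /eqP fu0].
have [] := @min_norm_point [set u | f u = 1].
- by exists ((f u0)^-1 *: u0); rewrite /= fZ mulVf.
- move=> u v /= fu fv; rewrite fZ fD fu fv -mulr2n.
  have -> : (1 *+ 2 : C) = (2 : R)%:C by rewrite rmorph_nat.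
  by rewrite -rmorphM /= mulVf ?pnatr_eq0.
move=> p [papp pmin].
have fp : f p = 1.
  apply/eqP; rewrite -subr_eq0 -nrm_eq0 eq_le nrm_ge0 andbT.
  apply: le_eps => e e0; rewrite add0r.
  have k1 : 0 < k + 1 by rewrite ltr_wpDl.
  have [x /= fx hx] := papp _ (divr_gt0 e0 k1).
  rewrite -fx -mulN1r -fZ -fD scaleN1r; apply: le_trans (fk _) _.
  rewrite ltr_pdivlMr // in hx; apply: le_trans (ltW hx).
  by rewrite mulrC ler_wpM2l ?nrm_ge0 // lerDl.
have p0 : p != 0 by apply/eqP => p0; move: fp; rewrite p0 f0 => /eqP; rewrite eq_sym oner_eq0.
have orth u : f u = 0 -> dot p u = 0.
  by move=> fu; apply: (orth_of_min dot_norm) => c; apply: pmin => /=; rewrite fD fZ fu mulr0 addr0.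
have np : (nrm p ^+ 2)%:C != 0 :> C by rewrite (inj_eq (@complexI R) _ 0) expf_neq0 ?nrm_eq0.
exists (((nrm p ^+ 2)%:C)^-1 *: p) => u.
have := orth (u - f u *: p); rewrite fD -scaleN1r !fZ fp mulr1 mulN1r subrr => /(_ erefl).
rewrite scaleN1r dotC => /(congr1 Num.conj); rewrite conjCK rmorph0 dotBl dotZl (dotuu dot_norm).
move/eqP; rewrite subr_eq0 => /eqP h.
by rewrite dotZr -fmorphV conj_real h fmorphV mulrC mulfK.
Qed.

Section Adj.
Variable A : {linear H -> H}.
Hypothesis A_bounded : bounded_on setT A.

Lemma bounded_pos : exists2 k : R, 0 <= k & forall x, nrm (A x) <= k * nrm x.
Proof.
case: A_bounded => k hk; exists (Num.max k 0); first by rewrite le_max lexx orbT.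
by move=> x; apply: le_trans (hk x I) _; rewrite ler_wpM2r ?nrm_ge0 // le_max lexx.
Qed.

Local Notation "A ^#" := (adjoint dot A) (at level 2).

Lemma adjointP u v : dot (A u) v = dot u (A^# v).
Proof.
move: u; rewrite /adjoint.
have [w hw] : exists w, forall u, dot (A u) v = dot u w.
  apply: (riesz (f := fun u => dot (A u) v)) => [c x y|].
    by rewrite linearP dotDl dotZl.
  have [k k0 hk] := bounded_pos; exists (k * nrm v); first by rewrite mulr_ge0 ?nrm_ge0.
  move=> x; apply: le_trans (cauchy_schwarz dot_norm _ _) _.
  by rewrite mulrAC ler_wpM2r ?nrm_ge0.
by case: xgetP => [x _ //|/(_ w)/(_ hw)].
Qed.

Lemma adjointP' u v : dot (A^# u) v = dot u (A v).
Proof. by rewrite dotC -adjointP -dotC. Qed.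

Lemma adjoint_linear : linear (A^#).
Proof.
move=> c u v; apply: (dot_ext dot_norm) => w.
by rewrite dotDr dotZr -!adjointP dotDr dotZr.
Qed.

Lemma adjoint_bounded : exists2 k : R, 0 <= k & forall x, nrm (A^# x) <= k * nrm x.
Proof.
have [k k0 hk] := bounded_pos; exists k => // x.
have [->|] := eqVneq (A^# x) 0; first by rewrite nrm0 mulr_ge0 ?nrm_ge0.
rewrite -nrm_gt0 => p.
rewrite -(ler_pM2r p) -expr2 -(Re_dotuu dot_norm) adjointP'.
apply: le_trans (Re_dot_le dot_norm _ _) _; rewrite mulrAC mulrC.
by rewrite ler_wpM2r ?nrm_ge0.
Qed.

Hypothesis A_normal : normal_op dot A.

Lemma nrm_adjoint x : nrm (A^# x) = nrm (A x).
Proof.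
apply/eqP; rewrite -(@eqrXn2 _ 2) ?nrm_ge0 //.
by rewrite -!(Re_dotuu dot_norm) adjointP' adjointP A_normal.
Qed.

End Adj.

End Hilb2.

(** * Polynomials in a normal operator and its adjoint *)

(* Polynomials in z and its conjugate, evaluated at complex numbers by [val] and at the
   pair (A, A^* ) by [opv]. *)
Inductive expr (R : realType) :=
  EZ | EZb | EC of R[i] | EAdd of expr R & expr R | EMul of expr R & expr R.
Arguments EZ {R}.
Arguments EZb {R}.

Fixpoint val (R : realType) (e : expr R) (m : R[i]) : R[i] :=
  match e with
  | EZ => m
  | EZb => Num.conj m
  | EC c => c
  | EAdd f g => val f m + val g m
  | EMul f g => val f m * val g m
  end.

(** The reversal of products makes [opv (cj e)] the adjoint of [opv e] by structural induction,
    without commutation. *)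
Fixpoint cj (R : realType) (e : expr R) : expr R :=
  match e with
  | EZ => EZb
  | EZb => EZ
  | EC c => EC (Num.conj c)
  | EAdd f g => EAdd (cj f) (cj g)
  | EMul f g => EMul (cj g) (cj f)
  end.

Definition ESub (R : realType) (e : expr R) (c : R[i]) := EAdd e (EC (- c)).

Lemma val_cj (R : realType) (e : expr R) m : val (cj e) m = Num.conj (val e m).
Proof.
elim: e => //= [|f IHf g IHg|f IHf g IHg]; first by rewrite conjCK.
  by rewrite IHf IHg conjD.
by rewrite IHf IHg conjM mulrC.
Qed.

Section Calc.
Variables (R : realType) (H : completeNormedModType R[i]).
Variable dot : {dot H for Num.conj}.
Hypothesis dot_norm : forall u : H, dot u u = `|u| ^+ 2.
Variable A : {linear H -> H}.
Hypothesis A_bounded : bounded_on setT A.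
Hypothesis A_normal : normal_op dot A.
Local Notation C := R[i].
Local Notation Re := complex.Re.
Local Notation Im := complex.Im.
Local Notation Ad := (adjoint dot A).
Implicit Types (u v w x y : H) (V : set H) (e f g h : expr R).

Fixpoint opv e x : H :=
  match e with
  | EZ => A x
  | EZb => Ad x
  | EC c => c *: x
  | EAdd f g => opv f x + opv g x
  | EMul f g => opv f (opv g x)
  end.

Lemma opvP e : linear (opv e).
Proof.
elim: e => [||c|f IHf g IHg|f IHf g IHg] a x y /=.
- exact: linearP.
- exact: (adjoint_linear dot_norm A_bounded).
- by rewrite scalerDr !scalerA mulrC.
- by rewrite IHf IHg scalerDr addrACA.
- by rewrite IHg IHf.
Qed.

Lemma opv0 e : opv e 0 = 0.
Proof. by have := opvP e (-1) 0 0; rewrite scaler0 addr0 scaleN1r addNr. Qed.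
Lemma opvZ e c x : opv e (c *: x) = c *: opv e x.
Proof. by have := opvP e c x 0; rewrite opv0 !addr0. Qed.
Lemma opvD e x y : opv e (x + y) = opv e x + opv e y.
Proof. by have := opvP e 1 x y; rewrite !scale1r. Qed.
Lemma opvN e x : opv e (- x) = - opv e x.
Proof. by rewrite -scaleN1r opvZ scaleN1r. Qed.
Lemma opvB e x y : opv e (x - y) = opv e x - opv e y.
Proof. by rewrite opvD opvN. Qed.

Lemma opv_bounded e : exists2 k : R, 0 < k & forall x, nrm (opv e x) <= k * nrm x.
Proof.
have pos k : 0 <= k -> 0 < k + 1 by move=> k0; rewrite ltr_wpDl.
elim: e => [||c|f [k k0 IHf] g [l l0 IHg]|f [k k0 IHf] g [l l0 IHg]] /=.
- have [k k0 hk] := bounded_pos A_bounded; exists (k + 1); first exact: pos.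
  by move=> x; apply: le_trans (hk x) _; rewrite ler_wpM2r ?nrm_ge0 // lerDl.
- have [k k0 hk] := adjoint_bounded dot_norm A_bounded; exists (k + 1); first exact: pos.
  by move=> x; apply: le_trans (hk x) _; rewrite ler_wpM2r ?nrm_ge0 // lerDl.
- exists (nrm c + 1); first exact/pos/nrm_ge0.
  by move=> x; rewrite nrmZ ler_wpM2r ?nrm_ge0 // lerDl.
- exists (k + l); first exact: addr_gt0.
  move=> x; apply: le_trans (nrmD _ _) _; rewrite mulrDl; exact: lerD.
- exists (k * l); first exact: mulr_gt0.
  move=> x; apply: le_trans (IHf _) _; rewrite -mulrA ler_wpM2l //; exact: ltW.
Qed.

Lemma opv_adj e x y : dot (opv e x) y = dot x (opv (cj e) y).
Proof.
elim: e x y => [||c|f IHf g IHg|f IHf g IHg] x y /=.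
- exact: (adjointP dot_norm A_bounded).
- exact: (adjointP' dot_norm A_bounded).
- by rewrite dotZl dotZr conjCK.
- by rewrite dotDl dotDr IHf IHg.
- by rewrite IHf IHg.
Qed.

Lemma opv_comm e f x : opv e (opv f x) = opv f (opv e x).
Proof.
have cA h y : A (opv h y) = opv h (A y).
  elim: h y => [||c|h IHh g IHg|h IHh g IHg] y //=.
  - by rewrite linearZ.
  - by rewrite linearD IHh IHg.
  - by rewrite IHh IHg.
have cB h y : Ad (opv h y) = opv h (Ad y).
  elim: h y => [||c|h IHh g IHg|h IHh g IHg] y //=.
  - exact: (opvZ EZb).
  - by rewrite -IHh -IHg; exact: (opvD EZb).
  - by rewrite IHh IHg.
elim: e x => [||c|h IHh g IHg|h IHh g IHg] x //=.
- by rewrite opvZ.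
- by rewrite opvD IHh IHg.
- by rewrite IHg IHh.
Qed.

Lemma nrm_adjoint_sub m x : nrm (Ad x - Num.conj m *: x) = nrm (A x - m *: x).
Proof.
apply/eqP; rewrite -(@eqrXn2 _ 2) ?nrm_ge0 //.
rewrite !(nrm_sqrB dot_norm) !nrmZ nrm_conj (nrm_adjoint dot_norm A_bounded A_normal).
rewrite !dotZr conjCK (adjointP' dot_norm A_bounded) (dotC dot x) .
have -> : m * Num.conj (dot (A x) x) = Num.conj (Num.conj m * dot (A x) x).
  by rewrite conjM conjCK.
by rewrite Re_conj.
Qed.

(** An approximate eigenvector of A for m is thus one of every polynomial in A and its adjoint. The
    case of the adjoint is where normality enters; products use f g - f(m) g(m) = f (g - g(m)) +
    g(m) (f - f(m)). *)
Lemma opv_val e m :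
  exists2 k : R, 0 < k & forall x, nrm (opv e x - val e m *: x) <= k * nrm (A x - m *: x).
Proof.
elim: e => [||c|f [k k0 IHf] g [l l0 IHg]|f [k k0 IHf] g [l l0 IHg]] /=.
- by exists 1 => // x; rewrite mul1r.
- by exists 1 => // x; rewrite mul1r nrm_adjoint_sub.
- by exists 1 => // x; rewrite subrr nrm0 mul1r nrm_ge0.
- exists (k + l); first exact: addr_gt0.
  move=> x; rewrite scalerDl opprD addrACA; apply: le_trans (nrmD _ _) _.
  by rewrite mulrDl; exact: lerD.
- have [b b0 hb] := opv_bounded f.
  exists (b * l + nrm (val g m) * k).
    by rewrite ltr_pwDl ?mulr_gt0 // mulr_ge0 ?nrm_ge0 // ltW.
  move=> x; rewrite -(subrK (opv f (val g m *: x)) (opv f _)) -opvB -addrA.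
  apply: le_trans (nrmD _ _) _; rewrite mulrDl -!mulrA; apply: lerD.
    by apply: le_trans (hb _) _; rewrite ler_pM2l.
  by rewrite opvZ (mulrC (val f m)) -scalerA -scalerBr nrmZ ler_wpM2l ?nrm_ge0.
Qed.

Definition reducing V := [/\ subsp V, (forall x, V x -> V (A x)) & (forall x, V x -> V (Ad x))].

Lemma opv_reducing V e x : reducing V -> V x -> V (opv e x).
Proof.
move=> [sV VA VB]; elim: e x => [||c|f IHf g IHg|f IHf g IHg] x Vx /=.
- exact: VA.
- exact: VB.
- exact: subspZ.
- by apply: subspD => //; [exact: IHf|exact: IHg].
- exact/IHf/IHg.
Qed.

(* Approximate point spectrum of the restriction of A to V. *)
Definition sap V (m : C) :=
  forall d : R, 0 < d -> exists x, [/\ V x, nrm x = 1 & nrm (A x - m *: x) < d].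

(** Such a q collects the defects of the approximate eigenvector equations imposed so far. The last
    clause, which commutation will guarantee, keeps vectors with small q small under A and its
    adjoint. *)
Definition calc_seminorm (q : H -> R) :=
  [/\ (forall x, 0 <= q x), (forall x y, q (x + y) <= q x + q y),
      (forall c x, q (c *: x) = nrm c * q x)
    & forall e, exists2 k : R, 0 < k & forall x, q (opv e x) <= k * q x].

Lemma normalize x : x != 0 -> exists c : R, [/\ 0 < c, c * nrm x = 1 & nrm (c%:C *: x) = 1].
Proof.
rewrite -nrm_gt0 => x0; exists (nrm x)^-1; rewrite invr_gt0 mulVf ?gt_eqF //.
by split=> //; rewrite nrmZr gtr0_norm ?invr_gt0 // mulVf ?gt_eqF.
Qed.

(* If h is bounded below by b on the approximate kernel of q, optimally, then
   h - b is small on near-minimizers: perturb x in the direction (h - b) x. *)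
Lemma joint_approx_step V q h : reducing V -> calc_seminorm q ->
  (forall x y, dot (opv h x) y = dot x (opv h y)) ->
  (forall d, 0 < d -> exists x, [/\ V x, nrm x = 1 & q x < d]) ->
  exists b : R, (forall x, V x -> q x = 0 -> b * nrm x ^+ 2 <= Re (dot (opv h x) x)) /\
    forall d, 0 < d -> exists x, [/\ V x, nrm x = 1 & q x + nrm (opv h x - b%:C *: x) < d].
Proof.
move=> rV [q0 qD qZ qe] sa ap; have [sV _ _] := rV.
have [k k0 hk] := opv_bounded h; have [l l0 hl] := qe h.
(* Lower bounds of the form of h on unit vectors with small q; how small may depend on b. Their
   supremum is the optimal bound. *)
pose S := [set b : R | exists2 d, 0 < d & forall x, V x -> nrm x = 1 -> q x < d ->
   b <= Re (dot (opv h x) x)].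
have Sk : S (- k).
  exists 1 => // x _ x1 _; have := Re_dot_le dot_norm (- opv h x) x.
  rewrite dotNl ReN nrmN x1 mulr1 => H1; rewrite lerNl; apply: le_trans H1 _.
  by have := hk x; rewrite x1 mulr1.
have ubS : ubound S k.
  move=> b [d d0 hb]; have [x [Vx x1 qx]] := ap _ d0.
  apply: le_trans (hb _ Vx x1 qx) _; apply: le_trans (Re_dot_le dot_norm _ _) _.
  by rewrite x1 mulr1; have := hk x; rewrite x1 mulr1.
have hS : has_sup S by split; [exists (- k)|exists k].
pose b := sup S; exists b.
have P1 t : 0 < t -> exists2 d, 0 < d & forall x, V x -> q x < d * nrm x ->
    (b - t) * nrm x ^+ 2 <= Re (dot (opv h x) x).
  move=> /sup_adherent/(_ hS)[b' [d d0 hb'] bb']; exists d => // x Vx qx.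
  have [x0|x0] := eqVneq x 0.
    by move: qx; rewrite x0 nrm0 mulr0 ltNge q0.
  have [c [c0 cx cx1]] := normalize x0.
  have xE : nrm x = c^-1 by apply: (mulfI (lt0r_neq0 c0)); rewrite cx divff ?gt_eqF.
  have := hb' _ (subspZ c%:C sV Vx) cx1.
  rewrite qZ nrm_real gtr0_norm // mulrC -ltr_pdivlMr // -xE => /(_ qx).
  rewrite opvZ dotZl dotZr conj_real mulrA -rmorphM ReZ => H1.
  rewrite xE exprVn expr2 ler_pdivrMr ?mulr_gt0 // mulrC.
  exact: le_trans (ltW bb') H1.
have P2 d t : 0 < d -> 0 < t -> exists x, [/\ V x, nrm x = 1, q x < d &
    Re (dot (opv h x) x) < b + t].
  move=> d0 t0; apply: contrapT => nx.
  have : S (b + t).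
    exists d => // x Vx x1 qx; rewrite leNgt; apply/negP => hx.
    by apply: nx; exists x.
  by move=> /(ub_le_sup hS.2); rewrite gerDl leNgt t0.
split=> [x Vx qx|d d0].
  apply: le_eps => t t0.
  have [x0|x0] := eqVneq x 0.
    by rewrite x0 nrm0 expr0n mulr0 opv0 dot0l add0r ltW.
  have nx : 0 < nrm x ^+ 2 by rewrite exprn_gt0 ?nrm_gt0.
  have [d d0 /(_ x Vx)] := P1 _ (divr_gt0 t0 nx).
  rewrite qx mulr_gt0 ?nrm_gt0 // => /(_ isT).
  by rewrite mulrBl divfK ?gt_eqF // lerBlDr.
pose K := k + `|b|; have K0 : 0 < K by rewrite ltr_pwDl.
pose s := (2 * K)^-1; have s0 : 0 < s by rewrite invr_gt0 mulr_gt0.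
have sK : s * K = 2^-1 by rewrite /s invfM mulrVK ?unitfE ?gt_eqF.
(* The final estimates give 3/2 s |y|^2 <= 13/4 t, hence |y|^2 <= 13/3 K t = 13 d^2 / 144, which is
   below (d / 2)^2. *)
have t0 : 0 < d ^+ 2 / (48 * K) by rewrite divr_gt0 ?exprn_gt0 ?mulr_gt0.
set t := _ / _ in t0.
have [d1 d10 h1] := P1 _ t0.
pose M := 1 + s * (l + `|b|).
have M0 : 0 < M by rewrite ltr_pwDl // mulr_ge0 ?addr_ge0 // ltW.
(* The first bound is half of the target d; the second gives q x' < d1 |x'| for the perturbed vector
   x', whose norm is at least 1/2. *)
have d20 : 0 < Num.min (d / 2) (d1 / 2 / M) by rewrite lt_min !divr_gt0.
have [x [Vx x1]] := P2 _ _ d20 t0.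
rewrite lt_min => /andP[qx1 qx2] hx; exists x; split => //.
pose y := opv h x - b%:C *: x; rewrite -/y.
have Vy : V y by apply: subspB => //; [exact: opv_reducing|exact: subspZ].
have yK : nrm y <= K.
  apply: le_trans (nrmB _ _) _; rewrite nrmZr x1 mulr1 lerD2r.
  by have := hk x; rewrite x1 mulr1.
have qy : q y <= (l + `|b|) * q x.
  apply: le_trans (qD _ _) _; rewrite -scaleNr qZ mulrDl lerD ?hl //.
  by rewrite -rmorphN nrm_real normrN.
(* A descent step for the form of h - b. Its value at x' is Re (dot y x) - 2 s |y|^2 plus at most s
   |y|^2 / 2, and it cannot lie below - t |x'|^2; this bounds |y|^2 by a multiple of t / s. *)
pose x' := x - s%:C *: y.
have Vx' : V x' by apply: subspB => //; exact: subspZ.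
have sy : nrm (s%:C *: y) <= 2^-1.
  by rewrite nrmZr gtr0_norm // -sK ler_pM2l.
have nx'1 : 2^-1 <= nrm x'.
  have := nrm_lerB x (- (s%:C *: y)); rewrite nrmN x1; move: sy; rewrite -/x'; lra.
have nx'2 : nrm x' <= 3 / 2.
  have := nrmB x (s%:C *: y); rewrite x1; move: sy; rewrite -/x'; lra.
have qx' : q x' < d1 * nrm x'.
  have : q x' <= M * q x.
    apply: le_trans (qD _ _) _; rewrite -scaleNr qZ /M mulrDl mul1r lerD2l.
    by rewrite -rmorphN nrm_real normrN gtr0_norm // -mulrA ler_pM2l.
  move=> /le_lt_trans; apply; rewrite mulrC; move: qx2; rewrite ltr_pdivlMr // => /lt_le_trans.
  by apply; rewrite ler_pM2l.
have := h1 _ Vx' qx'.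
have -> : Re (dot (opv h x') x') = b * nrm x' ^+ 2 + Re (dot y x) - 2 * s * nrm y ^+ 2
    + s ^+ 2 * (Re (dot (opv h y) y) - b * nrm y ^+ 2).
  have hxE : opv h x = y + b%:C *: x by rewrite subrK.
  clearbody y; rewrite -!(Re_dotuu dot_norm) /x' opvB opvZ.
  have e2 : dot (opv h y) x = dot y y + b%:C * dot y x.
    by rewrite sa hxE dotDr dotZr conj_real.
  rewrite hxE !(dotNl, dotNr, dotDl, dotDr, dotZl, dotZr, conj_real) e2.
  rewrite !(ReD, ReN, ReZ) (Re_dotC dot x y); ring.
have hyy : Re (dot (opv h y) y) - b * nrm y ^+ 2 <= K * nrm y ^+ 2.
  rewrite mulrDl; apply: lerD.
    apply: le_trans (Re_dot_le dot_norm _ _) _; rewrite expr2 mulrA ler_wpM2r ?nrm_ge0 //.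
  by rewrite -mulNr ler_wpM2r ?sqr_ge0 // -normrN ler_norm.
have yx : Re (dot y x) < t.
  by rewrite dotBl dotZl ReD ReN ReZ (Re_dotuu dot_norm) x1; move: hx; lra.
have ns : nrm x' ^+ 2 <= 9 / 4 by have := nrm_ge0 x'; nra.
move=> hmain.
have hs2 : s ^+ 2 * (Re (dot (opv h y) y) - b * nrm y ^+ 2) <= s / 2 * nrm y ^+ 2.
  have : s ^+ 2 * (Re (dot (opv h y) y) - b * nrm y ^+ 2) <= s ^+ 2 * (K * nrm y ^+ 2).
    by rewrite ler_wpM2l // sqr_ge0.
  by rewrite (mulrA _ K) [in leRHS]expr2 -(mulrA s s K) sK.
have ty : 3 / 2 * (s * nrm y ^+ 2) <= 13 / 4 * t.
  have := ler_wpM2l (ltW t0) ns; nra.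
have ty2 : nrm y ^+ 2 < (d / 2) ^+ 2.
  have : nrm y ^+ 2 = 2 * (K * (s * nrm y ^+ 2)).
    by rewrite (mulrA K) (mulrC K) sK mulrA divff ?mul1r ?pnatr_eq0.
  have : K * t = d ^+ 2 / 48 by rewrite /t; field; rewrite gt_eqF.
  have := ler_wpM2l (ltW K0) ty; have := exprn_gt0 2 d0; nra.
have : nrm y < d / 2 by rewrite -(@ltr_pXn2r _ 2) ?nnegrE ?nrm_ge0 // ltW // divr_gt0.
by move: qx1; lra.
Qed.

Lemma calc_seminorm0 : calc_seminorm (fun=> 0).
Proof.
by split=> [x|x y|c x|e]; rewrite ?addr0 ?mulr0 //; exists 1 => // x; rewrite mulr0.
Qed.

Lemma calc_seminormD q h (b : R) : calc_seminorm q ->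
  calc_seminorm (fun x => q x + nrm (opv h x - b%:C *: x)).
Proof.
move=> [q0 qD qZ qe].
have E x : opv h x - b%:C *: x = opv (ESub h b%:C) x by rewrite /= scaleNr.
split=> [x|x y|c x|e].
- by rewrite addr_ge0 ?nrm_ge0.
- rewrite !E opvD [leRHS]addrACA; apply: lerD; [exact: qD|exact: nrmD].
- by rewrite !E opvZ qZ nrmZ mulrDr.
- have [k k0 hk] := qe e; have [l l0 hl] := opv_bounded e; exists (k + l).
    exact: addr_gt0.
  move=> x; rewrite !E opv_comm; apply: le_trans (lerD (hk _) (hl _)) _.
  rewrite mulrDl !mulrDr; have := mulr_ge0 (ltW l0) (q0 x).
  by have := mulr_ge0 (ltW k0) (nrm_ge0 (opv (ESub h b%:C) x)); lra.
Qed.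

(* A near-minimizer of the quadratic form is made, by three applications of
   [joint_approx_step] (to Re e, Re A and Im A), an approximate eigenvector of A, whose
   eigenvalue is then a point mu of [sap V] with Re (e mu) close to the minimum. *)
Theorem spectral_lower_bound V e (m : R) : reducing V ->
  (forall mu, sap V mu -> m <= Re (val e mu)) ->
  forall x, V x -> m * nrm x ^+ 2 <= Re (dot (opv e x) x).
Proof.
move=> rV hm x Vx; have [sV _ _] := rV.
have [->|x0] := eqVneq x 0; first by rewrite nrm0 expr0n mulr0 dot0r.
have [c [_ _ cx1]] := normalize x0.
pose half : C := (2^-1 : R)%:C.
have conj_half : Num.conj half = half by exact: conj_real.
pose h0 := EMul (EC half) (EAdd e (cj e)).
pose X : expr R := EMul (EC half) (EAdd EZ EZb).
pose Y : expr R := EMul (EC (- 'i%C * half)) (EAdd EZ (EMul (EC (-1)) EZb)).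
have hh (a : C) : half * a + half * a = a.
  by rewrite -mulrDl -rmorphD /= [2^-1 + _](_ : _ = 1) ?mul1r //; lra.
have cji : Num.conj ('i%C : C) = - 'i%C by apply/eqP; rewrite eq_complex /= oppr0 !eqxx.
have sa0 u v : dot (opv h0 u) v = dot u (opv h0 v).
  rewrite /= dotZl dotZr dotDl dotDr !opv_adj conj_half; congr (_ * _).
  have cjK f : forall w, opv (cj (cj f)) w = opv f w.
    elim: f => //= [a w|f IHf g IHg w|f IHf g IHg w]; first by rewrite conjCK.
      by rewrite IHf IHg.
    by rewrite IHf IHg.
  by rewrite cjK addrC.
have saX u v : dot (opv X u) v = dot u (opv X v).
  rewrite /= dotZl dotZr dotDl dotDr conj_half (adjointP dot_norm A_bounded).
  by rewrite (adjointP' dot_norm A_bounded) addrC.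
have saY u v : dot (opv Y u) v = dot u (opv Y v).
  rewrite /= dotZl dotZr dotDl dotDr dotZl dotZr (adjointP dot_norm A_bounded).
  rewrite (adjointP' dot_norm A_bounded) conjM conjN cji conj_half.
  by rewrite [Num.conj (-1)]conjN rmorph1; ring.
(* The real part of e comes first: with q = 0 its optimal bound b0 is valid on all of V. For X and Y
   only the approximate eigenvector equations matter. *)
have q1 := calc_seminorm0.
have [b0 [hb0 ap1]] : exists b : R,
    (forall x, V x -> 0 = 0 :> R -> b * nrm x ^+ 2 <= Re (dot (opv h0 x) x)) /\
    forall d, 0 < d -> exists x, [/\ V x, nrm x = 1 & 0 + nrm (opv h0 x - b%:C *: x) < d].
  apply: (joint_approx_step rV q1 sa0) => d d0.
  by exists (c%:C *: x); split=> //; exact: subspZ.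
have q2 := calc_seminormD h0 b0 q1.
have [b1 [_ ap2]] := joint_approx_step rV q2 saX ap1.
have q3 := calc_seminormD X b1 q2.
have [b2 [_ ap3]] := joint_approx_step rV q3 saY ap2.
pose mu := b1%:C + 'i%C * b2%:C.
have muE u : A u - mu *: u = (opv X u - b1%:C *: u) + 'i%C *: (opv Y u - b2%:C *: u).
  have ii : 'i%C * (- 'i%C * half) = half :> C.
    by rewrite mulrA mulrN -expr2 sqr_i opprK mul1r.
  rewrite /= !scalerBr !scalerA ii scaleN1r scalerDl !scalerDr scalerN.
  rewrite -{1}(scale1r (A u)) -{1}(hh 1) !mulr1 scalerDl opprD.
  set a := half *: A u; set a' := half *: Ad u.
  by rewrite addrACA -!addrA; congr (_ + _); rewrite [RHS]addrCA; congr (_ + _);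
     rewrite addrCA [a' + (_ + _)]addrA addrA addrN add0r.
have sapmu : sap V mu.
  move=> d d0; have [y [Vy y1]] := ap3 _ d0; rewrite add0r => hy; exists y; split=> //.
  rewrite muE; apply: le_lt_trans (nrmD _ _) _; rewrite nrmZ.
  have -> : nrm ('i%C : C) = 1.
    by apply/eqP; rewrite -(@eqrXn2 _ 2) ?nrm_ge0 // nrmc_sqr /= expr0n add0r.
  by rewrite mul1r; apply: le_lt_trans hy; rewrite -addrA lerDr nrm_ge0.
have v0 : val h0 mu = (Re (val e mu))%:C.
  rewrite /= val_cj -[LHS]/(half * (_ + _)) addcJ mulrA -(rmorph_nat (real_complex R)).
  by rewrite -rmorphM /= mulVf ?pnatr_eq0 // mul1r.
(* The same unit vectors are approximate eigenvectors of h0 for b0 by construction and for the value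
   of h0 at mu by [opv_val], so the two numbers agree. *)
have b0E : b0 = Re (val e mu).
  have [k k0 hk] := opv_val h0 mu.
  have hd d : 0 < d -> nrm ((b0 - Re (val e mu))%:C : C) <= 0 + d.
    move=> d0; have k1 : 0 < 1 + k by rewrite ltr_pwDl // ltW.
    have [y [Vy y1]] := ap3 _ (divr_gt0 d0 k1).
    rewrite ltr_pdivlMr // add0r => hy.
    have := nrmB (opv h0 y - val h0 mu *: y) (opv h0 y - b0%:C *: y).
    rewrite opprB addrC addrA subrK v0 -scalerBl -rmorphB nrmZ y1 mulr1 => h1.
    apply: (le_trans (y := nrm (opv h0 y - (Re (val e mu))%:C *: y) +
      nrm (opv h0 y - b0%:C *: y))); first exact: h1.
    have := hk y; rewrite v0 => hky; apply: le_trans (lerD hky (lexx _)) _.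
    rewrite add0r; apply: le_trans (ltW hy); rewrite muE.
    have : nrm ('i%C : C) = 1.
      by apply/eqP; rewrite -(@eqrXn2 _ 2) ?nrm_ge0 // nrmc_sqr /= expr0n add0r.
    have := nrmD (opv X y - b1%:C *: y) ('i%C *: (opv Y y - b2%:C *: y)).
    rewrite nrmZ => h2 ni; rewrite ni mul1r in h2.
    have := ler_wpM2l (ltW k0) h2.
    have := nrm_ge0 (opv h0 y - b0%:C *: y).
    have := nrm_ge0 (opv X y - b1%:C *: y).
    have := nrm_ge0 (opv Y y - b2%:C *: y).
    nra.
  apply/eqP; rewrite -subr_eq0 -(inj_eq (@complexI R)) -nrm_eq0 eq_le nrm_ge0 andbT.
  exact: le_eps.
have := hb0 _ Vx erefl.
have -> : Re (dot (opv h0 x) x) = Re (dot (opv e x) x).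
  rewrite /= dotZl dotDl ReZ ReD -[dot (opv (cj e) x) x]conjCK -dotC Re_conj -opv_adj.
  lra.
apply: le_trans; rewrite ler_wpM2r ?sqr_ge0 // b0E; exact: hm.
Qed.

End Calc.

(** * Orthogonal projections onto finite-dimensional subspaces *)

Section Proj.
Variables (R : realType) (H : completeNormedModType R[i]).
Variable dot : {dot H for Num.conj}.
Hypothesis dot_norm : forall u : H, dot u u = `|u| ^+ 2.
Local Notation C := R[i].
Implicit Types (u v w x y : H) (M : set H).

Lemma dotuu0 u : dot u u = 0 -> u = 0.
Proof.
move=> h; apply/eqP; rewrite -nrm_eq0 -sqrf_eq0 -(Re_dotuu dot_norm) h; exact: eqxx.
Qed.

Lemma dot_eq0C u v : dot u v = 0 -> dot v u = 0.
Proof. by move=> h; rewrite dotC h rmorph0. Qed.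

Lemma proj_ex M u : findim_subspace M ->
  exists v, M v /\ forall w, M w -> dot (u - v) w = 0.
Proof.
move=> [s ->{M}]; elim: s u => [|x s IH] u.
  by rewrite lspan_nil; exists 0; split=> // _ ->; rewrite dot0r.
have [x' [sx' hx']] := IH x; have [u' [su' hu']] := IH u.
pose y := x - x'; have [y0|y0] := eqVneq y 0.
  exists u'; split; first by apply/lspan_cons; exists 0, u'; rewrite scale0r add0r.
  move=> w /lspan_cons[c [v [sv ->]]]; apply: hu'.
  by apply: (subsp_lspan _).2 => //; move/eqP: y0; rewrite subr_eq0 => /eqP ->.
have yy : dot y y != 0 by apply: contra_neq y0; exact: dotuu0.
pose a := dot (u - u') y / dot y y; exists (u' + a *: y); split.
  apply/lspan_cons; exists a, (u' - a *: x'); split; last by rewrite scalerBr addrCA.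
  by apply: (subspB (subsp_lspan _)) => //; apply: (subspZ _ (subsp_lspan _)).
move=> w /lspan_cons[c [v [sv ->]]].
have E1 t : lspan [set` s] t -> dot (u - (u' + a *: y)) t = 0.
  by move=> st; rewrite opprD addrA dotBl dotZl hu' // hx' // mulr0 subrr.
have -> : c *: x + v = c *: y + (c *: x' + v) by rewrite addrA -scalerDr subrK.
rewrite dotDr [X in _ + X]E1; last exact: (subsp_lspan _).2.
by rewrite addr0 dotZr opprD addrA dotBl dotZl /a divfK // subrr mulr0.
Qed.

Section OneProj.
Variable M : set H.
Hypothesis fM : findim_subspace M.
Local Notation P := (orthproj dot M).

Lemma orthprojP u : M (P u) /\ forall w, M w -> dot (u - P u) w = 0.
Proof.
rewrite /orthproj; have [v hv] := proj_ex u fM.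
by case: xgetP => [x _ //|/(_ v)/(_ hv)].
Qed.

Lemma proj_in u : M (P u). Proof. exact: (orthprojP u).1. Qed.
Lemma proj_orth u w : M w -> dot (u - P u) w = 0. Proof. exact: (orthprojP u).2. Qed.
Lemma proj_orthl u w : M w -> dot w (u - P u) = 0.
Proof. by move=> Mw; apply: dot_eq0C; exact: proj_orth. Qed.
Let sM := subsp_findim fM.

Lemma proj_uniq u v : M v -> (forall w, M w -> dot (u - v) w = 0) -> P u = v.
Proof.
move=> Mv hv; apply/eqP; rewrite -subr_eq0; apply/eqP; apply: dotuu0.
have Mw : M (P u - v) by apply: subspB => //; exact: proj_in.
have {1}-> : P u - v = (u - v) - (u - P u) by rewrite opprB [RHS]addrC addrA subrK.
by rewrite dotBl hv // proj_orth // subrr.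
Qed.

Lemma proj_linear : linear P.
Proof.
move=> c u v; apply: proj_uniq; first by apply: sM.2; exact: proj_in.
move=> w Mw; have -> : c *: u + v - (c *: P u + P v) = c *: (u - P u) + (v - P v).
  by rewrite scalerBr opprD addrACA.
by rewrite dotDl dotZl !proj_orth // mulr0 addr0.
Qed.

Lemma projD u v : P (u + v) = P u + P v.
Proof. by have := proj_linear 1 u v; rewrite !scale1r. Qed.
Lemma proj_id u : M u -> P u = u.
Proof. by move=> Mu; apply: proj_uniq => // w _; rewrite subrr dot0l. Qed.
Lemma proj0 : P 0 = 0. Proof. exact: proj_id sM.1. Qed.
Lemma projZ c u : P (c *: u) = c *: P u.
Proof. by have := proj_linear c u 0; rewrite proj0 !addr0. Qed.
Lemma projB u v : P (u - v) = P u - P v.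
Proof. by rewrite projD -scaleN1r projZ scaleN1r. Qed.

Lemma proj_dotl u w : M w -> dot (P u) w = dot u w.
Proof. by move=> Mw; apply/eqP; rewrite eq_sym -subr_eq0 -dotBl proj_orth. Qed.
Lemma proj_dotr u w : M w -> dot w (P u) = dot w u.
Proof. by move=> Mw; rewrite dotC proj_dotl // -dotC. Qed.
Lemma proj_adj u v : dot (P u) v = dot u (P v).
Proof. by rewrite -(proj_dotr v (proj_in u)) (proj_dotl u (proj_in v)). Qed.

Lemma proj_pyth u : nrm u ^+ 2 = nrm (P u) ^+ 2 + nrm (u - P u) ^+ 2.
Proof.
rewrite -(nrm_sqr_orth dot_norm) ?[P u + _]addrC ?subrK //.
by apply: proj_orthl; exact: proj_in.
Qed.

Lemma nrm_proj u : nrm (P u) <= nrm u.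
Proof.
rewrite -(@ler_pXn2r _ 2) ?nnegrE ?nrm_ge0 // [leRHS]proj_pyth.
by rewrite lerDl sqr_ge0.
Qed.

Lemma nrm_projc u : nrm (u - P u) <= nrm u.
Proof.
rewrite -(@ler_pXn2r _ 2) ?nnegrE ?nrm_ge0 // [leRHS]proj_pyth.
by rewrite lerDr sqr_ge0.
Qed.

Lemma proj_nearest u w : M w -> nrm (u - P u) <= nrm (u - w).
Proof.
move=> Mw; have -> : u - w = (P u - w) + (u - P u).
  by rewrite [RHS]addrC addrA subrK.
rewrite -(@ler_pXn2r _ 2) ?nnegrE ?nrm_ge0 // (nrm_sqr_orth dot_norm (u := P u - w)).
  by rewrite lerDr sqr_ge0.
by apply: proj_orthl; apply: subspB => //; exact: proj_in.
Qed.

Lemma set_distE u : set_dist u M = nrm (u - P u).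
Proof.
apply/eqP; rewrite eq_le; apply/andP; split.
  apply: ge_inf; last by exists (P u) => //; exact: proj_in.
  by exists 0 => _ [y _ <-]; exact: nrm_ge0.
apply: lb_le_inf; first by exists (nrm (u - P u)), (P u) => //; exact: proj_in.
by move=> _ [y My <-]; exact: proj_nearest.
Qed.

Lemma gap_le (E : set H) x : subsp E -> E x -> nrm (x - P x) <= gap E M * nrm x.
Proof.
move=> sE Ex; have [->|] := eqVneq x 0.
  by rewrite proj0 subrr nrm0 mulr0.
rewrite -nrm_gt0 => x0; rewrite -ler_pdivrMr //.
have -> : nrm (x - P x) / nrm x = set_dist ((nrm x)^-1%:C *: x) M.
  by rewrite set_distE projZ -scalerBr nrmZr gtr0_norm ?invr_gt0 // mulrC.
apply: ub_le_sup.
  exists 1 => _ [y [_ y1] <-]; rewrite set_distE -y1; exact: nrm_projc.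
exists ((nrm x)^-1%:C *: x) => //; split; first exact: subspZ.
by rewrite nrmZr gtr0_norm ?invr_gt0 // mulVf ?gt_eqF.
Qed.

Lemma gap_ge0 (E : set H) : 0 <= gap E M.
Proof.
have [[x [Ex x1]]|ne] := pselect (exists x, E x /\ nrm x = 1).
  apply: le_trans (nrm_ge0 (x - P x)) _; rewrite -set_distE; apply: ub_le_sup.
    exists 1 => _ [y [_ y1] <-]; rewrite set_distE -y1; exact: nrm_projc.
  by exists x.
rewrite /gap (_ : [set _ | _ in _] = set0) ?sup0 //.
by rewrite -subset0 => y [x hx yx]; apply: ne; exists x.
Qed.

Lemma gap_sub_le (E : set H) (k : R) : 0 <= k ->
  (forall x, E x -> nrm (x - P x) <= k * nrm x) -> gap E M <= k.
Proof.
move=> k0 hk; have [[x hx]|ne] := pselect (exists x, E x /\ nrm x = 1).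
  apply: ge_sup; first by exists (set_dist x M), x.
  by move=> _ [y [Ey y1] <-]; rewrite set_distE -(mulr1 k) -y1; exact: hk.
rewrite /gap (_ : [set _ | _ in _] = set0) ?sup0 //.
by rewrite -subset0 => y [x hx yx]; apply: ne; exists x.
Qed.

End OneProj.

End Proj.

(** * Isolated points of the spectrum of a normal operator *)

Lemma realcM (R : realType) (a b : R) : (a * b)%:C = a%:C * b%:C :> R[i].
Proof. by apply/eqP; rewrite eq_complex /= !mul0r !mulr0 subr0 addr0 !eqxx. Qed.
Lemma realcD (R : realType) (a b : R) : (a + b)%:C = a%:C + b%:C :> R[i].
Proof. by apply/eqP; rewrite eq_complex /= addr0 !eqxx. Qed.
Lemma realcB (R : realType) (a b : R) : (a - b)%:C = a%:C - b%:C :> R[i].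
Proof. by apply/eqP; rewrite eq_complex /= subr0 !eqxx. Qed.

Section Spectral.
Variables (R : realType) (H : completeNormedModType R[i]).
Variable dot : {dot H for Num.conj}.
Hypothesis dot_norm : forall u : H, dot u u = `|u| ^+ 2.
Variable A : {linear H -> H}.
Hypothesis A_bounded : bounded_on setT A.
Hypothesis A_normal : normal_op dot A.
Local Notation C := R[i].
Local Notation Re := complex.Re.
Local Notation Im := complex.Im.
Local Notation Ad := (adjoint dot A).
Local Notation opv := (opv dot A).
Local Notation sap := (sap A).
Local Notation reducing := (reducing dot A).
Implicit Types (u v w x y : H) (V M : set H) (m nu mu : C).

Lemma reducing_setT : reducing setT.
Proof. by []. Qed.

Lemma sapS V M m : V `<=` M -> sap V m -> sap M m.
Proof. by move=> VM h d /h[x [Vx x1 hx]]; exists x; split=> //; exact: VM. Qed.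

Lemma sap_spectrum m : sap setT m -> spectrum A m.
Proof.
move=> h [B [[k hk] hB]].
have k1 : 0 < `|k| + 1 by rewrite ltr_wpDl.
have k0 : 0 < (`|k| + 1)^-1 by rewrite invr_gt0.
have [x [_ x1 hx]] := h _ k0.
have [_ Bx _] := hB x I; have := hk (A x - m *: x) I; rewrite Bx x1 leNgt => /negP; apply.
apply: (@le_lt_trans _ _ ((`|k| + 1) * nrm (A x - m *: x))).
  by rewrite ler_wpM2r ?nrm_ge0 // (le_trans (ler_norm _)) // lerDl.
by rewrite mulrC -ltr_pdivlMr // mul1r.
Qed.

Lemma not_sap V m : subsp V -> ~ sap V m ->
  exists2 d, 0 < d & forall x, V x -> d * nrm x <= nrm (A x - m *: x).
Proof.
move=> sV /existsNP[d /not_implyP[d0 hd]]; exists d => // x Vx.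
have [->|x0] := eqVneq x 0; first by rewrite nrm0 mulr0 nrm_ge0.
have [c [c0 cx1 ncx]] := normalize x0.
rewrite leNgt; apply/negP => lt; apply: hd; exists (c%:C *: x); split=> //.
  exact: subspZ.
rewrite linearZ scalerA mulrC -scalerA -scalerBr nrmZr gtr0_norm //.
by rewrite -(mulr1 d) -cx1 mulrCA ltr_pM2l.
Qed.

Lemma sap_eigen V m x : V x -> subsp V -> x != 0 -> A x = m *: x -> sap V m.
Proof.
move=> Vx sV x0 Ax d d0; have [c [c0 cx1 ncx]] := normalize x0.
exists (c%:C *: x); split=> //; first exact: subspZ.
by rewrite linearZ Ax scalerA mulrC -scalerA subrr nrm0.
Qed.

Definition eshift m : expr R := ESub EZ m.

Lemma opv_eshift m x : opv (eshift m) x = A x - m *: x.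
Proof. by rewrite /= scaleNr. Qed.

Lemma opv_cjshift m x : opv (cj (eshift m)) x = Ad x - Num.conj m *: x.
Proof. by rewrite /= conjN scaleNr. Qed.

Lemma val_sqr m mu : val (EMul (cj (eshift m)) (eshift m)) mu = (nrm (mu - m) ^+ 2)%:C.
Proof. by rewrite -nrm_conj_sqr /= -conjD mulrC. Qed.

(** For normal A the operator |A - w|^2 is the polynomial with value |mu - w|^2 at mu, which is at
    least D^2 on the approximate point spectrum. *)
Lemma dist_le V (D : R) (w : C) x : reducing V -> 0 <= D ->
  (forall mu, sap V mu -> D <= nrm (mu - w)) -> V x -> D * nrm x <= nrm (A x - w *: x).
Proof.
move=> rV D0 hD Vx; rewrite -(@ler_pXn2r _ 2) ?nnegrE ?mulr_ge0 ?nrm_ge0 //.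
rewrite exprMn -opv_eshift -[leRHS](Re_dotuu dot_norm) (opv_adj dot_norm A_bounded) Re_dotC.
apply: (spectral_lower_bound dot_norm A_bounded A_normal rV
  (e := EMul (cj (eshift w)) (eshift w))) => // mu /hD hmu.
by rewrite val_sqr /= ler_pXn2r ?nnegrE ?nrm_ge0.
Qed.

Lemma nrm_shift m nu x :
  nrm (A x - m *: x) <= nrm (A x - nu *: x) + nrm (nu - m) * nrm x.
Proof.
rewrite -nrmZ scalerBl; apply: le_trans (nrmD _ _).
by rewrite addrA subrK.
Qed.

(** The point m itself may lie outside the approximate point spectrum, so that one notion covers
    discrete eigenvalues and regular points; conj z may be of either kind. *)
Definition isolated_in_sap m :=
  exists2 d, 0 < d & forall nu, sap setT nu -> nu != m -> d <= nrm (nu - m).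

Lemma not_sap_isolated m : ~ sap setT m -> isolated_in_sap m.
Proof.
move=> /not_sap[] // d d0 hd; exists d => // nu snu _; apply: le_eps => e e0.
have [x [_ x1 hx]] := snu _ e0.
have := nrm_shift m nu x; have := hd x I; rewrite x1 !mulr1; move: hx; lra.
Qed.

(** Put B = A - m. The polynomial |mu - m|^2 (|mu - m|^2 - d^2) is nonnegative on the approximate
    point spectrum, also at m where it vanishes, and this is the bound on the range of B. A vector x
    orthogonal to the kernel of B is a limit of that range: the least residual p is orthogonal to
    the range, hence in the kernel by normality. *)
Lemma isolated_bound m d x : 0 < d ->
  (forall nu, sap setT nu -> nu != m -> d <= nrm (nu - m)) ->
  (forall u, A u = m *: u -> dot x u = 0) -> d * nrm x <= nrm (A x - m *: x).
Proof.
move=> d0 hd xorth.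
pose B := opv (eshift m); pose Bs := opv (cj (eshift m)).
have BsE y : nrm (Bs y) = nrm (B y).
  by rewrite /B /Bs opv_eshift opv_cjshift nrm_adjoint_sub.
have adjB a b : dot (B a) b = dot a (Bs b) by exact: opv_adj.
have adjBs a b : dot (Bs a) b = dot a (B b).
  by rewrite dotC -adjB -dotC.
have ran y : d * nrm (B y) <= nrm (B (B y)).
  rewrite -(@ler_pXn2r _ 2) ?nnegrE ?mulr_ge0 ?nrm_ge0 ?(ltW d0) //.
  pose q := EMul (cj (eshift m)) (eshift m).
  have := @spectral_lower_bound R H dot dot_norm A A_bounded A_normal setT
    (EMul q (ESub q (d ^+ 2)%:C)) 0 reducing_setT _ y I.
  rewrite mul0r => /(_ _)/wrap[].
    move=> mu smu; have vE : val (EMul q (ESub q (d ^+ 2)%:C)) mu =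
        (nrm (mu - m) ^+ 2 * (nrm (mu - m) ^+ 2 - d ^+ 2))%:C.
      by rewrite realcM realcB -val_sqr.
    rewrite vE /=; have [->|ne] := eqVneq mu m.
      by rewrite subrr nrm0 expr0n mul0r.
    rewrite mulr_ge0 ?sqr_ge0 // subr_ge0 ler_pXn2r ?nnegrE ?nrm_ge0 ?(ltW d0) //.
    exact: hd.
  have -> : dot (opv (EMul q (ESub q (d ^+ 2)%:C)) y) y =
      dot (Bs (B y) + (- (d ^+ 2)%:C) *: y) (Bs (B y)).
    rewrite -adjB -adjBs; congr (dot _ _).
  rewrite dotDl dotZl -(adjB y (B y)) mulNr ReD ReN ReZ !(Re_dotuu dot_norm) BsE exprMn.
  by rewrite subr_ge0.
have [p [papp pmin]] : exists p, (forall e, 0 < e -> exists y, nrm (p - (x - B y)) < e) /\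
    (forall y, nrm p <= nrm (x - B y)).
  have [||p [pa pm]] := min_norm_point dot_norm (S := [set x - B y | y in setT]).
  - by exists (x - B 0), 0.
  - move=> u1 v1 [u _ <-] [v _ <-]; exists ((2^-1)%:C *: (u + v)) => //.
    rewrite /B (opvZ dot_norm A_bounded) (opvD dot_norm A_bounded).
    rewrite [X in _ = _ *: X]addrACA -opprD scalerBr; congr (_ - _).
    by rewrite scalerDr -scalerDl -realcD (_ : _ + _ = 1) ?scale1r //; lra.

  exists p; split=> [e /pa[_ [y _ <-] h]|y]; first by exists y.
  by apply: pm; exists y.
have pB v : dot p (B v) = 0.
  apply: (orth_of_min dot_norm) => c; apply: le_eps => e /papp[y hy].
  have -> : p + c *: B v = (p - (x - B y)) + (x - B (y - c *: v)).
    rewrite /B (opvB dot_norm A_bounded) (opvZ dot_norm A_bounded) opprB.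
    by rewrite -addrA; congr (_ + _); rewrite addrA subrK subKr.
  have := nrm_lerB (x - B (y - c *: v)) (p - (x - B y)).
  have := pmin (y - c *: v); rewrite [p - _ + _]addrC; move: hy; lra.
have Ap : A p = m *: p.
  apply/eqP; rewrite -subr_eq0 -opv_eshift -nrm_eq0 -/B -BsE nrm_eq0.
  by apply/eqP/(dotuu0 dot_norm); rewrite adjBs.
(* The eigenvector p is orthogonal to x and to the range of B, hence to every x - B y; but some x -
   B y is as close to p as desired. *)
have p0 : p = 0.
  apply/eqP; rewrite -nrm_eq0 eq_le nrm_ge0 andbT; apply: le_eps => e e0; rewrite add0r.
  have [y hy] := papp _ e0.
  have [->|pn] := eqVneq p 0; first by rewrite nrm0 ltW.
  have pp : 0 < nrm p by rewrite nrm_gt0.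
  rewrite -(ler_pM2r pp); apply: le_trans (_ : nrm (p - (x - B y)) * nrm p <= _); last first.
    by rewrite ler_pM2r // ltW.
  rewrite -expr2 -(Re_dotuu dot_norm).
  have -> : dot p p = dot (p - (x - B y)) p.
    by rewrite !dotBl xorth // sub0r opprK (dot_eq0C (pB y)) addr0.
  exact: (Re_dot_le dot_norm).
have [k k0 hk] := opv_bounded dot_norm A_bounded (eshift m).
rewrite -opv_eshift -/B; apply: le_eps => e e0.
have dk : 0 < d + k by apply: addr_gt0.
have [y] := papp _ (divr_gt0 e0 dk); rewrite p0 sub0r nrmN ltr_pdivlMr // => hy.
have h1 : nrm x <= nrm (x - B y) + nrm (B y) by have := nrmD (x - B y) (B y); rewrite subrK.
have h2 : nrm (B (B y)) <= nrm (B x) + k * nrm (x - B y).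
  apply: le_trans (lerD (lexx _) (hk _)); rewrite (opvB dot_norm A_bounded) -/B.
  by rewrite -{1}(subKr (B x) (B (B y))); exact: nrmB.
have := ran y; have := ler_wpM2l (ltW d0) h1; move: hy; lra.
Qed.

Lemma eigen_adjoint m x : A x = m *: x -> Ad x = Num.conj m *: x.
Proof.
move=> /eqP; rewrite -subr_eq0 -nrm_eq0 -(nrm_adjoint_sub dot_norm A_bounded A_normal).
by rewrite nrm_eq0 subr_eq0 => /eqP.
Qed.

Lemma reducing_eigenspan (D : set C) : reducing (lspan (\bigcup_(m in D) eigenspace_of A m)).
Proof.
set E := \bigcup_(_ in _) _; have sE := subsp_lspan E.
split=> // x; move: x; apply: lspan_sub.
- split; first by rewrite linear0; exact: sE.1.
  by move=> c u v hu hv; rewrite linearP; exact: sE.2.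
- move=> x [m Dm Ax]; have -> : A x = m *: x := Ax.
  by apply: subspZ => //; apply: sub_lspan; exists m.
- split; first by rewrite -[Ad 0]/(opv EZb 0) (opv0 dot_norm A_bounded); exact: sE.1.
  move=> c u v hu hv; rewrite -[Ad _]/(opv EZb _) (opvP dot_norm A_bounded).
  exact: sE.2.
- move=> x [m Dm Ax]; rewrite (eigen_adjoint Ax).
  by apply: subspZ => //; apply: sub_lspan; exists m.
Qed.

Definition orthc M := [set x | forall y, M y -> dot x y = 0].

Lemma subsp_orthc M : subsp (orthc M).
Proof.
split=> [y _|c u v hu hv y My]; first by rewrite dot0l.
by rewrite dotDl dotZl hu // hv // mulr0 addr0.
Qed.

Lemma reducing_orthc M : reducing M -> reducing (orthc M).
Proof.
move=> [sM MA MB]; split=> [|x Mx y My|x Mx y My]; first exact: subsp_orthc.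
  by rewrite (adjointP dot_norm A_bounded) Mx //; exact: MB.
by rewrite (adjointP' dot_norm A_bounded) Mx //; exact: MA.
Qed.

Lemma discrete_isolated m : discrete_spectrum A m -> isolated_in_sap m.
Proof.
move=> [[_ [V nV VE]] _ _].
have [e e0 he] : exists2 e : R, 0 < e & forall nu : C, nrm (nu - m) < e -> V nu.
  have [_ /= /gt0_complexE[e e0 ->] he] := (nbhs_ballP (m : R[i]^o) V).1 nV.
  exists e => // nu hnu; apply: he; rewrite -ball_normE /= -nrmE ltcR.
  by rewrite nrmBC.
exists e => // nu snu ne; rewrite leNgt; apply/negP => lt.
have : (V `&` spectrum A) nu by split; [exact: he|exact: sap_spectrum].
by rewrite VE /= => nuE; move: ne; rewrite nuE eqxx.
Qed.

Lemma not_essential_isolated m : ~ essential_spectrum A m -> isolated_in_sap m.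
Proof.
move=> ne; have [sm|] := pselect (spectrum A m).
  by apply: discrete_isolated; apply: contrapT => nd; apply: ne; split.
by move=> ns; apply: not_sap_isolated => /sap_spectrum.
Qed.

(** If z or conj z were essential, one factor of (l - z)(conj l - z) would vanish there, and 0 would
    belong to [Sigma_ z] itself. *)
Lemma quad_hull_not_essential z : ~ quad_hull (essential_spectrum A) z ->
  ~ essential_spectrum A z /\ ~ essential_spectrum A (Num.conj z).
Proof.
move=> nq; split=> ez; apply: nq => X [_ SX]; apply: SX.
  by exists z; rewrite // subrr mul0r.
by exists (Num.conj z); rewrite // conjCK subrr mulr0.
Qed.

End Spectral.

(** * Separation and compactness in the complex plane *)

Section ComplexPlane.
Variable R : realType.
Local Notation C := R[i].
Local Notation Re := complex.Re.
Local Notation Im := complex.Im.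

(** A square is the image of a product of two real segments, which yields its compactness; its
    boundary is described by the two coordinates separately. *)
Definition csquare (r : R) : set C := [set c | `|Re c| <= r /\ `|Im c| <= r].

Lemma complex_split (c : C) : c = (Re c)%:C + 'i%C * (Im c)%:C.
Proof. exact: complexE. Qed.

Lemma nrm_i : nrm ('i%C : C) = 1.
Proof. by apply/eqP; rewrite -(@eqrXn2 _ 2) ?nrm_ge0 // nrmc_sqr /= expr0n add0r. Qed.

Lemma normRe_le (c : C) : `|Re c| <= nrm c.
Proof.
by rewrite ler_norml Re_le_nrm andbT lerNl -ReN -nrmN Re_le_nrm.
Qed.

Lemma normIm_le (c : C) : `|Im c| <= nrm c.
Proof.
by rewrite ler_norml Im_le_nrm andbT lerNl -ImN -nrmN Im_le_nrm.
Qed.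

Lemma compact_csquare r : compact (csquare r : set R[i]^o).
Proof.
pose f (x : R * R) : R[i]^o := x.1%:C + 'i%C * x.2%:C.
have -> : csquare r = f @` (`[- r, r]%classic `*` `[- r, r]%classic).
  apply/seteqP; split=> [c [h1 h2]|_ [[a b] /= [h1 h2] <-]].
    exists (Re c, Im c); last by rewrite [RHS]complex_split.
    by split; rewrite /= in_itv /= -ler_norml.
  have -> : f (a, b) = Complex a b by rewrite [RHS]complex_split.
  by split; rewrite /= ler_norml; move: h1 h2; rewrite /= !in_itv.
apply: continuous_compact; last by apply: compact_setX; exact: segment_compact.
apply: continuous_subspaceT => x; apply/nrm_cvgP => e e0.
have e2 : 0 < e / 2 by rewrite divr_gt0.
exists (ball x.1 (e / 2), ball x.2 (e / 2)).
  by split; exact: nbhsx_ballx.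
move=> t [/= h1 h2].
have -> : f x - f t = (x.1 - t.1)%:C + 'i%C * (x.2 - t.2)%:C.
  by rewrite /f !realcB mulrBr opprD addrACA.
apply: le_lt_trans (nrmD _ _) _; rewrite nrmM nrm_i mul1r !nrm_real.
by rewrite (splitr e); apply: ltrD; rewrite -?ball_normE in h1 h2 *.
Qed.

Definition nrm_continuous_at (g : C -> R) (c : C) :=
  forall e, 0 < e -> exists2 d, 0 < d & forall c', nrm (c' - c) < d -> `|g c' - g c| < e.

Lemma nrm_continuous_cvg (g : R[i]^o -> R) (c : R[i]^o) :
  nrm_continuous_at g c -> g x @[x --> c] --> g c.
Proof.
move=> h U /nbhs_ballP[e /= e0 hU]; have [d d0 hd] := h _ e0.
apply: (nbhs_ballP c _).2; exists d%:C; first by rewrite /= ltcR.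
move=> t; rewrite -ball_normE /= -nrmE ltcR nrmBC => /hd ht; apply: hU.
by rewrite -ball_normE /= distrC.
Qed.

Lemma compact_minC (K : set C) (g : C -> R) : compact (K : set R[i]^o) -> K !=set0 ->
  (forall c, K c -> nrm_continuous_at g c) ->
  exists2 c, K c & forall c', K c' -> g c <= g c'.
Proof.
move=> cK K0 hg; have cg : {within (K : set R[i]^o), continuous (g : R[i]^o -> R)}.
  apply: continuous_in_subspaceT => c; rewrite inE => /hg; exact: nrm_continuous_cvg.
have [c] := compact_EVT_min (T := R[i]^o) K0 cK cg; rewrite inE => Kc hc.
by exists c => // c' Kc'; apply: hc; rewrite inE.
Qed.

Lemma nrm_continuous (c : C) : nrm_continuous_at (fun c => nrm c) c.
Proof.
move=> e e0; exists e => // c' hc; rewrite ltr_norml; apply/andP; split.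
  rewrite ltrNl opprB; apply: le_lt_trans hc; rewrite nrmBC lerBlDr.
  by rewrite -{1}(subrK c' c); exact: nrmD.
by apply: le_lt_trans hc; rewrite lerBlDr -{1}(subrK c c'); exact: nrmD.
Qed.

Lemma nrm_sqr_seg (p d : C) (t : R) : nrm (p + t%:C * d) ^+ 2 =
  nrm p ^+ 2 + 2 * t * Re (Num.conj p * d) + t ^+ 2 * nrm d ^+ 2.
Proof. by case: p d => [a b] [a' b']; rewrite !nrmc_sqr /=; ring. Qed.

(** Take w = conj p and c = |p|^2 for the point p of X nearest to 0: minimality along the segment
    from p to q gives Re (conj p (q - p)) >= 0. For empty X the choice of w and c is arbitrary. *)
Lemma closed_convex_separation (X : set C) : closed (X : set R[i]^o) ->
  convex_set (X : set R[i]^o) -> ~ X 0 ->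
  exists w c, 0 < c /\ forall q, X q -> c <= Re (w * q).
Proof.
move=> clX cvX X0; have [[q0 Xq0]|ne] := pselect (X !=set0); last first.
  by exists 0, 1; split=> // q Xq; case: ne; exists q.
pose K := csquare (nrm q0) `&` X.
have sqK q : nrm q <= nrm q0 -> csquare (nrm q0) q.
  by move=> h; split; apply: le_trans h; [exact: normRe_le|exact: normIm_le].
have [|||p [sp Xp] pm] := @compact_minC K (fun c => nrm c).
- by apply: compact_closedI => //; exact: compact_csquare.
- by exists q0; split=> //; exact: sqK.
- by move=> c _; exact: nrm_continuous.
have pmin q : X q -> nrm p <= nrm q.
  move=> Xq; have [h|h] := leP (nrm q) (nrm q0); first by apply: pm; split=> //; exact: sqK.
  by apply: le_trans (ltW h); apply: pm; split=> //; exact: sqK.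
have p0 : p != 0 by apply/eqP => p0; apply: X0; rewrite -p0.
exists (Num.conj p), (nrm p ^+ 2); split; first by rewrite exprn_gt0 ?nrm_gt0.
move=> q Xq.
have seg (t : R) : 0 < t -> t <= 1 -> X (p + t%:C * (q - p)).
  move=> t0 t1; have t0' : 0 <= t%:C :> C by rewrite ler0c ltW.
  have t1' : t%:C <= 1 :> C by rewrite -(lecR t 1) in t1.
  have := cvX q p (Itv01 t0' t1'); rewrite !inE => /(_ Xq Xp).
  rewrite /conv /=; congr (X _).
  by rewrite /GRing.scale /= mulrBl mul1r mulrBr addrC addrAC addrA.
have expand (t : R) : nrm (p + t%:C * (q - p)) ^+ 2 = nrm p ^+ 2 +
   2 * t * Re (Num.conj p * (q - p)) + t ^+ 2 * nrm (q - p) ^+ 2.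
  exact: nrm_sqr_seg.
suff : 0 <= Re (Num.conj p * (q - p)).
  rewrite mulrBr ReD ReN [Num.conj p * p]mulrC nrm_conj_sqr /=; lra.
have B0 := sqr_ge0 (nrm (q - p)); set B := _ ^+ 2 in B0.
apply: le_eps => e e0; set a := Re _.
pose t := Num.min 1 (e / (B + 1)).
have B1 : 0 < B + 1 by rewrite ltr_wpDl.
have t0 : 0 < t by rewrite lt_min ltr01 divr_gt0.
have t1 : t <= 1 by rewrite ge_min lexx.
have tB : t * B <= e.
  apply: (le_trans (y := t * (B + 1))); first by rewrite ler_pM2l // lerDl.
  by rewrite -ler_pdivlMr // ge_min lexx orbT.
have := pmin _ (seg t t0 t1).
rewrite -(@ler_pXn2r _ 2) ?nnegrE ?nrm_ge0 // expand -/a -/B -addrA lerDl => h.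
have : 0 <= 2 * a + t * B.
  rewrite -(pmulr_rge0 _ t0); apply: le_trans h _; rewrite le_eqVlt; apply/orP; left.
  by apply/eqP; ring.
lra.
Qed.

(** Every point of the square, in D or not, is the centre of a disc that meets D at most in that
    centre; a finite subcover leaves only its centres. *)
Lemma finite_of_discrete (D : set C) (r : R) : D `<=` csquare r ->
  (forall p, exists2 d, 0 < d & forall nu, D nu -> nrm (nu - p) < d -> nu = p) ->
  exists s : seq C, D `<=` [set` s].
Proof.
move=> Dr hD; have /choice[d hd] : forall p, exists d, 0 < d /\
    forall nu, D nu -> nrm (nu - p) < d -> nu = p.
  by move=> p; have [d d0 hd] := hD p; exists d.
have := @compact_csquare r; rewrite compact_cover.
move=> /(_ C setT (fun p => ball (p : R[i]^o) (d p)%:C))[].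
- by move=> p _; apply: ball_open; rewrite ltcR (hd p).1.
- by move=> p _; exists p => //; apply: ballxx; rewrite ltcR (hd p).1.
move=> F _ hF; exists (finmap.enum_fset F) => nu Dnu; have [p pF] := hF _ (Dr _ Dnu).
rewrite -ball_normE /= -nrmE ltcR nrmBC => /((hd p).2 _ Dnu) ->; exact: pF.
Qed.

End ComplexPlane.

(** * Coercivity off the quadratic hull of the essential spectrum *)

Section Coercive.
Variables (R : realType) (H : completeNormedModType R[i]).
Variable dot : {dot H for Num.conj}.
Hypothesis dot_norm : forall u : H, dot u u = `|u| ^+ 2.
Variable A : {linear H -> H}.
Hypothesis A_bounded : bounded_on setT A.
Hypothesis A_normal : normal_op dot A.
Local Notation C := R[i].
Local Notation Re := complex.Re.
Local Notation Im := complex.Im.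
Local Notation Ad := (adjoint dot A).
Local Notation opv := (opv dot A).
Local Notation sap := (sap A).
Local Notation reducing := (reducing dot A).
Local Notation orthc := (orthc dot).
Implicit Types (u v w x y : H) (V M : set H) (m nu mu l : C).

(** Both factors carry l and not its conjugate: the pencil is polynomial in l, and its value at m is
    an element of the set [Sigma_ l]. *)
Definition ET l : expr R := EMul (ESub EZb l) (ESub EZ l).

Lemma opv_ET l x : opv (ET l) x = opv (ESub EZb l) (A x - l *: x).
Proof. by rewrite /= scaleNr. Qed.

Lemma val_lip (e : expr R) (p : C) : exists2 k : R, 0 < k &
  forall m, nrm (m - p) <= 1 -> nrm (val e m - val e p) <= k * nrm (m - p).
Proof.
elim: e => [||c|f [k k0 IHf] g [l l0 IHg]|f [k k0 IHf] g [l l0 IHg]] /=.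
- by exists 1 => // m _; rewrite mul1r.
- by exists 1 => // m _; rewrite -conjN -conjD nrm_conj mul1r.
- by exists 1 => // m _; rewrite subrr nrm0 mul1r nrm_ge0.
- exists (k + l); first exact: addr_gt0.
  move=> m hm; rewrite opprD addrACA; apply: le_trans (nrmD _ _) _.
  by rewrite mulrDl; apply: lerD; [exact: IHf|exact: IHg].
- exists (k * (l + nrm (val g p)) + nrm (val f p) * l).
    by rewrite ltr_pwDl ?mulr_gt0 ?ltr_pwDl ?nrm_ge0 // mulr_ge0 ?nrm_ge0 // ltW.
  move=> m hm; have hf := IHf m hm; have hg := IHg m hm.
  have -> : val f m * val g m - val f p * val g p =
      (val f m - val f p) * ((val g m - val g p) + val g p) +
      val f p * (val g m - val g p) by ring.
  apply: le_trans (nrmD _ _) _; rewrite !nrmM.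
  have h1 : nrm (val g m - val g p) <= l.
    by apply: le_trans hg _; rewrite -[leRHS]mulr1 ler_pM2l.
  have h2 := nrmD (val g m - val g p) (val g p).
  rewrite mulrDl; apply: lerD.
    rewrite mulrAC; apply: ler_pM; rewrite ?nrm_ge0 //.
    by apply: le_trans h2 _; rewrite lerD2r.
  by rewrite -mulrA ler_wpM2l ?nrm_ge0.
Qed.

Lemma not_essential_sap m : ~ essential_spectrum A m -> sap setT m -> discrete_spectrum A m.
Proof.
move=> ne /sap_spectrum sm; apply: contrapT => nd; exact: ne.
Qed.

Lemma sap_bounded : exists k, sap setT `<=` csquare k.
Proof.
have [k k0 hk] := bounded_pos A_bounded; exists k => m sm.
have mk : nrm m <= k.
  apply: le_eps => e e0; have [x [_ x1 hx]] := sm _ e0.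
  have -> : nrm m = nrm (m *: x) by rewrite nrmZ x1 mulr1.
  rewrite -(subKr (A x) (m *: x)); apply: le_trans (nrmB _ _) _.
  by apply: lerD (ltW hx); have := hk x; rewrite x1 mulr1.
by split; apply: le_trans mk; [exact: normRe_le|exact: normIm_le].
Qed.

Variable z : C.
Hypothesis nqh : ~ quad_hull (essential_spectrum A) z.

(* w separates 0 from the closed convex hull of the values of val (ET z) on the essential
   spectrum; N is spanned by the eigenspaces of the finitely many points where
   Re (w * _) is at most c. *)
Lemma coercive_complement : exists (N : set H) (w : C) (c : R),
  [/\ 0 < c, findim_subspace N, reducing N,
      forall m, [set z; Num.conj z] m -> discrete_spectrum A m -> eigenspace_of A m `<=` N
    & forall x, orthc N x -> c * nrm x ^+ 2 <= Re (w * dot (opv (ET z) x) x)].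
Proof.
have [X [[clX cvX] SX X0]] : exists X : set R[i]^o, [/\ closed X /\ convex_set X,
    Sigma_ z (essential_spectrum A) `<=` X & ~ X 0].
  apply: contrapT => nX; apply: nqh => X [hX SX]; apply: contrapT => X0.
  by apply: nX; exists X.
have [w [c [c0 hw]]] := closed_convex_separation clX cvX X0.
pose e : expr R := EMul (EC w) (ET z).
have valE m : val e m = w * ((m - z) * (Num.conj m - z)).
  by rewrite [LHS]/(w * ((Num.conj m - z) * (m - z))) (mulrC (m - z)).
have c2 : 0 < c / 2 by rewrite divr_gt0.
have c2c : c / 2 < c by rewrite ltr_pdivrMr // mulr_natr mulr2n ltrDl.
have hess m : essential_spectrum A m -> c <= Re (val e m).
  by move=> hm; rewrite valE; apply: hw; apply: SX; exists m.
(* The threshold c / 2 leaves a margin to the value c on the essential spectrum. By continuity no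
   essential point is an accumulation point of D, all other points are isolated, and D is finite. It
   contains z and conj z when they are eigenvalues, as e vanishes there. *)
pose D : set C := [set m | sap setT m /\ Re (val e m) <= c / 2].
have Dness m : D m -> ~ essential_spectrum A m.
  by move=> [_ Dm] /hess h; move: (le_lt_trans (le_trans h Dm) c2c); rewrite ltxx.
have Ddis m : D m -> discrete_spectrum A m.
  by move=> Dm; apply: not_essential_sap (Dness _ Dm) Dm.1.
have [s hs] : exists s : seq C, D `<=` [set` s].
  have [k hk] := sap_bounded; apply: (@finite_of_discrete _ D k); first by move=> m [/hk].
  move=> p; have [ep|np] := pselect (essential_spectrum A p); last first.
    have [d d0 hd] := not_essential_isolated np; exists d => // nu [snu _] lt.
    by apply/eqP; apply: contraTT lt => ne; rewrite -leNgt; exact: hd.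
  have [k' k'0 hk'] := val_lip e p.
  exists (Num.min 1 (c / 2 / k')); first by rewrite lt_min ltr01 divr_gt0.
  move=> nu [snu hnu]; rewrite lt_min => /andP[h1 h2].
  have h3 := hk' _ (ltW h1); have h4 := hess _ ep.
  have h5 := Re_le_nrm (val e p - val e nu).
  have h6 : k' * nrm (nu - p) < c / 2 by rewrite mulrC -ltr_pdivlMr.
  exfalso; rewrite nrmBC ReD ReN in h5; lra.
pose N := lspan (\bigcup_(m in D) eigenspace_of A m).
have rN : reducing N by exact: reducing_eigenspan.
have EN m : D m -> eigenspace_of A m `<=` N by move=> Dm x Ex; apply: sub_lspan; exists m.
exists N, w, (c / 2); split=> //.
- by apply: findim_bigcup hs _ => m /Ddis[].
- move=> m mz dm; apply: EN; have [_ [u Eu u0] _] := dm; split.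
    exact: (@sap_eigen R H A setT m u).
  rewrite valE (_ : _ * _ = 0) ?mulr0 /= ?ltW //.
  by case: mz => ->; rewrite ?conjCK subrr ?mul0r ?mulr0.
move=> x Nx; have := @spectral_lower_bound R H dot dot_norm A A_bounded A_normal (orthc N)
  e (c / 2) (reducing_orthc dot_norm A_bounded rN) _ x Nx.
rewrite [opv e x]/(w *: opv (ET z) x) dotZl; apply.
(* The approximate point spectrum on the complement of N avoids D: a point of D is isolated, and off
   its eigenspace A - mu is bounded below. *)
move=> mu smu; rewrite leNgt; apply/negP => /ltW lt.
have Dmu : D mu by split=> //; exact: sapS smu.
have [d d0 hd] := not_essential_isolated (Dness _ Dmu).
have [y [Ny y1]] := smu _ d0; rewrite ltNge => /negP; apply.
rewrite -[leLHS]mulr1 -y1; apply: (isolated_bound dot_norm A_bounded A_normal d0 hd).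
by move=> u Au; apply: Ny; exact: (EN _ Dmu).
Qed.

End Coercive.

(** * Orthonormal bases and uniform convergence on finite-dimensional subspaces *)

Section ONB.
Variables (R : realType) (H : completeNormedModType R[i]).
Variable dot : {dot H for Num.conj}.
Hypothesis dot_norm : forall u : H, dot u u = `|u| ^+ 2.
Local Notation C := R[i].
Local Notation Re := complex.Re.

Definition comb k (e : 'I_k -> H) (c : 'rV[C]_k) : H := \sum_i c ord0 i *: e i.
Definition onb k (e : 'I_k -> H) (M : set H) :=
  (forall i j, dot (e i) (e j) = (i == j)%:R) /\ M = range (comb e).

Lemma combP k (e : 'I_k -> H) : linear (comb e).
Proof.
move=> a u v; rewrite /comb scaler_sumr -big_split /=; apply: eq_bigr => i _.
by rewrite !mxE scalerDl scalerA.
Qed.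

Lemma onb_ex M : findim_subspace M -> exists k (e : 'I_k -> H), onb e M.
Proof.
move=> [s ->{M}]; elim: s => [|x s [k [e [oe se]]]].
  exists 0%N, (fun=> 0); split; first by case.
  rewrite lspan_nil; apply/seteqP; split=> [_ ->|_ [c _ <-]]; last by rewrite /comb big_ord0.
  by exists 0; rewrite // /comb big_ord0.
have fs : findim_subspace (lspan [set` s]) by exists s.
pose P := orthproj dot (lspan [set` s]); pose y := x - P x.
have sP : lspan [set` s] (P x) by exact: (proj_in dot_norm).
have sub : subsp (lspan [set` s]) := subsp_lspan _.
have [y0|y0] := eqVneq y 0.
  exists k, e; split=> //; rewrite -se; apply/seteqP; split; last first.
    by apply: lspanS => u /= us; rewrite inE us orbT.
  move=> u /lspan_cons[c [v [sv ->]]]; apply: sub.2 => //.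
  by move/eqP: y0; rewrite subr_eq0 => /eqP ->.
have yp : 0 < nrm y by rewrite nrm_gt0.
pose f := ((nrm y)^-1)%:C *: y.
have ff : dot f f = 1.
  by rewrite (dotuu dot_norm) /f nrmZr gtr0_norm ?invr_gt0 // mulVf ?gt_eqF // expr1n.
have sei i : lspan [set` s] (e i).
  rewrite se; exists (delta_mx ord0 i) => //; rewrite /comb (bigD1 i) //= big1 ?addr0.
    by rewrite mxE !eqxx scale1r.
  by move=> j ji; rewrite mxE eqxx (negbTE ji) scale0r.
have fe i : dot f (e i) = 0 by rewrite dotZl (proj_orth dot_norm) ?mulr0.
exists k.+1, (fun i => if unlift ord0 i is Some j then e j else f); split.
  move=> i j; case: (unliftP ord0 i) => [i' ->|->]; case: (unliftP ord0 j) => [j' ->|->].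
  - by rewrite oe (inj_eq lift_inj).
  - by rewrite (dot_eq0C (fe _)).
  - by rewrite fe.
  - by rewrite ff eqxx.
apply/seteqP; split=> [u /lspan_cons[c [v [sv ->]]]|_ [c _ <-]].
  have : lspan [set` s] (c *: P x + v) by apply: sub.2.
  rewrite se => -[d _ dE].
  exists (\row_i (if unlift ord0 i is Some j then d ord0 j else c * (nrm y)%:C)) => //.
  rewrite /comb big_ord_recl mxE unlift_none.
  rewrite /f scalerA -mulrA -realcM divff ?gt_eqF // mulr1 /y.
  rewrite (eq_bigr (fun i => d ord0 i *: e i)); last by move=> i _; rewrite mxE liftK.
  by rewrite -[X in _ + X]/(comb e d) dE scalerBr addrA subrK.
apply: subsp_sum => [|i _]; first exact: subsp_lspan.
apply: subspZ; first exact: subsp_lspan.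
have ins u : lspan [set` s] u -> lspan [set` x :: s] u.
  by apply: lspanS => ? /= us; rewrite inE us orbT.
case: unliftP => [j _|_]; first exact: ins.
apply: subspZ; first exact: subsp_lspan.
apply: subspB; [exact: subsp_lspan| |exact: ins].
by apply: sub_lspan; rewrite /= mem_head.
Qed.

Section OneBasis.
Variables (k : nat) (e : 'I_k -> H) (M : set H).
Hypothesis eM : onb e M.

Lemma dot_comb c i : dot (comb e c) (e i) = c ord0 i.
Proof.
rewrite /comb linear_sumlz (bigD1 i) //= big1 ?addr0.
  by rewrite dotZl eM.1 eqxx mulr1.
by move=> j ji; rewrite dotZl eM.1 (negbTE ji) mulr0.
Qed.

Lemma comb_in c : M (comb e c).
Proof. by rewrite eM.2; exists c. Qed.

Lemma basis_nrm1 i : nrm (e i) = 1.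
Proof.
apply/eqP; rewrite -(@eqrXn2 _ 2) ?nrm_ge0 // -(Re_dotuu dot_norm) eM.1 eqxx expr1n.
exact: eqxx.
Qed.

Lemma coord_le (c : 'rV[C]_k) i : nrm (c ord0 i) <= nrm (comb e c).
Proof.
rewrite -dot_comb; apply: le_trans (cauchy_schwarz dot_norm _ _) _.
by rewrite basis_nrm1 mulr1.
Qed.

Lemma comb_le (c : 'rV[C]_k) : nrm (comb e c) <= \sum_i nrm (c ord0 i).
Proof.
apply: le_trans (nrm_sum _ _ _) _; apply: ler_sum => i _.
by rewrite nrmZ basis_nrm1 mulr1.
Qed.

End OneBasis.

(** Convergence on an orthonormal basis is enough, because each coordinate of x is at most |x|. *)
Lemma proj_unif (L : nat -> set H) M (d : R) : Lambda dot L -> findim_subspace M -> 0 < d ->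
  exists n0, forall n, (n0 <= n)%N ->
    forall x, M x -> nrm (x - orthproj dot (L n) x) <= d * nrm x.
Proof.
move=> [fL cL] fM d0; have [k [e eM]] := onb_ex fM.
have k1 : 0 < k.+1%:R :> R by [].
have /choice[n hn] : forall i, exists n, forall m, (n <= m)%N ->
    nrm (e i - orthproj dot (L m) (e i)) < d / k.+1%:R.
  by move=> i; have /nrm_cvgnP := cL (e i); apply; rewrite divr_gt0.
exists (\max_i n i) => m nm x; rewrite eM.2 => -[c _ <-].
have pl := proj_linear dot_norm (fL m).
have -> : comb e c - orthproj dot (L m) (comb e c) =
    \sum_i c ord0 i *: (e i - orthproj dot (L m) (e i)).
  rewrite /comb; have -> : orthproj dot (L m) (\sum_i c ord0 i *: e i) =
      \sum_i c ord0 i *: orthproj dot (L m) (e i).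
    elim/big_rec2: _ => [|i y1 y2 _ <-]; first exact: (proj0 dot_norm (fL m)).
    exact: pl.
  by rewrite -sumrB; apply: eq_bigr => i _; rewrite scalerBr.
apply: le_trans (nrm_sum _ _ _) _.
apply: (le_trans (y := \sum_(i < k) d / k.+1%:R * nrm (comb e c))).
  apply: ler_sum => i _; rewrite nrmZ mulrC; apply: ler_pM; rewrite ?nrm_ge0 //.
    by apply/ltW/hn/(leq_trans _ nm); exact: leq_bigmax.
  exact: coord_le eM _ _.
rewrite sumr_const card_ord -[leLHS]mulr_natl mulrA ler_wpM2r ?nrm_ge0 //.
rewrite mulrCA; apply: ler_piMr; first exact: ltW.
by rewrite ler_pdivrMr // mul1r ler_nat.
Qed.

End ONB.

(** * Galerkin estimates *)

Section Galerkin.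
Variables (R : realType) (H : completeNormedModType R[i]).
Variable dot : {dot H for Num.conj}.
Hypothesis dot_norm : forall u : H, dot u u = `|u| ^+ 2.
Variable A : {linear H -> H}.
Hypothesis A_bounded : bounded_on setT A.
Hypothesis A_normal : normal_op dot A.
Local Notation C := R[i].
Local Notation Re := complex.Re.
Local Notation Im := complex.Im.
Local Notation Ad := (adjoint dot A).
Local Notation opv := (opv dot A).
Local Notation sap := (sap A).
Local Notation reducing := (reducing dot A).
Local Notation orthc := (orthc dot).
Implicit Types (u v x y : H) (V M : set H) (m nu mu l : C).

(** With rho half the isolation distance of m, every other point of the approximate point spectrum
    is at least as far from l as m is. *)
Lemma shift_low m : isolated_in_sap A m -> exists2 rho : R, 0 < rho &
  forall l, nrm (l - m) <= rho -> forall x, nrm (l - m) * nrm x <= nrm (A x - l *: x).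
Proof.
move=> [d d0 hd]; exists (d / 2); first by rewrite divr_gt0.
move=> l hl x; apply: (dist_le dot_norm A_bounded A_normal (V := setT)) => // [|mu smu].
  exact: nrm_ge0.
have [->|ne] := eqVneq mu m; first by rewrite nrmBC.
have := hd _ smu ne; have := nrm_subD mu l m; lra.
Qed.

Lemma shift_adj_nrm l x : nrm (opv (ESub EZb l) x) = nrm (A x - Num.conj l *: x).
Proof.
by rewrite -(nrm_adjoint_sub dot_norm A_bounded A_normal) conjCK /= scaleNr.
Qed.

(** N reduces A, so the form splits: the test vector e(a) + conj w b gives |e(a)|^2 on N and the
    form of w e on the complement. It is written as conj w x plus a vector of N, since projecting
    onto a space containing x then affects only the latter. W is the restriction under which e is
    bounded below on N: none for l away from z, orthogonality to E near z. *)
Lemma t_coercive (N W : set H) (w : C) (c : R) (e : expr R) (x : H) :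
  findim_subspace N -> reducing N -> 0 < c -> c <= 1 ->
  (forall y, orthc N y -> c * nrm y ^+ 2 <= Re (w * dot (opv e y) y)) ->
  (forall y, N y -> W y -> c * nrm y <= nrm (opv e y)) ->
  W (orthproj dot N x) ->
  let a := orthproj dot N x in
  c ^+ 2 * nrm x ^+ 2 <=
    Re (dot (opv e x) (Num.conj w *: x + (opv e a - Num.conj w *: a))).
Proof.
move=> fN rN c0 c1 hV hN Wa; set a := orthproj dot N x => /=; pose b := x - a.
have Na : N a by exact: (proj_in dot_norm).
have Vb : orthc N b by move=> y Ny; exact: (proj_orth dot_norm fN).
have rV := reducing_orthc dot_norm A_bounded rN.
have VTb : orthc N (opv e b) by exact: (opv_reducing e rV Vb).
have NTa : N (opv e a) by exact: (opv_reducing e rN Na).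
have xE : x = a + b by rewrite addrC subrK.
have -> : Num.conj w *: x + (opv e a - Num.conj w *: a) = opv e a + Num.conj w *: b.
  by rewrite /b scalerBr addrCA.
rewrite xE (opvD dot_norm A_bounded) -xE.
rewrite dotDl !dotDr !dotZr conjCK VTb // (dot_eq0C (Vb _ NTa)).
rewrite mulr0 addr0 add0r ReD (Re_dotuu dot_norm) [X in nrm X]xE (nrm_sqr_orth dot_norm);
  last first.
  by apply: dot_eq0C; exact: Vb.
rewrite mulrDr; apply: lerD.
  rewrite -exprMn ler_pXn2r ?nnegrE ?mulr_ge0 ?nrm_ge0 ?(ltW c0) //; exact: hN.
apply: le_trans (hV _ Vb); rewrite ler_wpM2r ?sqr_ge0 // expr2 ler_piMr // ltW //.
Qed.

Variable z : C.
Hypothesis nqh : ~ quad_hull (essential_spectrum A) z.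

Lemma z_not_essential m : [set z; Num.conj z] m -> ~ essential_spectrum A m.
Proof. by have [h1 h2] := quad_hull_not_essential nqh; case=> ->. Qed.

Local Notation E := (discrete_eigenspan A [set z; Num.conj z]).
Local Notation T l := (opv (ET l)).

Lemma eigen_in_eigenspan m u : [set z; Num.conj z] m -> A u = m *: u -> E u.
Proof.
move=> mz Au; have [->|u0] := eqVneq u 0; first exact: (subsp_lspan _).1.
apply: sub_lspan; exists m => //; split=> //.
apply: not_essential_sap (z_not_essential mz) _.
exact: (@sap_eigen R H A setT m u).
Qed.

Lemma reducing_eigenspan_pair : reducing E.
Proof. exact: reducing_eigenspan. Qed.

Definition tz l := (Num.conj z - l) * (z - l).

(** Passing from z to conj z exchanges the two factors of the pencil, so one scalar serves for both
    eigenspaces. *)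
Lemma T_on_E l x : E x -> T l x = tz l *: x.
Proof.
have shA m y : A y = m *: y -> A y - l *: y = (m - l) *: y.
  by move=> ->; rewrite scalerBl.
have shB m y : A y = m *: y -> opv (ESub EZb l) y = (Num.conj m - l) *: y.
  by move=> Ay; rewrite /= (eigen_adjoint dot_norm A_bounded A_normal Ay) -scalerDl.
move: x; apply: lspan_sub => [|x [m [mz _] Ax]].
  split; first by rewrite (opv0 dot_norm A_bounded) scaler0.
  move=> a u v hu hv; rewrite (opvP dot_norm A_bounded) hu hv scalerDr !scalerA.
  by rewrite mulrC.
rewrite opv_ET (shA _ _ Ax) (opvZ dot_norm A_bounded) (shB _ _ Ax) scalerA /tz mulrC.
by case: mz => ->; rewrite ?conjCK // mulrC.
Qed.

Lemma T_diff : exists2 K : R, 0 < K & forall l, nrm (l - z) <= 1 ->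
  forall x, nrm (T l x - T z x) <= K * nrm (l - z) * nrm x.
Proof.
have [k k0 hk] := opv_bounded dot_norm A_bounded EZ.
have [k' k'0 hk'] := opv_bounded dot_norm A_bounded (ESub EZb z).
exists (k + (1 + nrm z) + k'); first by have := nrm_ge0 z; move: k0 k'0; lra.
move=> l hl x.
have -> : T l x - T z x = - ((l - z) *: (A x - l *: x)) - (l - z) *: opv (ESub EZb z) x.
  rewrite !opv_ET; have -> : A x - z *: x = (A x - l *: x) + (l - z) *: x.
    by rewrite scalerBl addrA subrK.
  rewrite (opvD dot_norm A_bounded (ESub EZb z)) (opvZ dot_norm A_bounded) opprD addrA;
    congr (_ - _).
  set y := A x - _; rewrite /= opprD addrACA subrr add0r -scalerBl -scaleNr.
  by congr (_ *: _); rewrite opprK opprB addrC.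
apply: le_trans (nrmB _ _) _; rewrite nrmN !nrmZ -mulrDr mulrAC [leRHS]mulrC.
rewrite ler_wpM2l ?nrm_ge0 // mulrDl; apply: lerD; last exact: hk'.
apply: le_trans (nrmB _ _) _; rewrite mulrDl; apply: lerD; first exact: hk.
rewrite nrmZ ler_wpM2r ?nrm_ge0 // -(subrK z l); apply: le_trans (nrmD _ _) _.
by rewrite lerD2r.
Qed.

Lemma T_bounded : exists2 K : R, 0 < K & forall l, nrm (l - z) <= 1 ->
  forall x, nrm (T l x) <= K * nrm x.
Proof.
have [K K0 hK] := T_diff; have [k k0 hk] := opv_bounded dot_norm A_bounded (ET z).
exists (K + k); first exact: addr_gt0.
move=> l hl x; rewrite -(subrK (T z x) (T l x)); apply: le_trans (nrmD _ _) _.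
rewrite mulrDl; apply: lerD (hk x); apply: le_trans (hK l hl x) _.
by rewrite ler_wpM2r ?nrm_ge0 // ler_piMr // ltW.
Qed.

(** Each factor contributes |l - z|: the adjoint minus l has the norm of A - conj l, and conj l is
    as far from conj z as l is from z. *)
Lemma T_low : exists2 rho : R, 0 < rho & forall l, nrm (l - z) <= rho ->
  forall x, nrm (l - z) ^+ 2 * nrm x <= nrm (T l x).
Proof.
have [r1 r10 h1] : exists2 rho : R, 0 < rho & forall l, nrm (l - z) <= rho ->
    forall x, nrm (l - z) * nrm x <= nrm (A x - l *: x).
  by apply: shift_low; apply: not_essential_isolated; apply: z_not_essential; left.
have [r2 r20 h2] : exists2 rho : R, 0 < rho & forall l, nrm (l - Num.conj z) <= rho ->
    forall x, nrm (l - Num.conj z) * nrm x <= nrm (A x - l *: x).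
  by apply: shift_low; apply: not_essential_isolated; apply: z_not_essential; right.
exists (Num.min r1 r2); first by rewrite lt_min r10.
move=> l; rewrite le_min => /andP[l1 l2] x.
have cE : nrm (Num.conj l - Num.conj z) = nrm (l - z).
  by rewrite -conjN -conjD nrm_conj.
rewrite opv_ET shift_adj_nrm.
apply: le_trans (h2 (Num.conj l) _ _); last by rewrite cE.
by rewrite cE expr2 -mulrA ler_wpM2l ?nrm_ge0 //; exact: h1.
Qed.

(** On the complement of E both factors are bounded below at l = z itself, so the bound persists on
    a full neighbourhood of z. This controls Galerkin eigenvectors for l arbitrarily close to z. *)
Lemma T_low_orth : exists2 c : R, 0 < c & exists2 rho : R, 0 < rho &
  forall l, nrm (l - z) <= rho -> forall x, orthc E x -> c * nrm x <= nrm (T l x).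
Proof.
have low m : [set z; Num.conj z] m -> exists2 d : R, 0 < d &
    forall x, orthc E x -> d * nrm x <= nrm (A x - m *: x).
  move=> mz; have [d d0 hd] := not_essential_isolated (z_not_essential mz).
  exists d => // x Ex; apply: (isolated_bound dot_norm A_bounded A_normal d0 hd) => u Au.
  by apply: Ex; exact: eigen_in_eigenspan Au.
have [d1 d10 h1] := low z (or_introl erefl).
have [d2 d20 h2] := low (Num.conj z) (or_intror erefl).
have [K K0 hK] := T_diff.
have rO := reducing_orthc dot_norm A_bounded reducing_eigenspan_pair.
have d0 : 0 < d1 * d2 by rewrite mulr_gt0.
exists (d1 * d2 / 2); first by rewrite divr_gt0.
exists (Num.min 1 (d1 * d2 / 2 / K)); first by rewrite lt_min ltr01 !divr_gt0.
move=> l; rewrite le_min => /andP[l1]; rewrite ler_pdivlMr // => l2 x Ex.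
have h : d1 * d2 * nrm x <= nrm (T z x).
  rewrite opv_ET shift_adj_nrm; apply: le_trans (h2 _ _).
    by rewrite (mulrC d1) -mulrA ler_pM2l //; exact: h1.
  by have := opv_reducing (ESub EZ z) rO Ex; rewrite /= scaleNr.
have h3 := hK l l1 x; rewrite nrmBC in h3.
have h4 := nrmD (T z x - T l x) (T l x); rewrite subrK in h4.
have h5 : K * nrm (l - z) * nrm x <= d1 * d2 / 2 * nrm x.
  by rewrite ler_wpM2r ?nrm_ge0 // mulrC.
lra.
Qed.

Lemma T_coercive_near (N : set H) (w : C) (c : R) : 0 < c ->
  (forall x, orthc N x -> c * nrm x ^+ 2 <= Re (w * dot (T z x) x)) ->
  exists2 rho : R, 0 < rho & forall l, nrm (l - z) <= rho ->
    forall x, orthc N x -> c / 2 * nrm x ^+ 2 <= Re (w * dot (T l x) x).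
Proof.
move=> c0 hc; have [K K0 hK] := T_diff.
have Kw : 0 < K * (1 + nrm w) by rewrite mulr_gt0 // ltr_pwDl ?nrm_ge0.
exists (Num.min 1 (c / 2 / (K * (1 + nrm w)))); first by rewrite lt_min ltr01 !divr_gt0.
move=> l; rewrite le_min => /andP[l1]; rewrite ler_pdivlMr // => l2 x Nx.
have h1 := hc x Nx.
have h2 : Re (w * dot (T z x - T l x) x) <= c / 2 * nrm x ^+ 2.
  apply: le_trans (Re_le_nrm _) _; rewrite nrmM.
  apply: (le_trans (y := nrm w * (K * nrm (l - z) * nrm x * nrm x))).
    rewrite ler_wpM2l ?nrm_ge0 //; apply: le_trans (cauchy_schwarz dot_norm _ _) _.
    by rewrite ler_wpM2r ?nrm_ge0 // nrmBC; exact: hK.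
  rewrite expr2 !mulrA ler_wpM2r ?nrm_ge0 // ler_wpM2r ?nrm_ge0 //.
  apply: le_trans l2; have := mulr_ge0 (ltW K0) (nrm_ge0 (l - z)).
  have := nrm_ge0 w; nra.
rewrite dotBl mulrBr ReD ReN in h2; lra.
Qed.

Variable L : nat -> set H.
Hypothesis L_Lambda : Lambda dot L.
Local Notation P n := (orthproj dot (L n)).

Lemma Lambda_findim n : findim_subspace (L n). Proof. exact: L_Lambda.1. Qed.

(* Test vector: with a the component of v in N, T(l) v is paired with
   conj w v + (T(l) a - conj w a), which gives |T(l) a|^2 on N and the coercive form on
   its complement, and which is almost in L_n because N is finite-dimensional. *)
Lemma galerkin_stable : exists2 rho0 : R, 0 < rho0 & forall rho, 0 < rho ->
  exists2 alpha : R, 0 < alpha & exists n0, forall n, (n0 <= n)%N ->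
    forall l, rho <= nrm (l - z) -> nrm (l - z) <= rho0 ->
    forall v, L n v -> alpha * nrm v <= nrm (P n (T l v)).
Proof.
have [N [w [c [c0 fN rN _ hc]]]] := coercive_complement dot_norm A_bounded A_normal nqh.
have [r1 r10 h1] := T_coercive_near c0 hc; have [r2 r20 h2] := T_low.
have [K K0 hK] := T_bounded.
exists (Num.min 1 (Num.min r1 r2)); first by rewrite !lt_min ltr01 r10.
move=> rho rho0; pose b := Num.min 1 (Num.min (c / 2) (rho ^+ 2)).
have b0 : 0 < b by rewrite !lt_min ltr01 divr_gt0 // exprn_gt0.
have b1 : b <= 1 by rewrite ge_min lexx.
have bc : b <= c / 2 by rewrite !ge_min lexx orbT.
have br : b <= rho ^+ 2 by rewrite !ge_min lexx !orbT.
pose M := K + nrm w; have M0 : 0 < M by rewrite ltr_pwDl ?nrm_ge0.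
(* Chosen so that the part of q outside L_n costs at most K eta M |v|^2, half of the coercive term
   b^2 |v|^2. *)
pose eta := b ^+ 2 / 2 / (K * M).
have eta0 : 0 < eta by rewrite !divr_gt0 ?exprn_gt0 ?mulr_gt0.
have [n0 hn0] := proj_unif dot_norm L_Lambda fN eta0.
have Mw : 0 < nrm w + M by rewrite ltr_wpDl ?nrm_ge0.
exists (b ^+ 2 / 2 / (nrm w + M)); first by rewrite !divr_gt0 ?exprn_gt0.
exists n0 => n nn0 l lr; rewrite !le_min => /and3P[l1 l2 l3] v Lv.
pose a := orthproj dot N v; pose q := T l a - Num.conj w *: a.
have Na : N a by exact: (proj_in dot_norm).
have na : nrm a <= nrm v by exact: (nrm_proj dot_norm).
have Nq : N q.
  by apply: subspB; [case: rN|exact: (opv_reducing _ rN Na)|apply: subspZ => //; case: rN].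
have nq : nrm q <= M * nrm v.
  apply: le_trans (nrmB _ _) _; rewrite nrmZ nrm_conj /M mulrDl; apply: lerD.
    by apply: le_trans (hK l l1 _) _; rewrite ler_pM2l.
  by rewrite ler_wpM2l ?nrm_ge0.
pose J := Num.conj w *: v + q.
have key : b ^+ 2 * nrm v ^+ 2 <= Re (dot (T l v) J).
  apply: (@t_coercive N setT w b (ET l) v) => //.
    move=> y Ny; apply: le_trans (h1 l l2 y Ny); rewrite ler_wpM2r ?sqr_ge0 //.
  move=> y _ _; apply: le_trans (h2 l l3 y); rewrite ler_wpM2r ?nrm_ge0 //.
  by apply: le_trans br _; rewrite ler_pXn2r ?nnegrE ?nrm_ge0 // ltW.
have nJ : nrm J <= (nrm w + M) * nrm v.
  by apply: le_trans (nrmD _ _) _; rewrite nrmZ nrm_conj mulrDl lerD2l.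
(* As v lies in L_n, only the component q of the test vector, taken from the fixed space N, is
   affected by the projection. *)
have JP : J - P n J = q - P n q.
  rewrite /J (projD dot_norm (Lambda_findim n)) (projZ dot_norm (Lambda_findim n)).
  rewrite (proj_id dot_norm (Lambda_findim n) Lv).
  by rewrite opprD addrACA subrr add0r.
have split : dot (T l v) J = dot (P n (T l v)) J + dot (T l v) (q - P n q).
  by rewrite (proj_adj dot_norm (Lambda_findim n)) -JP -dotDr addrC subrK.
have e1 := Re_dot_le dot_norm (P n (T l v)) J.
have e2 := Re_dot_le dot_norm (T l v) (q - P n q).
have e3 : nrm (T l v) * nrm (q - P n q) <= b ^+ 2 / 2 * nrm v ^+ 2.
  apply: (le_trans (y := (K * nrm v) * (eta * (M * nrm v)))).
    apply: ler_pM; rewrite ?nrm_ge0 //; first exact: hK.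
    by apply: le_trans (hn0 n nn0 q Nq) _; rewrite ler_pM2l.
  rewrite le_eqVlt; apply/orP; left; apply/eqP; rewrite /eta; field.
  by rewrite !gt_eqF.
have [->|v0] := eqVneq v 0; first by rewrite nrm0 mulr0 nrm_ge0.
have vp : 0 < nrm v by rewrite nrm_gt0.
rewrite mulrAC ler_pdivrMr // -(ler_pM2r vp).
have e4 : nrm (P n (T l v)) * nrm J <= nrm (P n (T l v)) * ((nrm w + M) * nrm v).
  by rewrite ler_wpM2l ?nrm_ge0.
rewrite split ReD in key; rewrite -!mulrA -expr2.
move: key e1 e2 e3 e4; rewrite [b ^+ 2 / 2 * _]mulrAC -mulrA; lra.
Qed.

Local Notation eps n := (gap E (L n)).

Lemma findim_eigenspan : findim_subspace E.
Proof.
have [N [w [c [c0 [s ->] rN EN _]]]] := coercive_complement dot_norm A_bounded A_normal nqh.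
apply: (@findim_sub _ _ s); first exact: subsp_lspan.
apply: lspan_sub (subsp_lspan _) _ => x [m [mz dm] Ax]; exact: EN Ax.
Qed.

(** The test vector of the stability estimate is built from y = v - e, in the complement of E, where
    the pencil is bounded below up to l = z. Since y itself is not in L_n, the defect of e against
    L_n enters, and it is at most eps |e|. The scalar on E is then a product of two such defects,
    whence the square. *)
Lemma galerkin_eigvec : exists2 rho : R, 0 < rho & exists2 K : R, 0 < K &
  exists n0, forall n, (n0 <= n)%N -> forall l, nrm (l - z) <= rho ->
  forall v, L n v -> (forall y, L n y -> dot (T l v) y = 0) ->
  let e := orthproj dot E v in
  nrm (v - e) <= K * eps n * nrm e /\
  nrm (tz l) * nrm e ^+ 2 <= K * eps n ^+ 2 * nrm e ^+ 2.
Proof.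
have [N [w [c [c0 fN rN EN hc]]]] := coercive_complement dot_norm A_bounded A_normal nqh.
have [r1 r10 h1] := T_coercive_near c0 hc.
have [d d0 [r2 r20 h2]] := T_low_orth; have [K K0 hK] := T_bounded.
exists (Num.min 1 (Num.min r1 r2)); first by rewrite !lt_min ltr01 r10.
pose b := Num.min 1 (Num.min (c / 2) d).
have b0 : 0 < b by rewrite !lt_min ltr01 divr_gt0.
have b1 : b <= 1 by rewrite ge_min lexx.
have bc : b <= c / 2 by rewrite !ge_min lexx orbT.
have bd : b <= d by rewrite !ge_min lexx !orbT.
pose M := K + nrm w; have M0 : 0 < M by rewrite ltr_pwDl ?nrm_ge0.
(* The bound 1/2, applied to e in N, gives |e|^2 <= 2 |P_n e|^2; the other bound absorbs the error
   of q into half of the coercive term. *)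
pose eta := Num.min 2^-1 (b ^+ 2 / 2 / (K * M)).
have eta0 : 0 < eta by rewrite lt_min invr_gt0 ltr0n !divr_gt0 ?exprn_gt0 ?mulr_gt0.
have [n0 hn0] := proj_unif dot_norm L_Lambda fN eta0.
have w0 := nrm_ge0 w.
have tzK l x : nrm (l - z) <= 1 -> E x -> nrm (tz l) * nrm x <= K * nrm x.
  by move=> l1 Ex; rewrite -nrmZ -T_on_E //; exact: hK.
(* Twice the sum of the coefficients of eps |e| |y| in the estimates of the terms with T e and with
   T y, divided by b^2; the factor 2 pays for the absorbed half. *)
pose K1 := 2 * (K * (nrm w + M) + K * nrm w) / b ^+ 2.
have K10 : 0 < K1 by rewrite divr_gt0 ?exprn_gt0 // mulr_gt0 //
    ltr_pwDl ?mulr_ge0 ?(ltW K0) // mulr_gt0 // ltr_wpDl.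
exists (K1 + 2 * K * K1); first by rewrite addr_gt0 // mulr_gt0 // mulr_gt0.
exists n0 => n nn0 l; rewrite !le_min => /and3P[l1 l2 l3] v Lv hv e; pose y := v - e.
have sE : subsp E by exact: subsp_lspan.
have Ee : E e by exact: (proj_in dot_norm findim_eigenspan).
have Oy : orthc E y by move=> u Eu; exact: (proj_orth dot_norm findim_eigenspan).
have rO := reducing_orthc dot_norm A_bounded reducing_eigenspan_pair.
have subEN : E `<=` N.
  by apply: lspan_sub; [case: rN|move=> u [m [mz dm] Au]; exact: EN Au].
pose a := orthproj dot N y; pose q := T l a - Num.conj w *: a.
have Na : N a by exact: (proj_in dot_norm).
have Oa : orthc E a.
  by move=> u Eu; rewrite (proj_dotl dot_norm fN) ?Oy //; exact: subEN.
have na : nrm a <= nrm y by exact: (nrm_proj dot_norm).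
have Nq : N q.
  by apply: subspB; [case: rN|exact: (opv_reducing _ rN Na)|apply: subspZ => //; case: rN].
have nq : nrm q <= M * nrm y.
  apply: le_trans (nrmB _ _) _; rewrite nrmZ nrm_conj /M mulrDl; apply: lerD.
    by apply: le_trans (hK l l1 _) _; rewrite ler_pM2l.
  by rewrite ler_wpM2l ?nrm_ge0.
pose J := Num.conj w *: y + q.
have OJ : orthc E J.
  have sO := subsp_orthc dot E; apply: (subspD sO); first exact: (subspZ _ sO).
  by apply: (subspB sO); [exact: (opv_reducing _ rO Oa)|exact: (subspZ _ sO)].
have key : b ^+ 2 * nrm y ^+ 2 <= Re (dot (T l y) J).
  apply: (@t_coercive N (orthc E) w b (ET l) y) => //.
    move=> x Nx; apply: le_trans (h1 l l2 x Nx); rewrite ler_wpM2r ?sqr_ge0 //.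
  move=> x _ Ox; apply: le_trans (h2 l l3 x Ox); rewrite ler_wpM2r ?nrm_ge0 //.
have nJ : nrm J <= (nrm w + M) * nrm y.
  by apply: le_trans (nrmD _ _) _; rewrite nrmZ nrm_conj mulrDl lerD2l.
have ee : nrm (e - P n e) <= eps n * nrm e.
  exact: (gap_le dot_norm (Lambda_findim n) sE Ee).
have vE : v = e + y by rewrite addrC subrK.
have JP : J - P n J = - (Num.conj w *: (e - P n e)) + (q - P n q).
  have -> : J = Num.conj w *: v - Num.conj w *: e + q by rewrite /J /y scalerBr.
  rewrite (projD dot_norm (Lambda_findim n)) (projB dot_norm (Lambda_findim n)).
  rewrite !(projZ dot_norm (Lambda_findim n)).
  rewrite (proj_id dot_norm (Lambda_findim n) Lv) opprD addrACA; congr (_ + _).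
  by rewrite opprB [LHS]addrC addrA subrK -scalerBr -scalerN opprB.
have T_e : T l e = tz l *: e by exact: T_on_E.
(* T e is a multiple of e and so orthogonal to J: y may be replaced by v, and then P_n J drops out
   by the Galerkin equation. *)
have zero1 : dot (T l y) J = dot (T l v) (J - P n J) .
  rewrite dotBr (hv (P n J)) ?subr0; last exact: (proj_in dot_norm (Lambda_findim n)).
  rewrite vE (opvD dot_norm A_bounded) dotDl T_e dotZl (dot_eq0C (OJ _ Ee)).
  by rewrite mulr0 add0r.
have e1 : nrm (dot (T l e) (J - P n J)) <= K * nrm e * (eps n * ((nrm w + M) * nrm y)).
  rewrite T_e dotZl nrmM.
  (* Moving the complementary projection onto e gains the factor eps. *)
  have -> : dot e (J - P n J) = dot (e - P n e) J.
    by rewrite dotBr dotBl (proj_adj dot_norm (Lambda_findim n)).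
  apply: (le_trans (y := nrm (tz l) * (eps n * nrm e * ((nrm w + M) * nrm y)))).
    rewrite ler_wpM2l ?nrm_ge0 //; apply: le_trans (cauchy_schwarz dot_norm _ _) _.
    by apply: ler_pM; rewrite ?nrm_ge0.
  have -> : nrm (tz l) * (eps n * nrm e * ((nrm w + M) * nrm y)) =
    nrm (tz l) * nrm e * (eps n * ((nrm w + M) * nrm y)) by ring.
  apply: ler_wpM2r; last exact: tzK.
  rewrite mulr_ge0 ?(gap_ge0 dot_norm (Lambda_findim n)) // mulr_ge0 ?nrm_ge0 //.
  by rewrite addr_ge0 // ltW.
have e2 : nrm (dot (T l y) (J - P n J)) <=
    K * nrm y * (nrm w * (eps n * nrm e) + eta * (M * nrm y)).
  apply: le_trans (cauchy_schwarz dot_norm _ _) _; apply: ler_pM; rewrite ?nrm_ge0 //.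
    exact: hK.
  rewrite JP; apply: le_trans (nrmD _ _) _; rewrite nrmN nrmZ nrm_conj; apply: lerD.
    by rewrite ler_wpM2l ?nrm_ge0.
  by apply: le_trans (hn0 n nn0 q Nq) _; rewrite ler_pM2l.
have e3 : K * nrm y * (eta * (M * nrm y)) <= b ^+ 2 / 2 * nrm y ^+ 2.
  have : eta * (K * M) <= b ^+ 2 / 2.
    by rewrite -ler_pdivlMr ?mulr_gt0 // ge_min lexx orbT.
  have := sqr_ge0 (nrm y) => y2 /(ler_wpM2r y2); apply: le_trans.
  by rewrite le_eqVlt; apply/orP; left; apply/eqP; ring.
have eps0 : 0 <= eps n := gap_ge0 dot_norm (Lambda_findim n) E.
have y1 : nrm y <= K1 * eps n * nrm e.
  have [->|y0] := eqVneq y 0.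
    by rewrite nrm0; exact: mulr_ge0 (mulr_ge0 (ltW K10) eps0) (nrm_ge0 e).
  have yp : 0 < nrm y by rewrite nrm_gt0.
  have e4 := Re_le_nrm (dot (T l v) (J - P n J)).
  have : nrm (dot (T l v) (J - P n J)) <=
      nrm (dot (T l e) (J - P n J)) + nrm (dot (T l y) (J - P n J)).
    by rewrite {1}vE (opvD dot_norm A_bounded) dotDl nrmD.
  rewrite zero1 in key => e5.
  have main : b ^+ 2 * nrm y <= 2 * (K * (nrm w + M) + K * nrm w) * (eps n * nrm e).
    rewrite -(ler_pM2r yp); move: key e1 e2 e3 e4 e5; lra.
  rewrite -(ler_pM2l (exprn_gt0 2 b0)); apply: le_trans main _.
  rewrite le_eqVlt; apply/orP; left; apply/eqP; rewrite /K1; field.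
  exact: lt0r_neq0.
clearbody K1.
have K1' : K1 <= K1 + 2 * K * K1.
  by rewrite lerDl; exact: mulr_ge0 (mulr_ge0 (ler0n _ 2) (ltW K0)) (ltW K10).
split.
  apply: le_trans y1 _; rewrite -[leLHS]mulrA -[leRHS]mulrA; apply: ler_wpM2r K1'.
  exact: mulr_ge0 eps0 (nrm_ge0 _).
have eps_half : nrm (e - P n e) <= 2^-1 * nrm e.
  apply: le_trans (hn0 n nn0 e (subEN _ Ee)) _; rewrite ler_wpM2r ?nrm_ge0 //.
  by rewrite ge_min lexx.
have hPe : nrm e ^+ 2 <= 2 * nrm (P n e) ^+ 2.
  have := proj_pyth dot_norm (Lambda_findim n) e; have := nrm_ge0 (e - P n e); have := nrm_ge0 e.
  move: eps_half; nra.
(* The Galerkin equation is tested with P_n e; since T y is orthogonal to e, the vector P_n e may be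
   replaced by its defect. *)
have z2 : tz l * (nrm (P n e) ^+ 2)%:C = dot (T l y) (e - P n e).
  have Lpe : L n (P n e) by exact: (proj_in dot_norm (Lambda_findim n)).
  have := hv _ Lpe; rewrite {1}vE (opvD dot_norm A_bounded) dotDl T_e dotZl.
  rewrite -(proj_dotl dot_norm (Lambda_findim n) e Lpe) (dotuu dot_norm).
  have OTy : orthc E (T l y) by exact: (opv_reducing _ rO Oy).
  by move=> /eqP; rewrite addr_eq0 => /eqP ->; rewrite dotBr (OTy _ Ee) sub0r.
have : nrm (tz l) * nrm (P n e) ^+ 2 <= K * (K1 * eps n * nrm e) * (eps n * nrm e).
  have -> : nrm (P n e) ^+ 2 = nrm ((nrm (P n e) ^+ 2)%:C : C).
    by rewrite nrm_real ger0_norm ?sqr_ge0.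
  rewrite -nrmM z2; apply: le_trans (cauchy_schwarz dot_norm _ _) _.
  apply: ler_pM; rewrite ?nrm_ge0 //; apply: le_trans (hK l l1 _) _.
  by rewrite ler_pM2l.
have := ler_wpM2l (nrm_ge0 (tz l)) hPe.
have : 0 <= K1 * eps n ^+ 2 * nrm e ^+ 2.
  exact: mulr_ge0 (mulr_ge0 (ltW K10) (sqr_ge0 _)) (sqr_ge0 _).
move=> p1 p2 p3; rewrite !expr2 in p1 p2 p3 *.
have -> : (K1 + 2 * K * K1) * (eps n * eps n) * (nrm e * nrm e) =
  K1 * (eps n * eps n) * (nrm e * nrm e) + 2 * (K * (K1 * eps n * nrm e) * (eps n * nrm e)).
  ring.
lra.
Qed.

End Galerkin.

(** * The block operator *)

Section FiniteDim.
Variables (R : realType) (H : completeNormedModType R[i]).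
Variable dot : {dot H for Num.conj}.
Hypothesis dot_norm : forall u : H, dot u u = `|u| ^+ 2.
Local Notation C := R[i].
Local Notation Re := complex.Re.

Lemma rV_continuous_cvg k (f : 'rV[R[i]^o]_k -> R) (v : 'rV[R[i]^o]_k) :
  (forall e : R, 0 < e -> exists2 d : R, 0 < d & forall u : 'rV[R[i]^o]_k,
     (forall i, nrm (u ord0 i - v ord0 i : C) < d) -> `|f u - f v| < e) ->
  f u @[u --> v] --> f v.
Proof.
move=> h U /nbhs_ballP[e /= e0 hU]; have [d d0 hd] := h _ e0.
apply: (nbhs_ballP v _).2; exists d%:C; first by rewrite /= ltcR.
move=> u hu; apply: hU; rewrite -ball_normE /= distrC; apply: hd => i.
have := hu.2 ord0 i; rewrite -ball_normE /= -nrmE ltcR.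
by rewrite nrmBC.
Qed.

Lemma sphere_min M (F : H -> H) : findim_subspace M -> linear F ->
  (exists2 k : R, 0 <= k & forall x, nrm (F x) <= k * nrm x) ->
  (exists2 x, M x & x != 0) ->
  exists2 x, M x /\ nrm x = 1 & forall y, M y -> nrm y = 1 -> nrm (F x) <= nrm (F y).
Proof.
move=> fM lF [K K0 hK] [x0 Mx0 x00].
have FB u v : F (u - v) = F u - F v.
  by rewrite addrC -scaleN1r lF scaleN1r addrC.
have [k [e eM]] := onb_ex dot_norm fM.
pose f (c : 'rV[R[i]^o]_k) : R := nrm (comb e (c : 'rV[C]_k)).
pose g (c : 'rV[R[i]^o]_k) : R := nrm (F (comb e (c : 'rV[C]_k))).
have combB (u v : 'rV[C]_k) : comb e (u - v) = comb e u - comb e v.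
  by rewrite addrC -scaleN1r combP scaleN1r addrC.
have close (G : H -> H) (B : R) : (forall u v, G (u - v) = G u - G v) -> 0 <= B ->
    (forall x, nrm (G x) <= B * nrm x) ->
    continuous (fun c : 'rV[R[i]^o]_k => nrm (G (comb e (c : 'rV[C]_k))) : R).
  move=> GB B0 hB v; apply: rV_continuous_cvg => d d0.
  have k1 : 0 < (B + 1) * k.+1%:R by rewrite mulr_gt0 // ltr_wpDl.
  exists (d / ((B + 1) * k.+1%:R)); first by rewrite divr_gt0.
  move=> u hu.
  have h1 : nrm (comb e (u : 'rV[C]_k) - comb e (v : 'rV[C]_k)) <= k%:R * (d / ((B + 1) * k.+1%:R)).
    rewrite -combB; apply: le_trans (comb_le dot_norm eM _) _.
    apply: (le_trans (y := \sum_(i < k) d / ((B + 1) * k.+1%:R))).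
      by apply: ler_sum => i _; rewrite !mxE; apply/ltW/hu.
    by rewrite sumr_const card_ord -[leLHS]mulr_natl.
  have h2 : nrm (G (comb e (u : 'rV[C]_k)) - G (comb e (v : 'rV[C]_k))) < d.
    rewrite -GB; apply: le_lt_trans (hB _) _.
    apply: le_lt_trans (ler_wpM2l B0 h1) _.
    have -> : B * (k%:R * (d / ((B + 1) * k.+1%:R))) =
        (B * k%:R) * d / ((B + 1) * k.+1%:R) by rewrite !mulrA.
    rewrite ltr_pdivrMr // mulrC ltr_pM2l //.
    have : k%:R < k.+1%:R :> R by rewrite ltr_nat.
    have : 0 <= k%:R :> R by []; move: B0; nra.
  rewrite ltr_norml; apply/andP; split.
    rewrite ltrNl opprB; apply: le_lt_trans h2; rewrite nrmBC lerBlDr.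
    by rewrite -{1}(subrK (G (comb e (u : 'rV[C]_k))) (G (comb e (v : 'rV[C]_k)))); exact: nrmD.
  apply: le_lt_trans h2; rewrite lerBlDr.
  by rewrite -{1}(subrK (G (comb e (v : 'rV[C]_k))) (G (comb e (u : 'rV[C]_k)))); exact: nrmD.
have cf : continuous f by apply: (close id 1) => // x; rewrite mul1r.
have cg : continuous g by apply: (close F K).
(* The constraint on the coordinates holds for every unit vector; it is added to obtain
   compactness. *)
pose S : set 'rV[R[i]^o]_k :=
  [set c : 'rV[R[i]^o]_k | forall i, csquare 1 (c ord0 i)] `&` (f @^-1` [set 1]).
have cS : compact S.
  apply: compact_closedI.
    by apply: (rV_compact (T := R[i]^o) (A := fun=> csquare 1)) => i; exact: compact_csquare.
  by apply: closed_comp => [c _|]; [exact: cf|exact: closed_eq].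
have Sin (c : 'rV[R[i]^o]_k) : f c = 1 -> S c.
  move=> fc; split=> // i; have := coord_le dot_norm eM (c : 'rV[C]_k) i.
  rewrite -/(f c) fc => h; split; apply: le_trans h; [exact: normRe_le|exact: normIm_le].
have [a [a0 _ ax1]] := normalize x00.
have Max : M (a%:C *: x0) by apply: subspZ => //; exact: subsp_findim.
have S0 : S !=set0.
  by move: Max ax1; rewrite {1}eM.2 => -[c _ <-] c1; exists c; exact: Sin.
have [c] := compact_EVT_min S0 cS (continuous_subspaceT cg).
rewrite inE => -[_ fc] hc; exists (comb e (c : 'rV[C]_k)).
  by split=> //; exact: comb_in eM _.
move=> y; rewrite eM.2 => -[d _ <-] d1.
by apply: (hc d); rewrite inE; exact: Sin.
Qed.

Lemma findim_inverse M (F : H -> H) : findim_subspace M -> linear F ->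
  (forall x, M x -> M (F x)) -> (forall x, M x -> F x = 0 -> x = 0) ->
  exists B : H -> H, [/\ forall x, M x -> M (B x), forall x, M x -> B (F x) = x,
     forall x, M x -> F (B x) = x & exists k : R, forall x, M x -> nrm (B x) <= k * nrm x].
Proof.
move=> fM lF MF iF; have [k [e eM]] := onb_ex dot_norm fM.
pose a : 'M[C]_k := \matrix_(i, j) dot (F (e i)) (e j).
pose co (x : H) : 'rV[C]_k := \row_j dot x (e j).
have coK (c : 'rV[C]_k) : co (comb e c) = c.
  by apply/rowP => j; rewrite mxE (dot_comb eM).
have combK x : M x -> comb e (co x) = x.
  by rewrite eM.2 => -[c _ <-]; rewrite coK.
have ein i : M (e i).
  rewrite -[e i](_ : comb e (delta_mx ord0 i) = _); first exact: comb_in eM _.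
  rewrite /comb (bigD1 i) //= big1 ?addr0; first by rewrite mxE !eqxx scale1r.
  by move=> j ji; rewrite mxE eqxx (negbTE ji) scale0r.
have F0 : F 0 = 0 by have := lF (-1) 0 0; rewrite scaler0 addr0 scaleN1r addNr.
have Fcomb (c : 'rV[C]_k) : F (comb e c) = comb e (c *m a).
  have -> : F (comb e c) = \sum_i c ord0 i *: F (e i).
    rewrite /comb; elim/big_rec2: _ => [//|i y1 y2 _ <-]; exact: lF.
  have -> : comb e (c *m a) = \sum_i c ord0 i *: comb e (row i a).
    rewrite /comb; under eq_bigr do rewrite mxE scaler_suml.
    rewrite exchange_big /=; apply: eq_bigr => i _; rewrite scaler_sumr.
    by apply: eq_bigr => j _; rewrite [in RHS]mxE scalerA.
  apply: eq_bigr => i _; congr (_ *: _); rewrite -[LHS]combK; last exact: MF.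
  by congr comb; apply/rowP => j; rewrite !mxE.
have ua : a \in unitmx.
  rewrite -row_free_unit -kermx_eq0; apply/eqP/row_matrixP => i; rewrite row0.
  set c := row i _; have ca : c *m a = 0 by rewrite -row_mul mulmx_ker row0.
  have : comb e c = 0.
    apply: iF; first exact: comb_in eM _.
    by rewrite Fcomb ca /comb big1 // => j _; rewrite mxE scale0r.
  by move=> h; rewrite -(coK c) h; apply/rowP => j; rewrite !mxE dot0l.
exists (fun x => comb e (co x *m invmx a)); split=> [x Mx|x Mx|x Mx|].
- exact: comb_in eM _.
- by rewrite -(combK x Mx) Fcomb coK mulmxK.
- by rewrite Fcomb mulmxKV // combK.
exists (\sum_j \sum_i nrm (invmx a i j)) => x Mx.
apply: le_trans (comb_le dot_norm eM _) _; rewrite mulr_suml; apply: ler_sum => j _.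
rewrite mxE; apply: le_trans (nrm_sum _ _ _) _; rewrite mulr_suml; apply: ler_sum => i _.
rewrite nrmM mulrC ler_wpM2l ?nrm_ge0 // -[in leRHS](combK x Mx).
exact: coord_le eM _ _.
Qed.

Lemma prod_nrmE (x : H * H) : nrm x = Num.max (nrm x.1) (nrm x.2).
Proof.
apply: (@complexI R); rewrite nrmE prod_normE -!nrmE.
by rewrite /Order.max ltcR; case: ifP.
Qed.

End FiniteDim.

(** * The block operator as linearization of the projected pencil *)

Section QuadBlock.
Variables (R : realType) (H : completeNormedModType R[i]).
Variable dot : {dot H for Num.conj}.
Hypothesis dot_norm : forall u : H, dot u u = `|u| ^+ 2.
Variable A : {linear H -> H}.
Hypothesis A_bounded : bounded_on setT A.
Hypothesis A_normal : normal_op dot A.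
Variable L : set H.
Hypothesis fL : findim_subspace L.
Local Notation C := R[i].
Local Notation Ad := (adjoint dot A).
Local Notation opv := (opv dot A).
Local Notation P := (orthproj dot L).
Local Notation T l := (opv (ET l)).
Local Notation S := (quad_block dot A L).
Implicit Types (u v x y : H) (l : C).

Let sL := subsp_findim fL.

Lemma AdP : linear Ad.
Proof. exact: (adjoint_linear dot_norm A_bounded). Qed.
Lemma AdD u v : Ad (u + v) = Ad u + Ad v.
Proof. by have := AdP 1 u v; rewrite !scale1r. Qed.
Lemma AdZ c u : Ad (c *: u) = c *: Ad u.
Proof. exact: (opvZ dot_norm A_bounded EZb). Qed.

Lemma quad_block_linear : linear S.
Proof.
move=> a [u1 u2] [v1 v2]; congr pair; rewrite /=.
rewrite !(linearP, linearD, linearZ) /= !(AdD, AdZ).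
rewrite addrACA -scalerDr.
rewrite [P (a *: _ + (_ + _))](proj_linear dot_norm fL) [P (a *: _ + _)](proj_linear dot_norm fL).
by rewrite scalerN opprD addrACA.
Qed.

Lemma quad_block_in (x : H * H) : (L `*` L) x -> (L `*` L) (S x).
Proof.
by move=> [L1 L2]; split=> //=; apply: subspB => //; exact: (proj_in dot_norm fL).
Qed.

(** The compressed pencil is a monic quadratic polynomial in l on L, and the entries of the block
    operator are its coefficients. *)
Lemma projT l v : L v ->
  P (T l v) = P (Ad (A v)) - l *: P (A v + Ad v) + (l ^+ 2) *: v.
Proof.
move=> Lv; rewrite -[in X in _ = _ + X](proj_id dot_norm fL Lv).
rewrite -!(projZ dot_norm fL) -(projB dot_norm fL) -(projD dot_norm fL); congr P.
rewrite opv_ET /= AdD -scaleNr AdZ scalerDr scalerA mulrNN -expr2 scalerDr opprD !scaleNr.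
by rewrite -!addrA; congr (_ + _); rewrite addrCA.
Qed.

Lemma quad_block_shift l u v : S (u, v) - l *: (u, v) =
  (P (A u + Ad u) - P (Ad (A v)) - l *: u, u - l *: v).
Proof. by []. Qed.

(** If the compressed pencil is injective on L, the resolvent is explicit. The second row gives the
    first component l y + v for the unknown second component y; inserted into the first row it
    leaves P T(l) y = w (u, v). *)
Lemma quad_spectrum_eigvec l : quad_spectrum dot A L l ->
  exists v, [/\ L v, v != 0 & P (T l v) = 0].
Proof.
move=> sp; apply: contrapT => nv; apply: sp.
have [] := findim_inverse dot_norm (F := fun v => P (T l v)) fL.
- by move=> c u v; rewrite (opvP dot_norm A_bounded) (proj_linear dot_norm fL).
- by move=> x _; exact: (proj_in dot_norm fL).
- move=> x Lx hx; apply/eqP; apply: contrapT => /negP x0.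
  by apply: nv; exists x.
move=> B [LB BK KB [k hk]].
have [k' k'0 hk'] := opv_bounded dot_norm A_bounded (EAdd EZ EZb).
pose w (x : H * H) := - (x.1 + l *: x.2 - P (A x.2 + Ad x.2)).
have Lw (x : H * H) : (L `*` L) x -> L (w x).
  move=> [L1 L2]; rewrite /w -scaleN1r; apply: subspZ => //; apply: subspB => //.
    by apply: subspD => //; exact: subspZ.
  exact: (proj_in dot_norm fL).
have PB1 u v : P (A (u - l *: v) + Ad (u - l *: v)) =
    P (A u + Ad u) - l *: P (A v + Ad v).
  rewrite -[A _ + _]/(opv (EAdd EZ EZb) _) (opvB dot_norm A_bounded).
  by rewrite (opvZ dot_norm A_bounded) (projB dot_norm fL) (projZ dot_norm fL).
have PB2 u v : P (A (l *: u + v) + Ad (l *: u + v)) =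
    l *: P (A u + Ad u) + P (A v + Ad v).
  rewrite -[A _ + _]/(opv (EAdd EZ EZb) _) (opvP dot_norm A_bounded).
  by rewrite (proj_linear dot_norm fL).
exists (fun x : H * H => (l *: B (w x) + x.2, B (w x))); split.
  pose K := 1 + (nrm l + 1) * (`|k| * (1 + nrm l + k')).
  exists K => x Lx.
  have x1 : nrm x.1 <= nrm x by rewrite prod_nrmE le_max lexx.
  have x2 : nrm x.2 <= nrm x by rewrite prod_nrmE le_max lexx orbT.
  have wx : nrm (w x) <= (1 + nrm l + k') * nrm x.
    rewrite /w nrmN; apply: le_trans (nrmB _ _) _; rewrite mulrDl; apply: lerD.
      apply: le_trans (nrmD _ _) _; rewrite nrmZ mulrDl mul1r; apply: lerD => //.
      by rewrite ler_wpM2l ?nrm_ge0.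
    apply: le_trans (nrm_proj dot_norm fL _) _; apply: le_trans (hk' _) _.
    by rewrite ler_pM2l.
  have Bx : nrm (B (w x)) <= `|k| * (1 + nrm l + k') * nrm x.
    apply: le_trans (hk _ (Lw _ Lx)) _; rewrite -mulrA.
    apply: (le_trans (y := `|k| * nrm (w x))).
      by rewrite ler_wpM2r ?nrm_ge0 // ler_norm.
    by rewrite ler_wpM2l.
  have n1 := nrmD (l *: B (w x)) x.2; rewrite nrmZ in n1.
  have n2 := ler_wpM2l (nrm_ge0 l) Bx.
  have n3 := nrm_ge0 (B (w x)); have n4 := nrm_ge0 l; have n5 := nrm_ge0 x.
  have n6 : 0 <= `|k| * (1 + nrm l + k') * nrm x by exact: le_trans n3 Bx.
  rewrite [leLHS]prod_nrmE ge_max /= /K; apply/andP; split; first by lra.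
  have n7 := mulr_ge0 n4 n6; lra.
case=> u v [/= Lu Lv]; split.
- split=> /=; last by apply: LB; exact: (Lw (u, v)).
  by apply: subspD => //; apply: subspZ => //; apply: LB; exact: (Lw (u, v)).
- rewrite quad_block_shift /=.
  have -> : w (P (A u + Ad u) - P (Ad (A v)) - l *: u, u - l *: v) = P (T l v).
    rewrite /w /= projT // PB1 scalerBr scalerA -expr2.
    set a := P (A u + _); set b := P (Ad _); set c := l *: P (A v + _); set d := _ *: v.
    rewrite addrA subrK !opprB addrC -addrA [X in d + X]addrA subrK.
    exact: addrC.
  by rewrite BK //; congr pair; rewrite addrC subrK.
- set y := B _; have Ly : L y by apply: LB; exact: (Lw (u, v)).
  have hy : P (T l y) = w (u, v) by apply: KB; exact: (Lw (u, v)).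
  rewrite quad_block_shift; congr pair; last by rewrite addrC addKr.
  move: hy; rewrite projT // /w /= PB2 scalerDr scalerA -expr2.
  set a := l *: P (A y + _); set b := P (Ad _); set c := P (A v + _); set d := _ *: y.
  move=> hy; have -> : b = (a + c) - ((u + l *: v) + d).
    have -> : b = b - a + d - d + a by rewrite addrK subrK.
    rewrite hy; set m := u + _; rewrite opprB [LHS]addrC (opprD m d).
    by rewrite !addrA.
  by rewrite subKr -[_ + d]addrA [d + _]addrC addrK.
Qed.

End QuadBlock.

(** * Root vectors and the maximum principle *)

Section RootVectors.
Variables (R : realType) (V : lmodType R[i]).
Local Notation C := R[i].
Variables (T : V -> V) (K : set V) (D : set C).
Hypothesis Tlin : linear T.
Hypothesis sK : subsp K.
Hypothesis TK : forall x, K x -> K (T x).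
Implicit Types (x y g : V) (l r : C).

Local Notation sh l := (fun y : V => T y - l *: y).

Lemma shP l : linear (sh l).
Proof.
move=> a u v; rewrite Tlin scalerDr opprD addrACA scalerBr; congr (_ - _ + _).
by rewrite !scalerA mulrC.
Qed.

Lemma sh0 l : sh l 0 = 0.
Proof. by have := shP l (-1) 0 0; rewrite scaler0 addr0 scaleN1r addNr. Qed.

Lemma shK l x : K x -> K (sh l x).
Proof. by move=> Kx; apply: subspB => //; [exact: TK|exact: subspZ]. Qed.

Lemma iter_shP l k : linear (iter k (sh l)).
Proof. by elim: k => [|k IH] a u v //=; rewrite IH (shP l). Qed.

Lemma iter_sh0 l k : iter k (sh l) 0 = 0.
Proof. by elim: k => //= k ->; exact: sh0. Qed.

Lemma iter_sh_le l j k x : (j <= k)%N -> iter j (sh l) x = 0 -> iter k (sh l) x = 0.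
Proof. by move=> jk h; rewrite -(subnK jk) iterD h iter_sh0. Qed.

Definition root_span : set V :=
  lspan [set x | K x /\ exists (l : C) (k : nat), D l /\ iter k (sh l) x = 0].

(** On root vectors for l the operator T - r is invertible: if (T - r) h = (T - l) g, then T - r
    maps g - h to (l - r) g, and h exists by induction on the order. *)
Lemma root_solve l r k g : l != r -> K g -> iter k (sh l) g = 0 ->
  exists g', [/\ K g', iter k (sh l) g' = 0 & sh r g' = g].
Proof.
move=> lr; elim: k g => [|k IH] g Kg; 
  first by move=> /= ->; exists 0; split; [exact: sK.1| |exact: sh0].
rewrite iterSr => hg; have [h [Kh hh hE]] := IH _ (shK l Kg) hg.
have lr0 : l - r != 0 by rewrite subr_eq0.
exists ((l - r)^-1 *: (g - h)); split.
- by apply: subspZ => //; exact: subspB.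
- have := iter_shP l k.+1 (l - r)^-1 (g - h) 0.
  rewrite iter_sh0 !addr0 => ->.
  rewrite [g - h]addrC -[- h]scaleN1r (iter_shP l).
  rewrite [iter k.+1 (sh l) h]iterS hh sh0 scaler0 add0r iterSr hg scaler0.
  by [].
- have := shP r (l - r)^-1 (g - h) 0; rewrite sh0 !addr0 => ->.
  have -> : sh r (g - h) = (l - r) *: g.
    rewrite [g - h]addrC -[- h]scaleN1r (shP r) hE scaleN1r.
    by rewrite scalerBl opprB addrA subrK.
  by rewrite scalerA mulVf // scale1r.
Qed.

(* Modulo the root vectors for eigenvalues other than r, which are images under [sh r] of
   such vectors, [sh r y] is a root vector for r. *)
Lemma root_span_lift r y : D r -> K y -> root_span (sh r y) -> root_span y.
Proof.
move=> Dr Ky hy; pose G := root_span.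
have sG : subsp G by exact: subsp_lspan.
have GK : G `<=` K by apply: lspan_sub => // x [].
pose W := [set g | exists g' j, G g' /\ iter j (sh r) (sh r g' - g) = 0].
have WG : G `<=` W.
  apply: lspan_sub => [|x [Kx [l [k [Dl hx]]]]].
    split; first by exists 0, 0%N; split; [exact: sG.1|rewrite /= sh0 subrr].
    move=> c u v [u' [i [Gu hu]]] [v' [j [Gv hv]]].
    exists (c *: u' + v'), (i + j)%N; split; first exact: sG.2.
    rewrite (shP r) opprD addrACA -scalerBr (iter_shP r).
    by rewrite (iter_sh_le _ hu) ?leq_addr // (iter_sh_le _ hv) ?leq_addl // scaler0 addr0.
  have [lr|lr] := eqVneq l r.
    exists 0, k; split; first exact: sG.1.
    by rewrite sh0 sub0r -scaleN1r -(addr0 (-1 *: x)) -lr (iter_shP l) hx iter_sh0 scaler0 addr0.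
  have [g' [Kg' hg' gE]] := root_solve lr Kx hx.
  exists g', 0%N; split; last by rewrite /= gE subrr.
  by apply: sub_lspan; split=> //; exists l, k.
have [g' [j [Gg' hg']]] := WG _ hy.
rewrite -(subrK g' y); apply: subspD => //; apply: sub_lspan; split.
  by apply: subspB => //; exact: GK.
exists r, j.+1; split=> //; rewrite iterSr.
have -> : sh r (y - g') = (-1) *: (sh r g' - sh r y) + 0.
  by rewrite addr0 scaleN1r opprB [y - g']addrC -[- g']scaleN1r (shP r) scaleN1r addrC.
by rewrite (iter_shP r) hg' iter_sh0 scaler0 addr0.
Qed.

(** This takes the place of a primary decomposition: repeated and distinct factors are treated
    alike, one at a time, by [root_span_lift]. *)
Lemma root_span_prod (rs : seq C) y : (forall r, r \in rs -> D r) -> K y ->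
  foldl (fun x r => sh r x) y rs = 0 -> root_span y.
Proof.
elim: rs y => [|r rs IH] y hD Ky /=; first by move=> ->; exact: (subsp_lspan _).1.
move=> h; apply: (@root_span_lift r) => //; first by apply: hD; rewrite mem_head.
apply: IH => //; last exact: shK.
by move=> r' hr'; apply: hD; rewrite inE hr' orbT.
Qed.

End RootVectors.

(** * Identities and inequalities for the four-point mean *)

Lemma geometric4 (R : realType) (V : lmodType R[i]) (c : R[i]) (b0 b1 b2 b3 b4 a0 a1 a2 a3 : V) :
  b0 = a0 + c *: b1 -> b1 = a1 + c *: b2 -> b2 = a2 + c *: b3 -> b3 = a3 + c *: b4 ->
  b0 = a0 + c *: a1 + c ^+ 2 *: a2 + c ^+ 3 *: a3 + c ^+ 4 *: b4.
Proof.
move=> -> -> -> ->; rewrite !(scalerDr, scalerA) !exprS !expr0 !mulr1.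
by rewrite !addrA !mulrA.
Qed.

Lemma four_terms (R : realType) (n : nat) (a a1 a2 a3 q1 q2 q3 q4 : 'rV[R[i]]_n)
    (t u t2 t3 u3 t4 : R[i]) :
  4%:R *: a =
  a + t *: a1 + t2 *: a2 + t3 *: a3 + t4 *: q1 + (a + u *: a1 + - t2 *: a2 + - u3 *: a3 + t4 *: q2)
  + (a + - t *: a1 + t2 *: a2 + - t3 *: a3 + t4 *: q3)
  + (a + - u *: a1 + - t2 *: a2 + - - u3 *: a3 + t4 *: q4) - t4 *: (q1 + q2 + q3 + q4).
Proof. by apply/rowP => j; rewrite !mxE; ring. Qed.

Lemma norm_addr_le (R : realType) (x y p q : R) : p <= q - `|x| -> `|y| <= p -> `|x + y| <= q.
Proof. move=> h1 h2; apply: le_trans (ler_normD _ _) _; lra. Qed.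

Lemma dist_oppD (R : realType) (a a' b b' e : R) : `|a' - a| < e / 2 -> `|b' - b| < e / 2 ->
  `|- (a' + b') - - (a + b)| < e.
Proof.
rewrite !ltr_norml => /andP[? ?] /andP[? ?]; apply/andP; split; lra.
Qed.

Lemma sum4_le (R : realType) (a b c d ab abc abcd q : R) :
  a <= q -> b <= q -> c <= q -> d <= q ->
  ab <= a + b -> abc <= ab + c -> abcd <= abc + d -> abcd <= 4 * q.
Proof. by lra. Qed.

Lemma sum4_drop (R : realType) (f de x t x1 x2 x3 x4 p1 p2 p3 p4 p12 p123 p : R) :
  p1 <= f + de * x - de * x1 -> p2 <= f + de * x - de * x2 ->
  p3 <= f + de * x - de * x3 -> p4 <= f + de * x - de * x4 ->
  x1 + x2 + x3 + x4 = 4 * x + 4 * t ->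
  p12 <= p1 + p2 -> p123 <= p12 + p3 -> p <= p123 + p4 ->
  p <= 4 * f - 4 * (de * t).
Proof.
move=> h1 h2 h3 h4 hx k1 k2 k3.
have : de * (x1 + x2 + x3 + x4) = de * (4 * x + 4 * t) by rewrite hx.
lra.
Qed.

(** A gain of order de t^2 cannot be compensated by an error Q t^4: together they give de <= t^2 Q
    <= t Q, against the choice of t. *)
Lemma small_drop (R : realType) (t Q de f q : R) : 0 < t -> t <= 1 -> 0 <= Q ->
  t * (2 * (Q + 1)) <= de -> 4 * f <= q + t ^+ 4 * (4 * Q) ->
  q <= 4 * f - 4 * (de * t ^+ 2) -> False.
Proof.
move=> t0 t1 Q0 h h1 h2.
have : t ^+ 2 * de <= t ^+ 2 * (t ^+ 2 * Q) by rewrite mulrA -exprD; lra.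
rewrite ler_pM2l ?exprn_gt0 // => h3.
have tt : t ^+ 2 <= t by rewrite expr2 ler_piMr // ltW.
have := ler_wpM2r Q0 tt; have := mulr_ge0 (ltW t0) Q0; lra.
Qed.

(** * Maximum principle for resolvents in a quotient seminorm *)

Section MaxPrinciple.
Variables (R : realType) (d : nat).
Local Notation C := R[i].
Local Notation Re := complex.Re.
Local Notation Im := complex.Im.
Variable N : 'rV[C]_d.+1 -> R.
Hypothesis N0 : forall x, 0 <= N x.
Hypothesis ND : forall x y, N (x + y) <= N x + N y.
Hypothesis NZ : forall c x, N (c *: x) = nrm c * N x.
Hypothesis Ninj : forall x, N x = 0 -> x = 0.
Hypothesis NM : forall M : 'M[C]_d.+1, exists2 k : R, 0 < k & forall x, N (x *m M) <= k * N x.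

Lemma N_zero : N 0 = 0.
Proof. by rewrite -(scale0r (0 : 'rV[C]_d.+1)) NZ nrm0 mul0r. Qed.

Lemma NN x : N (- x) = N x.
Proof. by rewrite -scaleN1r NZ nrmN nrm1 mul1r. Qed.

Section Quotient.
Variable G : set 'rV[C]_d.+1.
Hypothesis sG : subsp G.

(* Quotient seminorm of N modulo G. *)
Definition qn x : R := inf [set N (x - g) | g in G].

Lemma qn_le x g : G g -> qn x <= N (x - g).
Proof. by move=> Gg; apply: ge_inf; [exists 0 => _ [h _ <-]|exists g]. Qed.

Lemma qn_leN x : qn x <= N x.
Proof. by have := qn_le x sG.1; rewrite subr0. Qed.

Lemma qn_adh x e : 0 < e -> exists2 g, G g & N (x - g) < qn x + e.
Proof.
move=> e0; have hI : has_inf [set N (x - g) | g in G].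
  by split; [exists (N (x - 0)), 0; [exact: sG.1|]|exists 0 => _ [h _ <-]].
by have [_ [g Gg <-] h] := inf_adherent e0 hI; exists g.
Qed.

Lemma qnD x y : qn (x + y) <= qn x + qn y.
Proof.
apply: le_eps => e e0; have e2 : 0 < e / 2 by rewrite divr_gt0.
have [g Gg hg] := qn_adh x e2; have [h Gh hh] := qn_adh y e2.
have := qn_le (x + y) (subspD sG Gg Gh); have := ND (x - g) (y - h).
rewrite addrACA -opprD; lra.
Qed.

Lemma qnZ_le c x : qn (c *: x) <= nrm c * qn x.
Proof.
apply: le_eps => e e0; have c1 : 0 < nrm c + 1 by rewrite ltr_wpDl ?nrm_ge0.
have [g Gg hg] := qn_adh x (divr_gt0 e0 c1).
apply: le_trans (qn_le _ (subspZ c sG Gg)) _; rewrite -scalerBr NZ.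
apply: le_trans (ler_wpM2l (nrm_ge0 c) (ltW hg)) _; rewrite mulrDr lerD2l.
by rewrite mulrCA ler_piMr ?(ltW e0) // ler_pdivrMr // mul1r lerDl.
Qed.

Lemma qn_modG x g : G g -> qn (x + g) = qn x.
Proof.
have h y k : G k -> qn (y + k) <= qn y.
  move=> Gk; apply: le_eps => e /(qn_adh y)[g' Gg' hg'].
  apply: le_trans (ltW hg'); have := qn_le (y + k) (subspD sG Gg' Gk).
  by rewrite opprD addrACA subrr addr0.
move=> Gg; apply/eqP; rewrite eq_le h //=.
have := h (x + g) (- g); rewrite addrK; apply.
by rewrite -scaleN1r; exact: subspZ.
Qed.

Lemma qn_lip x y : `|qn x - qn y| <= N (x - y).
Proof.
have h a b : qn a - qn b <= N (a - b).
  rewrite lerBlDr -{1}(subrK b a); apply: le_trans (qnD _ _) _.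
  by rewrite lerD2r; exact: qn_leN.
rewrite ler_norml h andbT lerNl opprB; apply: le_trans (h _ _) _.
by rewrite -NN opprB.
Qed.

End Quotient.

Variable S : 'M[C]_d.+1.
Variables (z : C) (rho K : R).
Hypothesis rho0 : 0 < rho.
Hypothesis K0 : 0 <= K.

Definition on_boundary (l : C) := csquare rho l /\ (`|Re l| = rho \/ `|Im l| = rho).

Hypothesis bnd : forall l, on_boundary (l - z) -> forall x, N x <= K * N (x *m (S - l%:M)).

Lemma boundary_unit l : on_boundary (l - z) -> S - l%:M \in unitmx.
Proof.
move=> hl; rewrite -row_free_unit -kermx_eq0; apply/eqP/row_matrixP => i; rewrite row0.
apply: Ninj; apply/eqP; rewrite eq_le N0 andbT.
by apply: le_trans (bnd hl _) _; rewrite -row_mul mulmx_ker row0 N_zero mulr0.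
Qed.

Lemma horner_mx_eigen (M : 'M[C]_d.+1) (t : 'rV[C]_d.+1) l (p : {poly C}) :
  t *m M = l *: t -> t *m horner_mx M p = p.[l] *: t.
Proof.
move=> tM; elim/poly_ind: p => [|p c IH]; first by rewrite rmorph0 mulmx0 horner0 scale0r.
rewrite rmorphD rmorphM /= horner_mx_X horner_mx_C mulmxDr mulmxA IH -scalemxAl tM.
by rewrite scalerA mul_mx_scalar hornerD hornerM hornerX hornerC scalerDl.
Qed.

Section Resolvent.
Variable M : 'M[C]_d.+1.
Hypothesis uM : forall l, csquare rho (l - z) -> M - l%:M \is a GRing.unit.
Variable G : set 'rV[C]_d.+1.
Hypothesis sG : subsp G.
Variable y : 'rV[C]_d.+1.

Local Notation Rs l := ((M - l%:M)^-1).

Lemma resolvent_id l m : M - l%:M \is a GRing.unit -> M - m%:M \is a GRing.unit ->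
  Rs m = Rs l + (m - l) *: (Rs m * Rs l).
Proof.
move=> ul um; apply: (mulrI um); rewrite mulrV // mulrDr -scalerAr mulrA mulrV // mul1r.
rewrite -mul_scalar_mx mulmxE -mulrDl [X in X * _](_ : _ = M - l%:M) ?mulrV //.
by rewrite raddfB /= addrA subrK.
Qed.

Lemma row_resolvent l m (x : 'rV[C]_d.+1) : M - l%:M \is a GRing.unit ->
  M - m%:M \is a GRing.unit ->
  x *m Rs m = x *m Rs l + (m - l) *: (x *m Rs m *m Rs l).
Proof.
move=> ul um; rewrite {1}(resolvent_id ul um) mulmxDr -scalemxAr.
by rewrite -mulmxE mulmxA.
Qed.

(** If k bounds the resolvent at l and |m - l| k <= 1/2, the correction term of the resolvent
    identity is absorbed, which doubles the bound. Invertibility follows in the same way from a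
    trivial kernel. *)
Lemma local_bound l : csquare rho (l - z) -> exists2 k : R, 0 < k &
  forall m, nrm (m - l) <= (2 * k)^-1 -> M - m%:M \is a GRing.unit /\
    forall x, N (x *m Rs m) <= 2 * k * N x.
Proof.
move=> hl; have ul := uM hl; have [k k0 hk] := NM (Rs l); exists k => // m hm.
have k2 : 0 < 2 * k by rewrite mulr_gt0.
have hmk : nrm (m - l) * k <= 2^-1.
  have := ler_wpM2r (ltW k0) hm; by rewrite invfM mulfVK ?gt_eqF.
have um : M - m%:M \is a GRing.unit.
  rewrite -[_ \is a GRing.unit]/(_ \in unitmx) -row_free_unit -kermx_eq0.
  apply/eqP/row_matrixP => i; rewrite row0; set t := row i _.
  have tM : t *m (M - m%:M) = 0 by rewrite -row_mul mulmx_ker row0.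
  have tE : t = (m - l) *: (t *m Rs l).
    have : t *m (M - l%:M) = (m - l) *: t.
      have -> : M - l%:M = (M - m%:M) + (m - l)%:M by rewrite raddfB /= addrA subrK.
      by rewrite mulmxDr tM add0r mul_mx_scalar.
    move=> h; rewrite scalemxAl -h -mulmxA.
    by rewrite [_ *m Rs l](_ : _ = 1%:M) ?mulmx1 //; exact: (mulrV ul).
  apply: Ninj; apply/eqP; rewrite eq_le N0 andbT.
  have h1 : N t <= nrm (m - l) * (k * N t).
    by rewrite {1}tE NZ ler_wpM2l ?nrm_ge0.
  have := ler_wpM2r (N0 t) hmk; have := N0 t; lra.
split=> // x; have : N (x *m Rs m) <= k * N x + nrm (m - l) * k * N (x *m Rs m).
  rewrite {1}(row_resolvent x ul um); apply: le_trans (ND _ _) _.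
  rewrite NZ; apply: lerD => //.
  by rewrite -mulrA; apply: ler_wpM2l; rewrite ?nrm_ge0.
have := ler_wpM2r (N0 (x *m Rs m)) hmk; lra.
Qed.

Let F l : R := qn G (y *m Rs l).

Lemma F_continuous l : csquare rho (l - z) -> nrm_continuous_at F l.
Proof.
move=> hl e e0; have [k k0 hk] := local_bound hl; have [k' k'0 hk'] := NM (Rs l).
pose Q := k' * (2 * k * N y) + 1.
have Q0 : 0 < Q by rewrite ltr_wpDl // mulr_ge0 ?(ltW k'0) // mulr_ge0 // mulr_ge0 // ltW.
exists (Num.min (2 * k)^-1 (e / Q)).
  by rewrite lt_min invr_gt0 mulr_gt0 // divr_gt0.
move=> m; rewrite lt_min => /andP[h1]; rewrite ltr_pdivlMr // => h2.
have [um hm] := hk m (ltW h1).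
apply: le_lt_trans (qn_lip sG _ _) _.
rewrite (row_resolvent y (uM hl) um) addrC addKr NZ.
apply: le_lt_trans h2; apply: ler_wpM2l; first exact: nrm_ge0.
apply: le_trans (hk' _) _; rewrite /Q; have := ler_wpM2l (ltW k'0) (hm y); lra.
Qed.

(** Each resolvent is expanded by four uses of the resolvent identity. The powers 1, 2 and 3 of t
    cancel because the corresponding powers of 1, i, -1, -i sum to 0; the remainder is exact, so no
    series has to converge. *)
Lemma four_point l (t : C) : csquare rho (l - z) ->
  (forall c, c \in [:: t; 'i%C * t; - t; - ('i%C * t)] -> M - (l + c)%:M \is a GRing.unit) ->
  4%:R *: (y *m Rs l) =
    y *m Rs (l + t) + y *m Rs (l + 'i%C * t) + y *m Rs (l - t) + y *m Rs (l - 'i%C * t)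
    - t ^+ 4 *: ((y *m Rs (l + t) + y *m Rs (l + 'i%C * t) + y *m Rs (l - t)
                  + y *m Rs (l - 'i%C * t)) *m (Rs l) ^+ 4).
Proof.
move=> hl hu; have ul := uM hl; pose Q := Rs l; pose a := y *m Q.
have ex c : c \in [:: t; 'i%C * t; - t; - ('i%C * t)] -> y *m Rs (l + c) =
    a + c *: (a *m Q) + c ^+ 2 *: (a *m Q *m Q) + c ^+ 3 *: (a *m Q *m Q *m Q)
    + c ^+ 4 *: (y *m Rs (l + c) *m Q ^+ 4).
  move=> /hu uc; have E : y *m Rs (l + c) = a + c *: (y *m Rs (l + c) *m Q).
    by rewrite {1}(row_resolvent y ul uc) [l + c]addrC addrK.
  set b := y *m Rs (l + c) in E *.
  have E4 : b *m Q ^+ 4 = b *m Q *m Q *m Q *m Q.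
    by rewrite !exprS expr0 mulr1 -!mulmxE !mulmxA.
  rewrite E4; have EQ (w : 'rV[C]_d.+1) (w0 w1 : 'rV[C]_d.+1) :
      w = w0 + c *: w1 -> w *m Q = w0 *m Q + c *: (w1 *m Q).
    by move=> ->; rewrite mulmxDl -scalemxAl.
  exact: (geometric4 E (EQ _ _ _ E) (EQ _ _ _ (EQ _ _ _ E)) (EQ _ _ _ (EQ _ _ _ (EQ _ _ _ E)))).
have i2 : 'i%C * 'i%C = -1 :> C by rewrite -expr2 sqr_i.
have h1 := ex t; have h2 := ex ('i%C * t); have h3 := ex (- t); have h4 := ex (- ('i%C * t)).
have e2 : ('i%C * t) ^+ 2 = - t ^+ 2 by rewrite exprMn sqr_i mulN1r.
have e3 : ('i%C * t) ^+ 3 = - ('i%C * t ^+ 3).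
  by rewrite exprS e2 mulrN -mulrA -exprS.
have e4 : ('i%C * t) ^+ 4 = t ^+ 4 by rewrite (exprM _ 2 2) e2 sqrrN -exprM.
have {}h1 := h1 (mem_head _ _).
have {}h2 := h2 _; rewrite !inE eqxx ?orbT in h2; have {}h2 := h2 isT.
have {}h3 := h3 _; rewrite !inE eqxx ?orbT in h3; have {}h3 := h3 isT.
have {}h4 := h4 _; rewrite !inE eqxx ?orbT in h4; have {}h4 := h4 isT.
rewrite e2 e3 e4 in h2; rewrite !sqrrN in h3 h4.
have o3 (c : C) : (- c) ^+ 3 = - c ^+ 3 by rewrite exprNn -signr_odd /= expr1 mulN1r.
have o4 (c : C) : (- c) ^+ 4 = c ^+ 4 by rewrite (exprM _ 2 2) sqrrN -exprM.
rewrite o3 o4 in h3; rewrite o3 o4 e2 e3 e4 in h4.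
rewrite !mulmxDl.
set b1 := y *m Rs (l + t) in h1 *; set b2 := y *m Rs (l + 'i%C * t) in h2 *.
set b3 := y *m Rs (l - t) in h3 *; set b4 := y *m Rs (l - 'i%C * t) in h4 *.
rewrite -/Q -/a.
rewrite {1}h1 {1}h2 {1}h3 {1}h4; exact: four_terms.
Qed.

(* F(l) + de |l - z|^2 has no maximum in the open square for de > 0: its mean over the
   four points l + i^k t exceeds its value at l by at least de t^2 - O(t^4), since the
   terms of order 1, 2, 3 of the resolvent cancel. *)
Lemma resolvent_max (B : R) :
  (forall c, on_boundary c -> F (z + c) <= B) -> F z <= B.
Proof.
move=> hB; apply: le_eps => e e0.
(* On the square |c|^2 <= 2 rho^2, so the quadratic perturbation never exceeds e. *)
pose de := e / (2 * rho ^+ 2); have de0 : 0 < de by rewrite divr_gt0 // mulr_gt0 // exprn_gt0.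
have sq0 : csquare rho (0 : C) by split; rewrite /= normr0 ltW.
have zc c : z + c - z = c by rewrite addrC addKr.
have [|||c0 sc0 hc0] := @compact_minC R (csquare rho) (fun c => - (F (z + c) + de * nrm c ^+ 2)).
- exact: compact_csquare.
- by exists 0.
- move=> c sc e' e'0; 
  have [|d1 d10 hd1] := @F_continuous (z + c) _ (e' / 2) (divr_gt0 e'0 (ltr0n _ 2)).
    by rewrite zc.
  pose q := de * (2 * nrm c + 1) + 1.
  have q0 : 0 < q by rewrite ltr_wpDl // mulr_ge0 ?(ltW de0) // addr_ge0 // mulr_ge0 ?nrm_ge0.
  exists (Num.min d1 (Num.min 1 (e' / 2 / q))); first by rewrite !lt_min d10 ltr01 !divr_gt0.
  move=> c'; rewrite !lt_min => /and3P[n1 n2]; rewrite ltr_pdivlMr // => n3.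
  have := hd1 (z + c'); rewrite opprD addrACA subrr add0r => /(_ n1) f1.
  have f2 : `|nrm c' - nrm c| <= nrm (c' - c).
    rewrite ler_norml; apply/andP; split.
      rewrite lerNl opprB nrmBC lerBlDr -{1}(subrK c' c); exact: nrmD.
    by rewrite lerBlDr -{1}(subrK c c'); exact: nrmD.
  have f3 : `|de * nrm c' ^+ 2 - de * nrm c ^+ 2| < e' / 2.
    rewrite -mulrBr subr_sqr normrM ger0_norm ?(ltW de0) // normrM.
    apply: le_lt_trans n3.
    have g1 : `|nrm c' + nrm c| <= 2 * nrm c + 1.
      rewrite ger0_norm ?addr_ge0 ?nrm_ge0 //; have := nrmD (c' - c) c; rewrite subrK.
      move: n2; lra.
    have g2 : `|nrm c' - nrm c| * `|nrm c' + nrm c| <= nrm (c' - c) * (2 * nrm c + 1).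
      by apply: ler_pM.
    have := ler_wpM2l (ltW de0) g2; have := nrm_ge0 (c' - c); rewrite /q; lra.
  exact: dist_oppD f1 f3.
have F0 : F z <= F (z + c0) + de * nrm c0 ^+ 2.
  have E0 : F (z + 0) = F z by rewrite addr0.
  move: (hc0 0 sq0); rewrite lerN2 E0 nrm0.
  by move: (F z) (F (z + c0)) (nrm c0) => p q w; rewrite expr0n mulr0 addr0.
have nc0 : nrm c0 ^+ 2 <= 2 * rho ^+ 2.
  have [s1 s2] := sc0; rewrite nrmc_sqr -[Re _ ^+ 2]real_normK ?num_real //.
  rewrite -[Im _ ^+ 2]real_normK ?num_real // mulr_natl mulr2n.
  by apply: lerD; rewrite ler_pXn2r ?nnegrE // ltW.
have [bc|nb] := pselect (on_boundary c0).
  apply: le_trans F0 _; apply: lerD; first exact: hB.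
  have := ler_wpM2l (ltW de0) nc0; rewrite {2}/de divfK //.
  by rewrite mulf_neq0 ?pnatr_eq0 // expf_neq0 // gt_eqF.
exfalso.
have [s1 s2] := sc0.
have s1' : `|Re c0| < rho.
  by rewrite lt_neqAle s1 andbT; apply/eqP => h; apply: nb; split=> //; left.
have s2' : `|Im c0| < rho.
  by rewrite lt_neqAle s2 andbT; apply/eqP => h; apply: nb; split=> //; right.
pose l := z + c0; have hl : csquare rho (l - z) by rewrite zc.
have [k k0 hk] := local_bound hl; have [k4 k40 hk4] := NM ((Rs l) ^+ 4).
pose Q := k4 * (2 * k * N y); have Q0 : 0 <= Q.
  by apply: mulr_ge0 (ltW k40) _; apply: mulr_ge0 (N0 y); apply: mulr_ge0 (ltW k0).
(* The four points must stay in the square and in the disc of [local_bound], and t must be small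
   enough for [small_drop]. *)
pose t := Num.min (Num.min (rho - `|Re c0|) (rho - `|Im c0|))
           (Num.min (2 * k)^-1 (Num.min 1 (de / (2 * (Q + 1))))).
have Q1 : 0 < 2 * (Q + 1) by rewrite mulr_gt0 // ltr_wpDl.
have t0 : 0 < t.
  have k2 : 0 < (2 * k)^-1 by rewrite invr_gt0 mulr_gt0.
  have dQ : 0 < de / (2 * (Q + 1)) by apply: divr_gt0.
  by rewrite /t !lt_min k2 dQ ltr01 !subr_gt0 s1' s2'.
have t1 : t <= rho - `|Re c0| by rewrite !ge_min lexx.
have t2 : t <= rho - `|Im c0| by rewrite !ge_min lexx !orbT.
have t3 : t <= (2 * k)^-1 by rewrite !ge_min lexx !orbT.
have t4 : t <= 1 by rewrite !ge_min lexx !orbT.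
have t5 : t <= de / (2 * (Q + 1)) by rewrite !ge_min lexx !orbT.
clearbody t.
have nt : nrm (t%:C : C) = t by rewrite nrm_real gtr0_norm.
have nit : nrm ('i%C * t%:C : C) = t by rewrite nrmM nrm_i mul1r.
have pts c : c \in [:: t%:C; 'i%C * t%:C; - t%:C; - ('i%C * t%:C)] -> nrm c = t.
  by rewrite !inE => /or4P[] /eqP ->; rewrite ?nrmN.
have uN c : c \in [:: t%:C; 'i%C * t%:C; - t%:C; - ('i%C * t%:C)] ->
    M - (l + c)%:M \is a GRing.unit /\ forall x, N (x *m Rs (l + c)) <= 2 * k * N x.
  by move=> /pts ct; apply: hk; rewrite [l + c]addrC addrK ct.
have sqc c : c \in [:: t%:C; 'i%C * t%:C; - t%:C; - ('i%C * t%:C)] -> csquare rho (c0 + c).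
  move=> /pts ct; have r1 := normRe_le c; have r2 := normIm_le c; rewrite ct in r1 r2.
  split; first by rewrite ReD; exact: norm_addr_le t1 r1.
  by rewrite ImD; exact: norm_addr_le t2 r2.
have Fc c : c \in [:: t%:C; 'i%C * t%:C; - t%:C; - ('i%C * t%:C)] ->
    F (l + c) <= F l + de * nrm c0 ^+ 2 - de * nrm (c0 + c) ^+ 2.
  by move=> /sqc /hc0; rewrite lerN2 addrA -/l lerBrDr.
have sumn : nrm (c0 + t%:C) ^+ 2 + nrm (c0 + 'i%C * t%:C) ^+ 2 + nrm (c0 - t%:C) ^+ 2
    + nrm (c0 - 'i%C * t%:C) ^+ 2 = 4 * nrm c0 ^+ 2 + 4 * t ^+ 2.
  rewrite !nrmc_sqr !(ReD, ImD, ReN, ImN) /= !(mul0r, mul1r, mulr0, subr0, addr0, add0r); ring.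
pose pt : seq C := [:: t%:C; 'i%C * t%:C; - t%:C; - ('i%C * t%:C)].
have m1 : t%:C \in pt by rewrite mem_head.
have m2 : 'i%C * t%:C \in pt by rewrite !inE eqxx orbT.
have m3 : - t%:C \in pt by rewrite !inE eqxx !orbT.
have m4 : - ('i%C * t%:C) \in pt by rewrite !inE eqxx !orbT.
have E := four_point hl (fun c hc => (uN c hc).1).
set b1 := y *m Rs (l + t%:C) in E; set b2 := y *m Rs (l + 'i%C * t%:C) in E.
set b3 := y *m Rs (l - t%:C) in E; set b4 := y *m Rs (l - 'i%C * t%:C) in E.
have l4 : 4 * F l <= qn G (b1 + b2 + b3 + b4) + t ^+ 4 * (4 * Q).
  have -> : 4 * F l = `|4| * F l by rewrite ger0_norm.
  have q4 : 4 * F l <= qn G (4%:R *: (y *m Rs l)).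
    have := qnZ_le sG (4%:R)^-1 (4%:R *: (y *m Rs l)).
    have n4 : nrm ((4%:R)^-1 : C) = 4^-1.
      by rewrite nrmV; congr (_ ^-1); rewrite -(rmorph_nat (real_complex R) 4) nrm_real ger0_norm.
    rewrite scalerA mulVf ?pnatr_eq0 // scale1r n4 -/(F l) mulrC ler_pdivlMr // mulrC.
    exact.
  rewrite ger0_norm //; apply: le_trans q4 _; rewrite E.
  apply: le_trans (qnD sG _ _) _; rewrite lerD2l; apply: le_trans (qn_leN sG _) _.
  rewrite NN NZ nrmX nt ler_wpM2l ?exprn_ge0 ?(ltW t0) //.
  apply: le_trans (hk4 _) _.
  have n1 := (uN _ m1).2 y; have n2 := (uN _ m2).2 y.
  have n3 := (uN _ m3).2 y; have n4 := (uN _ m4).2 y.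
  have n5 : N (b1 + b2 + b3 + b4) <= 4 * (2 * k * N y).
    exact: sum4_le n1 n2 n3 n4 (ND b1 b2) (ND _ b3) (ND _ b4).
  by have := ler_wpM2l (ltW k40) n5; rewrite mulrCA.
have qs : qn G (b1 + b2 + b3 + b4) <= 4 * F l - 4 * (de * t ^+ 2).
  exact: sum4_drop (Fc _ m1) (Fc _ m2) (Fc _ m3) (Fc _ m4) sumn
    (qnD sG b1 b2) (qnD sG _ b3) (qnD sG _ b4).
apply: small_drop t0 t4 Q0 _ l4 qs.
by move: t5; rewrite ler_pdivlMr.
Qed.

End Resolvent.

(* The maximum principle is applied to the resolvent of [S' = S Pi + w (1 - Pi)], where
   [1 - Pi] is the spectral projection of [S] for the eigenvalues in the square and [w]
   is outside: modulo the range of [1 - Pi], it agrees with the resolvent of [S]. *)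
Lemma root_approx (x : 'rV[C]_d.+1) : exists (rs : seq C) (y : 'rV[C]_d.+1),
  [/\ forall l, l \in rs -> csquare rho (l - z),
      y *m horner_mx S (\prod_(l <- rs) ('X - l%:P)) = 0
    & N (x - y) <= (K + 1) * N (x *m (S - z%:M))].
Proof.
have [rs] := closed_field_poly_normal (char_poly S).
rewrite (monicP (char_poly_monic S)) scale1r => hrs.
pose inside (l : C) := `[< csquare rho (l - z) >].
pose p_in := \prod_(l <- [seq l <- rs | inside l]) ('X - l%:P) : {poly C}.
pose p_out := \prod_(l <- [seq l <- rs | ~~ inside l]) ('X - l%:P) : {poly C}.
have chE : char_poly S = p_in * p_out.
  by rewrite hrs /p_in /p_out !big_filter (bigID inside).
have out l : csquare rho (l - z) -> p_out.[l] != 0.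
  move=> hl; rewrite -rootE root_prod_XsubC mem_filter negb_and negbK.
  by apply/orP; left; apply/asboolP.
have cop : coprimep p_in p_out.
  apply/Pdiv.ClosedField.coprimepP => l; rewrite root_prod_XsubC mem_filter => /andP[/asboolP hl _].
  exact: out.
have /Bezout_eq1_coprimepP[[u1 u2] /= uE] := cop.
(* By Bezout and Cayley-Hamilton, [h p] and [h q] are complementary projections, onto the root
   vectors for the eigenvalues outside and inside the square. *)
pose p := u1 * p_in; pose q := u2 * p_out.
have pq1 : p + q - 1 = 0 by rewrite /p /q uE subrr.
pose h := horner_mx S.
have hc (a : {poly C}) : h (a * char_poly S) = 0 by rewrite /h rmorphM /= Cayley_Hamilton mulr0.
have hX l : S - l%:M = h ('X - l%:P).
  by rewrite /h rmorphB /= horner_mx_X horner_mx_C.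
(* The real part of w - z is 2 (rho + 1), beyond the half-side rho. *)
pose w : C := z + (2 * (rho + 1))%:C.
have hw l : csquare rho (l - z) -> w - l != 0.
  move=> [hl _]; rewrite subr_eq0; apply/eqP => E; move: hl.
  have -> : l - z = (2 * (rho + 1))%:C by rewrite -E /w addrC addKr.
  rewrite -[Re _]/(2 * (rho + 1)) ler_norml => /andP[_ h2]; move: rho0 h2; lra.
pose s' := 'X * p + w%:P * q; pose S' := h s'.
have hS' l : S' - l%:M = h (s' - l%:P) by rewrite /S' /h rmorphB /= horner_mx_C.
have f1 l : (S' - l%:M) * h p = (S - l%:M) * h p.
  rewrite hS' hX /h -!rmorphM /=; apply/eqP; rewrite -subr_eq0 -rmorphB /=; apply/eqP.
  rewrite -[RHS](hc ((w%:P - 'X) * (u1 * u2))) chE; congr (h _).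
  have -> : (s' - l%:P) * p - ('X - l%:P) * p =
    (w%:P - 'X) * (u1 * u2) * (p_in * p_out) + 'X * p * (p + q - 1) by rewrite /s' /p /q; ring.
  by rewrite pq1 mulr0 addr0.
have f2 l : (S' - l%:M) * h q = (w - l) *: h q.
  rewrite hS' -[RHS]mul_scalar_mx mulmxE -(horner_mx_C S) -/h.
  rewrite /h -!rmorphM /=; apply/eqP; rewrite -subr_eq0 -rmorphB /=; apply/eqP.
  rewrite -[RHS](hc (('X - w%:P) * (u1 * u2))) chE; congr (h _).
  have -> : (s' - l%:P) * q - (w - l)%:P * q =
    ('X - w%:P) * (u1 * u2) * (p_in * p_out) + w%:P * q * (p + q - 1).
    by rewrite polyCB /s' /p /q; ring.
  by rewrite pq1 mulr0 addr0.
have hpq (t : 'rV[C]_d.+1) : t = t *m h p + t *m h q.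
  rewrite -mulmxDr /h -rmorphD /=; have -> : p + q = 1 by apply/eqP; rewrite -subr_eq0 pq1.
  by rewrite rmorph1 mulmx1.
have cX a l : h a * (S - l%:M) = (S - l%:M) * h a by rewrite hX /h -!rmorphM mulrC.
have cS' a l : h a * (S' - l%:M) = (S' - l%:M) * h a by rewrite hS' /h -!rmorphM mulrC.
have uS' l : csquare rho (l - z) -> S' - l%:M \is a GRing.unit.
  move=> hl; rewrite -[_ \is a GRing.unit]/(_ \in unitmx) -row_free_unit -kermx_eq0.
  apply/eqP/row_matrixP => i; rewrite row0; set t := row i _.
  have t0 : t *m (S' - l%:M) = 0 by rewrite -row_mul mulmx_ker row0.
  have tp : t *m h p *m (S - l%:M) = 0.
    by rewrite -mulmxA mulmxE cX -f1 -mulmxE mulmxA t0 mul0mx.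
  have tq : t *m h q = 0.
    have : t *m (S' - l%:M) *m h q = (w - l) *: (t *m h q).
      by rewrite -mulmxA mulmxE f2 -scalemxAr.
    rewrite t0 mul0mx => /esym/eqP; rewrite scaler_eq0 (negPf (hw l hl)) /= => /eqP. done.
  have tp0 : t *m h p = 0.
    have eS : t *m h p *m S = l *: (t *m h p).
      by apply/eqP; rewrite -subr_eq0 -mul_mx_scalar -mulmxBr tp.
    have := horner_mx_eigen p_out eS; rewrite -mulmxA mulmxE -/h /h -rmorphM /=.
    rewrite (_ : p * p_out = u1 * char_poly S); last by rewrite chE mulrA.
    rewrite -/h hc mulmx0 => /esym/eqP; rewrite scaler_eq0 (negPf (out l hl)) /= => /eqP. done.
  by rewrite (hpq t) tp0 tq addr0.
pose G := [set t : 'rV[C]_d.+1 | t *m h p_in = 0].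
have sG : subsp G.
  split; first by rewrite /G /= mul0mx.
  by move=> c a b; rewrite /G /= => ha hb; rewrite mulmxDl -scalemxAl ha hb scaler0 addr0.
have Gq t : G (t *m h q).
  rewrite /G /= -mulmxA mulmxE /h -rmorphM /= (_ : q * p_in = u2 * char_poly S).
    by rewrite -/h hc mulmx0.
  by rewrite chE /q -mulrA [p_out * _]mulrC.
have qnp t : qn G (t *m h p) = qn G t by rewrite {2}(hpq t) qn_modG.
pose y0 := x *m (S - z%:M).
have zz : csquare rho (z - z) by rewrite subrr; split; rewrite /= normr0 ltW.
have res (t : 'rV[C]_d.+1) l : S' - l%:M \is a GRing.unit ->
    t *m (S - l%:M) *m h p *m (S' - l%:M)^-1 = t *m h p.
  move=> ul; have uV : (S' - l%:M) *m (S' - l%:M)^-1 = 1%:M by exact: mulrV ul.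
  have e : t *m (S - l%:M) *m h p = t *m h p *m (S' - l%:M).
    by rewrite -mulmxA mulmxE -f1 -cS' -mulmxE mulmxA.
  by rewrite e -[RHS]mulmx1 -uV mulmxA.
(* Modulo G the resolvent of S' applied to y0 is x at the centre, and on the boundary it is the
   resolvent of S, which K bounds by hypothesis. *)
have qx : qn G x <= K * N y0.
  have := @resolvent_max S' uS' G sG (y0 *m h p) (K * N y0); rewrite res ?qnp //; last exact: uS'.
  apply=> c bc; have bc' : on_boundary (z + c - z) by rewrite addrC addKr.
  have ub := boundary_unit bc'.
  rewrite -{1}[y0](mulmxKV ub) res; last by apply: uS'; exact: bc'.1.
  by rewrite qnp; apply: le_trans (qn_leN sG _) _; rewrite -{2}[y0](mulmxKV ub); exact: bnd.
(* The infimum defining [qn] need not be attained, which costs the additional N y0. If N y0 = 0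
   there is no room, but then x is in the eigenspace of S at z and lies in G itself. *)
have [y hy] : exists2 y, G y & N (x - y) <= (K + 1) * N y0.
  have [N0y|Ny] := eqVneq (N y0) 0.
    exists x; last by rewrite subrr N_zero N0y mulr0.
    have y00 := Ninj N0y.
    have eS : x *m S = z *: x.
      by apply/eqP; rewrite -subr_eq0 -mul_mx_scalar -mulmxBr; apply/eqP.
    rewrite /G /=; have := horner_mx_eigen p_out eS; have := horner_mx_eigen (char_poly S) eS.
    rewrite Cayley_Hamilton mulmx0 chE hornerM => /esym/eqP.
    rewrite scaler_eq0 mulf_eq0 (negPf (out z zz)) orbF => /orP[/eqP e0|/eqP -> _].
      by move=> _; rewrite /h (horner_mx_eigen _ eS) e0 scale0r.
    by rewrite mul0mx.
  have Np : 0 < N y0 by rewrite lt_neqAle eq_sym Ny N0.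
  have [y Gy hy] := qn_adh sG x Np; exists y => //.
  rewrite mulrDl mul1r; apply: le_trans (ltW hy) _; by rewrite lerD2r.
move=> hxy; exists [seq l <- rs | inside l], y; split=> //.
by move=> l; rewrite mem_filter => /andP[/asboolP].
Qed.

End MaxPrinciple.

(** * Spectral subspaces of the block operator *)

Section Transport.
Variables (R : realType) (V : normedModType R[i]).
Local Notation C := R[i].
Implicit Types (T : V -> V) (M : set V).

Lemma eigen_spectrum_on M T l x : subsp M -> linear T -> M x -> x != 0 -> T x = l *: x ->
  spectrum_on M T l.
Proof.
move=> sM Tlin Mx x0 Tx [B [_ hB]].
have [_ h1 _] := hB x Mx; have [_ h2 _] := hB 0 sM.1.
have T0 : T 0 = 0 by have := Tlin (-1) 0 0; rewrite scaler0 addr0 scaleN1r addNr.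
move: h1 h2; rewrite Tx T0 scaler0 !subrr => -> xE.
by rewrite xE eqxx in x0.
Qed.

Lemma root_spectrum_on M T l k x : subsp M -> linear T -> (forall x, M x -> M (T x)) ->
  M x -> x != 0 -> iter k (fun y => T y - l *: y) x = 0 -> spectrum_on M T l.
Proof.
move=> sM Tlin TM; elim: k x => [|k IH] x Mx x0; first by move=> /= e; rewrite e eqxx in x0.
rewrite iterSr; have [e _|ne] := eqVneq (T x - l *: x) 0.
  by apply: (eigen_spectrum_on sM Tlin Mx x0); apply/eqP; rewrite -subr_eq0 e.
by apply: IH ne; exact: (shK sM TM l Mx).
Qed.

(** In [spectral_subspace] the points must also belong to the spectrum; a nonzero root vector forces
    this, and the zero vector is in any span. *)
Lemma root_span_spectral M T D : subsp M -> linear T -> (forall x, M x -> M (T x)) ->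
  root_span T M D `<=` spectral_subspace M T D.
Proof.
move=> sM Tlin TM; apply: lspan_sub => [|x [Mx [l [k [Dl hx]]]]]; first exact: subsp_lspan.
have [->|x0] := eqVneq x 0; first exact: (subsp_lspan _).1.
apply: sub_lspan; split=> //; exists l, k; split=> //.
exact: (root_spectrum_on sM Tlin TM Mx x0 hx).
Qed.

(** [root_approx] in the coordinates f, with the norm pulled back from V. The bound of the
    coordinates by the norm makes f injective and every matrix bounded for that norm. *)
Lemma approx_root_span (m : nat) (f : 'rV[C]_m -> V) T (z : C) (rho K kc : R) :
  linear f -> (forall (c : 'rV[C]_m) i, nrm (c ord0 i) <= kc * nrm (f c)) ->
  linear T -> (forall c, exists c', T (f c) = f c') -> 0 < rho -> 0 <= K -> 0 <= kc ->
  (forall l, on_boundary rho (l - z) -> forall c, nrm (f c) <= K * nrm (T (f c) - l *: f c)) ->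
  forall c, exists c', root_span T (range f) [set l | csquare rho (l - z)] (f c') /\
    nrm (f c - f c') <= (K + 1) * nrm (T (f c) - z *: f c).
Proof.
move=> flin coord Tlin Tf rho0 K0 kc0 bnd c.
have f0 : f 0 = 0 by have := flin (-1) 0 0; rewrite scaler0 addr0 scaleN1r addNr.
have sR : subsp (range f).
  split; first by exists 0.
  by move=> a _ _ [u _ <-] [v _ <-]; exists (a *: u + v); rewrite ?flin.
(* Polynomials in a matrix require positive size; for m = 0 all vectors are 0. *)
case: m f flin coord Tf bnd c f0 sR => [|d] f flin coord Tf bnd c f0 sR.
  exists 0; have -> : c = 0 by apply/rowP; case.
  rewrite f0 subrr nrm0; split; first exact: (subsp_lspan _).1.
  by apply: mulr_ge0 (nrm_ge0 _); rewrite addr_ge0.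
have fZ a u : f (a *: u) = a *: f u by have := flin a u 0; rewrite f0 !addr0.
have fD u v : f (u + v) = f u + f v by have := flin 1 u v; rewrite !scale1r.
have fS (I : Type) (r : seq I) (F : I -> 'rV[C]_d.+1) :
    f (\sum_(i <- r) F i) = \sum_(i <- r) f (F i).
  by elim: r => [|i r IH]; rewrite ?big_nil // !big_cons fD IH.
have [a ha] := choice (fun i : 'I_d.+1 => Tf (delta_mx 0 i)).
have T0 : T 0 = 0 by have := Tlin (-1) 0 0; rewrite scaler0 addr0 scaleN1r addNr.
have TZ b u : T (b *: u) = b *: T u by have := Tlin b u 0; rewrite T0 !addr0.
have TD u v : T (u + v) = T u + T v by have := Tlin 1 u v; rewrite !scale1r.
have TS (I : Type) (r : seq I) (F : I -> V) :
    T (\sum_(i <- r) F i) = \sum_(i <- r) T (F i).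
  by elim: r => [|i r IH]; rewrite ?big_nil // !big_cons TD IH.
pose S : 'M[C]_d.+1 := \matrix_(i, j) a i ord0 j.
have fT (u : 'rV[C]_d.+1) : f (u *m S) = T (f u).
  rewrite {2}(row_sum_delta u) fS TS mulmx_sum_row fS; apply: eq_bigr => i _.
  by rewrite !fZ TZ ha; congr (_ *: f _); apply/rowP => j; rewrite !mxE.
have fsh l (u : 'rV[C]_d.+1) : f (u *m (S - l%:M)) = T (f u) - l *: f u.
  by rewrite mulmxBr mul_mx_scalar -scaleN1r addrC flin fT scaleN1r fZ addrC.
pose N u := nrm (f u).
have NM (M : 'M[C]_d.+1) : exists2 k : R, 0 < k & forall u, N (u *m M) <= k * N u.
  pose k := \sum_j \sum_i kc * nrm (M i j) * nrm (f (delta_mx 0 j)).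
  have k0 : 0 <= k.
    apply: sumr_ge0 => j _; apply: sumr_ge0 => i _.
    by apply: mulr_ge0 (nrm_ge0 _); apply: mulr_ge0 (nrm_ge0 _).
  exists (k + 1); first by rewrite ltr_wpDl.
  move=> u; rewrite mulrDl mul1r -[leLHS]addr0; apply: lerD; last exact: nrm_ge0.
  rewrite /N {1}(row_sum_delta (u *m M)) fS; apply: le_trans (nrm_sum _ _ _) _.
  rewrite /k mulr_suml; apply: ler_sum => j _; rewrite fZ nrmZ mxE.
  rewrite mulr_suml -/(N u).
  apply: le_trans (ler_wpM2r (nrm_ge0 _) (nrm_sum _ _ _)) _.
  rewrite mulr_suml; apply: ler_sum => i _; rewrite nrmM.
  have := ler_wpM2r (nrm_ge0 (M i j)) (coord u i).
  move=> /(ler_wpM2r (nrm_ge0 (f (delta_mx 0 j)))).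
  by rewrite -/(N u) mulrAC [kc * N u * _]mulrAC [X in _ <= X]mulrAC.
have [|||||rs [y [hrs hy hxy]]] :=
    @root_approx R d N _ _ _ _ NM S z rho K rho0 _ c.
- by move=> u; exact: nrm_ge0.
- by move=> u v; rewrite /N fD nrmD.
- by move=> b u; rewrite /N fZ nrmZ.
- move=> u Nu; apply/rowP => i; rewrite mxE; apply/eqP; rewrite -nrm_eq0 eq_le nrm_ge0 andbT.
  by apply: le_trans (coord u i) _; rewrite -/(N u) Nu mulr0.
- by move=> l hl u; rewrite /N fsh; exact: bnd.
exists y; split; last first.
  by move: hxy; rewrite /N fsh -scaleN1r addrC flin scaleN1r addrC.
have fprod : f (y *m horner_mx S (\prod_(l <- rs) ('X - l%:P))) =
    foldl (fun x l => T x - l *: x) (f y) rs.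
  elim: rs y {hrs hy hxy} => [|l rs IH] y; first by rewrite big_nil rmorph1 mulmx1.
  rewrite big_cons rmorphM /= rmorphB /= horner_mx_X horner_mx_C -mulmxE mulmxA IH.
  by rewrite fsh.
apply: (@root_span_prod R V T (range f) _ Tlin sR _ rs).
- by move=> _ [u _ <-]; have [u' ->] := Tf u; exists u'.
- by move=> l /hrs.
- by exists y.
- by rewrite -fprod hy f0.
Qed.

End Transport.

(** * Spectral subspaces of the block operators and rates of convergence *)

Section BlockApprox.
Variables (R : realType) (H : completeNormedModType R[i]).
Variable dot : {dot H for Num.conj}.
Hypothesis dot_norm : forall u : H, dot u u = `|u| ^+ 2.
Variable A : {linear H -> H}.
Hypothesis A_bounded : bounded_on setT A.
Hypothesis A_normal : normal_op dot A.
Local Notation C := R[i].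
Local Notation Re := complex.Re.
Local Notation Im := complex.Im.
Local Notation Ad := (adjoint dot A).
Local Notation opv := (opv dot A).
Local Notation T l := (opv (ET l)).

Section OneSpace.
Variable L : set H.
Hypothesis fL : findim_subspace L.
Local Notation S := (quad_block dot A L).
Local Notation P := (orthproj dot L).

Lemma subsp_prod : subsp (L `*` L).
Proof.
have sL := subsp_findim fL; split; first by split; exact: sL.1.
by move=> a [u v] [u' v'] [/= hu hv] [/= hu' hv']; split; apply: sL.2.
Qed.

(** The square with half-side rho lies in the disc enclosed by the circle, because |l - z| <= |Re| +
    |Im| <= 2 rho < r. *)
Lemma block_root_approx (z : C) (rho K r : R) : 0 < rho -> 0 <= K -> 2 * rho < r ->
  (forall l, on_boundary rho (l - z) -> forall x : H * H, (L `*` L) x ->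
    nrm x <= K * nrm (S x - l *: x)) ->
  forall x : H * H, (L `*` L) x -> exists2 g, Mspace dot A L z r g &
    nrm (x - g) <= (K + 1) * nrm (S x - z *: x).
Proof.
move=> rho0 K0 rr bnd x Lx; have [k [e eL]] := onb_ex dot_norm fL.
have sL := subsp_findim fL.
pose f (c : 'rV[C]_(k + k)) : H * H := (comb e (lsubmx c), comb e (rsubmx c)).
have flin : linear f by move=> a u v; rewrite /f !linearP !combP.
have fL' c : (L `*` L) (f c) by split; exact: (comb_in eL).
have Lf y : (L `*` L) y -> exists c, y = f c.
  case: y => u v [/=]; rewrite eL.2 => -[c _ <-] [c' _ <-].
  by exists (row_mx c c'); rewrite /f row_mxKl row_mxKr.
have Slin := quad_block_linear dot_norm A_bounded fL.
have Sin := quad_block_in dot_norm A fL.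
have [c cE] := Lf x Lx; rewrite cE.
have [|||c' [hc' hcc']] := 
  @approx_root_span R (H * H)%type (k + k) f S z rho K 1 flin _ Slin _ rho0 K0 ler01 _ c.
- move=> b i; rewrite mul1r prod_nrmE /= le_max.
  rewrite -(splitK i); case: (fintype.split i) => j /=.
    have := coord_le dot_norm eL (lsubmx b) j; rewrite mxE => ->; by [].
  have := coord_le dot_norm eL (rsubmx b) j; rewrite mxE => ->; by rewrite orbT.
- by move=> b; exact: Lf (Sin _ (fL' b)).
- by move=> l hl b; exact: bnd.
exists (f c') => //.
have rE : range f = L `*` L.
  by apply/seteqP; split=> [_ [b _ <-]|y /Lf[b ->]]; [exact: fL'|exists b].
rewrite rE in hc'; apply: root_span_spectral Slin Sin _ _; first exact: subsp_prod.
apply: lspanS hc' => y [Ly [l [j [hl hy]]]]; split=> //; exists l, j; split=> //.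
have [h1 h2] := hl; rewrite /enclosed /=; apply: le_lt_trans (nrmc_le _) _; lra.
Qed.

(* For l <> 0 this is the eigenvector (l v, v); for l = 0 and the sign + it is the root
   vector (v, 0) of order two, because P A^* A v = 0 implies A v = 0. *)
Lemma eigvec_in_Mspace (s : bool) (z l : C) (r : R) v : nrm (l - z) < r ->
  L v -> v != 0 -> P (T l v) = 0 -> Mspace_pm dot s A L z r v.
Proof.
move=> lz Lv v0 hv; have sL := subsp_findim fL.
have Slin := quad_block_linear dot_norm A_bounded fL.
have Sin := quad_block_in dot_norm A fL.
have gen : root_span S (L `*` L) (enclosed z r) `<=` Mspace dot A L z r.
  exact: root_span_spectral subsp_prod Slin Sin.
have x1 : Mspace dot A L z r (l *: v, v).
  apply: gen; apply: sub_lspan; split; first by split=> //=; exact: subspZ.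
  exists l, 1%N; split=> //=; rewrite quad_block_shift // subrr.
  have P0 : P (A (l *: v) + Ad (l *: v)) = l *: P (A v + Ad v).
    by rewrite linearZ /= AdZ // -scalerDr projZ.
  rewrite P0; congr pair; apply/eqP; rewrite -oppr_eq0; apply/eqP; rewrite -[RHS]hv projT //.
  by rewrite !opprB scalerA -expr2 addrC.
case: s; last by exists (l *: v, v).
have sM : subsp (Mspace dot A L z r) by exact: subsp_lspan.
have [l0|l0] := eqVneq l 0; last first.
  exists (l^-1 *: (l *: v, v)); first exact: subspZ.
  by rewrite /= scalerA mulVf // scale1r.
have PAA : P (Ad (A v)) = 0.
  by move: hv; rewrite projT // l0 scale0r expr0n scale0r subr0 addr0.
have Av : A v = 0.
  apply: (dotuu0 dot_norm); rewrite -(adjointP' dot_norm A_bounded).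
  by rewrite -(proj_dotl dot_norm fL) // PAA dot0l.
exists (v, 0) => //; apply: gen; apply: sub_lspan; split; first by split=> //=; exact: sL.1.
exists 0, 2%N; split; first by rewrite -l0.
have AvE : Ad v = 0.
  by apply/eqP; rewrite -nrm_eq0 (nrm_adjoint dot_norm A_bounded) // Av nrm0.
rewrite /= !scale0r !subr0 /quad_block /= Av AvE addr0 linear0.
have A0 : Ad 0 = 0 by have := AdZ dot_norm A_bounded 0 0; rewrite !scale0r.
by rewrite A0 (proj0 dot_norm fL) subrr linear0 A0 addr0 (proj0 dot_norm fL) subrr.
Qed.

End OneSpace.

Variable z : C.
Hypothesis nqh : ~ quad_hull (essential_spectrum A) z.
Variable L : nat -> set H.
Hypothesis L_Lambda : Lambda dot L.
Local Notation E := (discrete_eigenspan A [set z; Num.conj z]).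
Local Notation S n := (quad_block dot A (L n)).
Local Notation P n := (orthproj dot (L n)).
Local Notation eps n := (gap E (L n)).

(** If (f, g) is the image of (u, v) under S - l, then u = g + l v, and the first row becomes an
    equation for P_n T(l) v with right-hand side controlled by f and g. On the boundary rho <= |l -
    z| <= 2 rho, so [galerkin_stable] bounds v, and then u. *)
Lemma quad_block_low : exists2 rho1 : R, 0 < rho1 & forall rho : R, 0 < rho -> rho <= rho1 ->
  exists2 K : R, 0 <= K & exists n0, forall n, (n0 <= n)%N -> forall l, on_boundary rho (l - z) ->
    forall x : H * H, (L n `*` L n) x -> nrm x <= K * nrm (S n x - l *: x).
Proof.
have [rho0 rho00 stab] := galerkin_stable dot_norm A_bounded A_normal nqh L_Lambda.
have [kA kA0 hA] := bounded_pos A_bounded.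
exists (Num.min (rho0 / 2) 2^-1); first by rewrite lt_min divr_gt0 // invr_gt0 ltr0n.
move=> rho rho_gt0; rewrite le_min => /andP[r1 r2].
have [alpha alpha0 [n0 hn0]] := stab rho rho_gt0.
(* q bounds |l| on the square. The numerator of W bounds the right-hand side of the equation for v
   in terms of |(f, g)|. *)
pose q := nrm z + 1; pose W := (2 * kA + q + 1) / alpha.
have q0 : 0 <= q by rewrite addr_ge0 ?nrm_ge0.
have W0 : 0 <= W by apply: divr_ge0 (ltW alpha0); move: q0 kA0; lra.
exists (1 + (q + 1) * W); first by rewrite addr_ge0 // mulr_ge0 // addr_ge0.
exists n0 => n hn l [[b1 b2] b3] [u v] [/= Lu Lv].
have fL := L_Lambda.1 n.
have l1 : rho <= nrm (l - z).
  by case: b3 => <-; [exact: normRe_le|exact: normIm_le].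
have l2 : nrm (l - z) <= 2 * rho.
  by apply: le_trans (nrmc_le _) _; rewrite mulr_natl mulr2n; exact: lerD.
have l3 : nrm (l - z) <= rho0 by apply: le_trans l2 _; lra.
have l4 : nrm l <= q.
  rewrite -(subrK z l) /q addrC; apply: le_trans (nrmD _ _) _; rewrite lerD2l.
  by apply: le_trans l2 _; lra.
have := hn0 n hn l l1 l3 v Lv; rewrite quad_block_shift.
set f := _ - l *: u; pose g := u - l *: v; rewrite -/g.
have uE : u = g + l *: v by rewrite /g subrK.
clearbody g.
have gf : P n (T l v) = P n (A g + Ad g) - l *: g - f.
  have AuE : A u = A g + l *: A v by rewrite {1}uE linearD linearZ.
  have AdE : Ad u = Ad g + l *: Ad v.
    by rewrite {1}uE (AdD dot_norm A_bounded) (AdZ dot_norm A_bounded).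
  have PuE : P n (A u + Ad u) = P n (A g + Ad g) + l *: P n (A v + Ad v).
    by rewrite AuE AdE addrACA -scalerDr (projD dot_norm fL) (projZ dot_norm fL).
  rewrite projT // /f PuE.
  have -> : l *: u = l *: g + l ^+ 2 *: v by rewrite {1}uE scalerDr scalerA -expr2.
  set p := P n (A g + Ad g); set e := l *: P n (A v + _); set b := P n (Ad (A v)).
  set c := l ^+ 2 *: v; set d := l *: g.
  rewrite !opprB -[d + c + _]addrA [p - d + _]addrA subrK opprD [p + _]addrC -!addrA.
  by rewrite [- e + p]addrC addKr addrA addrC.
have nf : nrm f <= nrm ((f, g) : H * H) by rewrite prod_nrmE le_max lexx.
have ng : nrm g <= nrm ((f, g) : H * H) by rewrite prod_nrmE le_max lexx orbT.
set w := nrm ((f, g) : H * H) in nf ng *.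
have w0 : 0 <= w by apply: le_trans (nrm_ge0 _) nf.
have h1 : nrm (P n (T l v)) <= (2 * kA + q + 1) * w.
  rewrite gf; apply: le_trans (nrmB _ _) _; rewrite mulrDl mul1r; apply: lerD nf.
  apply: le_trans (nrmB _ _) _; rewrite mulrDl; apply: lerD.
    apply: le_trans (nrm_proj dot_norm fL _) _; apply: le_trans (nrmD _ _) _.
    rewrite (nrm_adjoint dot_norm A_bounded A_normal) -mulrA mulr_natl mulr2n.
    by apply: lerD; apply: le_trans (hA g) (ler_wpM2l kA0 ng).
  by rewrite nrmZ; apply: ler_pM (nrm_ge0 _) (nrm_ge0 _) l4 ng.
move=> h2; have nv : nrm v <= W * w.
  by rewrite /W mulrAC ler_pdivlMr // mulrC; exact: le_trans h2 h1.
have nu : nrm u <= w + q * (W * w).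
  rewrite uE; apply: le_trans (nrmD _ _) _; apply: lerD ng _.
  by rewrite nrmZ; apply: ler_pM (nrm_ge0 _) (nrm_ge0 _) l4 nv.
have Ww : 0 <= W * w by exact: mulr_ge0.
have qWw : 0 <= q * (W * w) by exact: mulr_ge0.
rewrite [leLHS]prod_nrmE ge_max /=; apply/andP; split; move: nu nv Ww qWw w0; lra.
Qed.

Lemma eps_ge0 n : 0 <= eps n.
Proof. exact: (gap_ge0 dot_norm (L_Lambda.1 n)). Qed.

Lemma eps_le (d : R) : 0 < d -> exists n0, forall n, (n0 <= n)%N -> eps n <= d.
Proof.
move=> d0; have fE := findim_eigenspan dot_norm A_bounded A_normal nqh.
have [n0 hn0] := proj_unif dot_norm L_Lambda fE d0; exists n0 => n hn.
by apply: gap_sub_le (ltW d0) (hn0 n hn) => //; exact: L_Lambda.1.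
Qed.

Lemma root_vector_approx (r : R) (u : H) : 0 < r -> A u = z *: u -> nrm u = 1 ->
  exists2 K : R, 0 <= K & exists n0, forall n, (n0 <= n)%N ->
    exists2 g, Mspace dot A (L n) z r g &
      nrm ((z *: P n u, P n u) - g) <= K * eps n.
Proof.
move=> r0 Au u1; have [rho1 rho10 low] := quad_block_low.
pose rho := Num.min rho1 (r / 4).
have rho0 : 0 < rho by rewrite lt_min rho10 divr_gt0.
have [|K K0 [n0 hn0]] := low rho rho0; first by rewrite ge_min lexx.
have [KT KT0 hT] := T_bounded dot_norm A_bounded z.
have [sE Eu] : subsp E /\ E u.
  by split; [exact: subsp_lspan|apply: (eigen_in_eigenspan nqh _ Au); left].
exists ((K + 1) * KT); first by rewrite mulr_ge0 ?(ltW KT0) // addr_ge0.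
exists n0 => n hn; have fL := L_Lambda.1 n; set p := P n u.
have Lp : L n p by exact: proj_in.
have sL := subsp_findim fL.
have rr : 2 * rho < r.
  by have : rho <= r / 4; [rewrite ge_min lexx orbT|move: r0; lra].
have [|g Mg hg] := block_root_approx fL rho0 K0 rr (hn0 n hn) (x := (z *: p, p)).
  by split=> //=; exact: subspZ.
exists g => //; apply: le_trans hg _; rewrite -mulrA ler_wpM2l ?addr_ge0 //.
rewrite quad_block_shift subrr linearZ /= (AdZ dot_norm A_bounded) -scalerDr (projZ dot_norm fL).
have -> : z *: P n (A p + Ad p) - P n (Ad (A p)) - z *: (z *: p) = - P n (T z p).
  by rewrite projT // !opprD opprK scalerA -expr2 [- _ + z *: _]addrC.
set t := P n (T z p).
rewrite prod_nrmE /= nrm0 nrmN ge_max; apply/andP; split; last first.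
  by rewrite mulr_ge0 ?(ltW KT0) // eps_ge0.
rewrite /t; apply: le_trans (nrm_proj dot_norm fL _) _.
have Tu : T z u = 0 by rewrite (T_on_E dot_norm A_bounded A_normal _ Eu) /tz subrr mulr0 scale0r.
rewrite -[T z p]subr0 -Tu -(opvB dot_norm A_bounded); apply: le_trans (hT _ _ _) _.
  by rewrite subrr nrm0.
rewrite ler_wpM2l ?(ltW KT0) // nrmBC; have := gap_le dot_norm fL sE Eu.
by rewrite u1 mulr1.
Qed.

(** For real z, [tz z l] is the square of z - l and a root is taken of its eps^2 bound. For other z,
    the factor conj z - l is at least |Im z| in absolute value when |l - z| <= |Im z|, and eps^2 is
    weakened to eps once eps <= 1. *)
Lemma eigvec_rate : exists2 rho : R, 0 < rho & exists2 K : R, 0 <= K &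
  exists n0, forall n, (n0 <= n)%N -> forall l v, nrm (l - z) <= rho ->
    L n v -> v != 0 -> P n (T l v) = 0 ->
    nrm (l - z) <= K * eps n /\ nrm (v - orthproj dot E v) <= K * eps n * nrm v.
Proof.
have [rho0 rho00 [K K0 [n0 hn0]]] := galerkin_eigvec dot_norm A_bounded A_normal nqh L_Lambda.
have fE := findim_eigenspan dot_norm A_bounded A_normal nqh.
have gen n l v : (n0 <= n)%N -> nrm (l - z) <= rho0 -> L n v -> v != 0 -> P n (T l v) = 0 ->
    nrm (tz z l) <= K * eps n ^+ 2 /\ nrm (v - orthproj dot E v) <= K * eps n * nrm v.
  move=> hn hl Lv v0 hv.
  have orth y : L n y -> dot (T l v) y = 0.
    by move=> Ly; rewrite -(proj_dotl dot_norm (L_Lambda.1 n)) // hv dot0l.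
  have /= [h1 h2] := hn0 n hn l hl v Lv orth.
  set e := orthproj dot E v in h1 h2 *.
  have e0 : 0 < nrm e.
    rewrite nrm_gt0; apply/eqP => eE; rewrite eE nrm0 mulr0 subr0 in h1.
    by move: v0; rewrite -nrm_gt0 ltNge h1.
  split; first by move: h2; rewrite ler_pM2r ?exprn_gt0.
  apply: le_trans h1 _; apply: ler_wpM2l; last exact: (nrm_proj dot_norm fE).
  by apply: mulr_ge0 (ltW K0) (eps_ge0 n).
have [Im0|Im0] := eqVneq (Im z) 0.
  exists rho0 => //; exists (K + 1); first by rewrite addr_ge0 // ltW.
  exists n0 => n hn l v hl Lv v0 hv; have [h1 h2] := gen n l v hn hl Lv v0 hv.
  have e0 := eps_ge0 n; split; last first.
    by apply: le_trans h2 _; apply: (ler_wpM2r (nrm_ge0 _)); apply: ler_wpM2r => //; rewrite lerDl.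
  have cz : Num.conj z = z.
    by move: Im0; case: z => a b /= ->; apply/eqP; rewrite eq_complex /= oppr0 !eqxx.
  (* K <= (K + 1)^2 avoids a square root of K. *)
  have : nrm (l - z) ^+ 2 <= ((K + 1) * eps n) ^+ 2.
    have tE : tz z l = (z - l) ^+ 2 by rewrite /tz cz expr2.
    move: h1; rewrite tE nrmX nrmBC exprMn => h1; apply: le_trans h1 _.
    apply: (ler_wpM2r (exprn_ge0 2 e0)).
    by move: (sqr_ge0 K); rewrite sqrrD mulr1 expr1n; move: K0; lra.
  by rewrite ler_pXn2r ?nnegrE ?nrm_ge0 // mulr_ge0 // addr_ge0 // ltW.
have b0 : 0 < `|Im z| by rewrite normr_gt0.
exists (Num.min rho0 `|Im z|); first by rewrite lt_min rho00.
have [n1 hn1] := eps_le ltr01.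
exists (K + K / `|Im z|); first by rewrite addr_ge0 ?divr_ge0 // ltW.
exists (maxn n0 n1) => n; rewrite geq_max => /andP[hn hn'] l v.
rewrite le_min => /andP[hl hl'] Lv v0 hv; have [h1 h2] := gen n l v hn hl Lv v0 hv.
have e0 := eps_ge0 n; have e1 := hn1 n hn'.
have Kb : 0 <= K / `|Im z| by rewrite divr_ge0 // ltW.
split; last first.
  by apply: le_trans h2 _; apply: (ler_wpM2r (nrm_ge0 _)); apply: ler_wpM2r => //; rewrite lerDl.
have h3 : `|Im z| <= nrm (Num.conj z - l).
  have := normIm_le (Num.conj z - l); rewrite ImD ImN.
  have -> : Im (Num.conj z) = - Im z by case: (z).
  have := normIm_le (l - z); rewrite ImD ImN.
  have -> : - Im z - Im l = - (Im l - Im z + 2 * Im z) by ring.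
  rewrite normrN; have := ler_normB (Im l - Im z + 2 * Im z) (Im l - Im z).
  rewrite addrC addKr normrM ger0_norm //; move: hl'; lra.
have h4 : `|Im z| * nrm (l - z) <= K * eps n.
  have h5 : nrm (tz z l) <= K * eps n.
    apply: le_trans h1 _; apply: (ler_wpM2l (ltW K0)).
    by rewrite expr2; exact: ler_piMr.
  apply: le_trans h5; rewrite /tz nrmM [nrm (z - l)]nrmBC; exact: (ler_wpM2r (nrm_ge0 _) h3).
have h5 : nrm (l - z) <= K / `|Im z| * eps n by rewrite mulrAC ler_pdivlMr // mulrC.
by apply: le_trans h5 _; apply: ler_wpM2r => //; rewrite lerDr ltW.
Qed.

Lemma residual_near (kA : R) (t phi : H) (w : C) : (forall x, nrm (A x) <= kA * nrm x) ->
  A t = z *: t ->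
  nrm (A phi - w *: phi) <= nrm (w - z) * nrm t + (kA + nrm w) * nrm (phi - t).
Proof.
move=> hA At; have -> : A phi - w *: phi = (A t - w *: t) + (A (phi - t) - w *: (phi - t)).
  by rewrite linearB /= scalerBr opprB addrACA [A t + _]addrC subrK addKr.
apply: le_trans (nrmD _ _) _; apply: lerD.
  by rewrite At -scalerBl nrmZ nrmBC.
by apply: le_trans (nrmB _ _) _; rewrite mulrDl nrmZ; apply: lerD.
Qed.

Lemma findim_Mspace_pm (s : bool) (r : R) n : findim_subspace (Mspace_pm dot s A (L n) z r).
Proof.
have fL := L_Lambda.1 n; have [b bE] := fL.
have sM : subsp (Mspace dot A (L n) z r) by exact: subsp_lspan.
have ML : Mspace dot A (L n) z r `<=` L n `*` L n.
  by apply: lspan_sub; [exact: subsp_prod|move=> x []].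
apply: (@findim_sub _ _ b); last by rewrite -bE => _ [x /ML[h1 h2] <-]; case: s.
split; first by exists 0; [exact: sM.1|case: s].
move=> c _ _ [x Mx <-] [y My <-]; exists (c *: x + y); first exact: sM.2.
by case: s.
Qed.

Lemma residuals_le (M : set H) (w : C) phi : subsp M -> M phi -> phi != 0 ->
  inf (residuals A M w) * nrm phi <= nrm (A phi - w *: phi).
Proof.
move=> sM Mphi phi0; have [c [c0 c1 cn]] := normalize phi0.
have hc : nrm (A (c%:C *: phi) - w *: (c%:C *: phi)) = c * nrm (A phi - w *: phi).
  by rewrite linearZ /= scalerA mulrC -scalerA -scalerBr nrmZr gtr0_norm.
have : inf (residuals A M w) <= c * nrm (A phi - w *: phi).
  apply: ge_inf; first by exists 0 => _ [x _ <-]; exact: nrm_ge0.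
  by exists (c%:C *: phi) => //; split=> //; exact: subspZ.
move=> /(ler_wpM2r (nrm_ge0 phi)) h; apply: le_trans h _.
by rewrite mulrAC c1 mul1r.
Qed.

Variables (r : R) (z_ : nat -> C) (s : bool).
Hypothesis r0 : 0 < r.
Hypothesis z_spec_n : forall n, quad_spectrum dot A (L n) (z_ n).
Hypothesis z_cvg : forall e : R, 0 < e -> exists N, forall n, (N <= n)%N -> nrm (z_ n - z) < e.
Local Notation M n := (Mspace_pm dot s A (L n) z r).
Local Notation gamma n := (inf (residuals A (M n) (z_ n))).

Lemma z_rate : exists2 K : R, 0 <= K & exists n0, forall n, (n0 <= n)%N ->
  nrm (z_ n - z) <= K * eps n.
Proof.
have [rho rho0 [K K0 [n0 hn0]]] := eigvec_rate; have [n1 hn1] := z_cvg rho0.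
exists K => //; exists (maxn n0 n1) => n; rewrite geq_max => /andP[h h'].
have [v [Lv v0 hv]] := quad_spectrum_eigvec dot_norm A_bounded (L_Lambda.1 n) (@z_spec_n n).
exact: (hn0 n h _ v (ltW (hn1 n h')) Lv v0 hv).1.
Qed.

Lemma Mspace_pm_neq0 : exists n0, forall n, (n0 <= n)%N -> exists2 phi, M n phi & phi != 0.
Proof.
have [n0 hn0] := z_cvg r0; exists n0 => n hn.
have [v [Lv v0 hv]] := quad_spectrum_eigvec dot_norm A_bounded (L_Lambda.1 n) (@z_spec_n n).
exists v => //; exact: (eigvec_in_Mspace (L_Lambda.1 n) s (hn0 n hn) Lv v0 hv).
Qed.

(* When z = 0 and the sign is +, the approximation of (z u, u) says nothing about the first
   component: the eigenvectors of the block operator are used instead. *)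
Lemma gamma_rate_zero : z = 0 -> exists2 K : R, 0 <= K & exists n0, forall n, (n0 <= n)%N ->
  gamma n <= K * eps n.
Proof.
move=> z0; have [rho rho0 [K K0 [n0 hn0]]] := eigvec_rate.
have [kA kA0 hA] := bounded_pos A_bounded.
have fE := findim_eigenspan dot_norm A_bounded A_normal nqh.
have m0 : 0 < Num.min rho (Num.min r 1) by rewrite !lt_min rho0 r0 ltr01.
have [n1 hn1] := z_cvg m0.
have kA1 : 0 <= kA + 1 by rewrite addr_ge0.
exists (K + (kA + 1) * K); first by rewrite addr_ge0 // mulr_ge0.
exists (maxn n0 n1) => n; rewrite geq_max => /andP[h h'].
have := hn1 n h'; rewrite !lt_min => /and3P[d1 d2 d3].
have fL := L_Lambda.1 n.
have [v [Lv v0 hv]] := quad_spectrum_eigvec dot_norm A_bounded fL (@z_spec_n n).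
have [h1 h2] := hn0 n h _ v (ltW d1) Lv v0 hv.
have Mv := eigvec_in_Mspace fL s d2 Lv v0 hv.
have := residuals_le (z_ n) (subsp_findim (findim_Mspace_pm s r n)) Mv v0.
set e := orthproj dot E v in h2.
(* For z = 0 the points z and conj z coincide, so E consists of eigenvectors for z. *)
have Ae : A e = z *: e.
  have : E e by exact: (proj_in dot_norm fE).
  apply: (@lspan_sub _ _ _ [set x | A x = z *: x]) => [|x [l [hl _]]].
    split; first by rewrite /= linear0 scaler0.
    by move=> c a b /= ha hb; rewrite linearP ha hb scalerDr !scalerA mulrC.
  case: hl => ->; first by [].
  by rewrite z0 conjC0.
have := residual_near v (z_ n) hA Ae.
have ev : nrm e <= nrm v by exact: (nrm_proj dot_norm fE).
have e0 := eps_ge0 n; have nv := nrm_ge0 v.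
have zn : nrm (z_ n) <= 1 by move: d3; rewrite {1}z0 subr0 => /ltW.
have t1 : nrm (z_ n - z) * nrm e <= K * eps n * nrm v.
  exact: ler_pM (nrm_ge0 _) (nrm_ge0 _) h1 ev.
have t2 : (kA + nrm (z_ n)) * nrm (v - e) <= (kA + 1) * (K * eps n * nrm v).
  by apply: ler_pM (nrm_ge0 _) _ h2; [rewrite addr_ge0 ?nrm_ge0|rewrite lerD2l].
move=> t3 t4; have : gamma n * nrm v <= (K + (kA + 1) * K) * eps n * nrm v.
  apply: le_trans t4 _; apply: le_trans t3 _; apply: le_trans (lerD t1 t2) _.
  by rewrite !mulrDl !mulrA.
by rewrite ler_pM2r // nrm_gt0.
Qed.

(** The number k is the norm of the component of (z u, u) selected by the sign. It must be positive,
    since the trial vector phi is within O(eps) of that component and has to be normalized. *)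
Lemma gamma_rate_eigvec u : A u = z *: u -> nrm u = 1 -> 0 < (if s then nrm z else 1) ->
  exists2 K : R, 0 <= K & exists n0, forall n, (n0 <= n)%N -> gamma n <= K * eps n.
Proof.
move=> Au u1; set k := (if s then _ else _) => k0.
have [kA kA0 hA] := bounded_pos A_bounded.
have [K1 K10 [n1 hn1]] := root_vector_approx r0 Au u1.
have [K2 K20 [n2 hn2]] := z_rate.
have [n3 hn3] := z_cvg ltr01.
pose K3 := k + K1; have K30 : 0 < K3 by rewrite /K3 ltr_pwDl.
(* Then K3 eps <= k / 2, and |phi| is at least k / 2. *)
have [n4 hn4] := eps_le (divr_gt0 k0 (mulr_gt0 (ltr0n R 2) K30)).
pose q := kA + (nrm z + 1); have q0 : 0 <= q by rewrite !addr_ge0 ?nrm_ge0.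
have [sE Eu] : subsp E /\ E u.
  by split; [exact: subsp_lspan|apply: (eigen_in_eigenspan nqh _ Au); left].
exists ((K2 * k + q * K3) / (k / 2)).
  by rewrite divr_ge0 ?divr_ge0 ?(ltW k0) // addr_ge0 // mulr_ge0 // ltW.
exists (maxn (maxn n1 n2) (maxn n3 n4)) => n.
rewrite !geq_max => /andP[/andP[h1 h2] /andP[h3 h4]].
have [g Mg hg] := hn1 n h1; have e0 := eps_ge0 n; have fL := L_Lambda.1 n.
pose phi := if s then g.1 else g.2; pose t := if s then z *: u else u.
have Mphi : M n phi by exists g.
have nt : nrm t = k by rewrite /t /k; case: (s); rewrite ?nrmZ u1 ?mulr1.
have At : A t = z *: t by rewrite /t; case: (s); rewrite ?linearZ /= Au.
have Et : E t by rewrite /t; case: (s) => //; exact: subspZ.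
have Pg : nrm (P n t - phi) <= K1 * eps n.
  apply: le_trans hg; rewrite prod_nrmE /phi /t le_max; case: (s) => /=.
    by rewrite (projZ dot_norm fL) lexx.
  by rewrite lexx orbT.
have d : nrm (phi - t) <= K3 * eps n.
  rewrite nrmBC; apply: le_trans (nrm_subD _ (P n t) _) _; rewrite mulrDl; apply: lerD Pg.
  by have := gap_le dot_norm fL sE Et; rewrite nt mulrC.
have nphi : k / 2 <= nrm phi.
  have : K3 * eps n <= k / 2.
    have := ler_wpM2l (ltW K30) (hn4 n h4); have -> // : K3 * (k / (2 * K3)) = k / 2.
    by rewrite invfM mulrCA [K3 * _]mulrC mulfVK ?gt_eqF // mulrC.
  have := nrmB phi (phi - t); rewrite opprB addrC subrK nt; move: d; lra.
have k2 : 0 < k / 2 by rewrite divr_gt0.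
have phi0 : phi != 0 by rewrite -nrm_gt0; exact: lt_le_trans nphi.
have := residuals_le (z_ n) (subsp_findim (findim_Mspace_pm s r n)) Mphi phi0.
have := residual_near phi (z_ n) hA At; rewrite nt.
have zn : nrm (z_ n) <= nrm z + 1.
  have := hn3 n h3; have := nrmD (z_ n - z) z; rewrite subrK; lra.
have t1 : nrm (z_ n - z) * k <= K2 * k * eps n.
  by rewrite mulrAC; exact: (ler_wpM2r (ltW k0) (hn2 n h2)).
have t2 : (kA + nrm (z_ n)) * nrm (phi - t) <= q * (K3 * eps n).
  by apply: ler_pM (nrm_ge0 _) _ d; [rewrite addr_ge0 ?nrm_ge0|rewrite lerD2l].
(* The lower bound of |phi| is multiplied by gamma n, which requires its sign; otherwise the claim
   is trivial. *)
have [gneg|gpos] := lerP (gamma n) 0.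
  move=> _ _; apply: le_trans gneg _; apply: mulr_ge0 e0.
  by rewrite divr_ge0 ?(ltW k2) // addr_ge0 // mulr_ge0 // ltW.
move=> t3 t4; rewrite mulrAC ler_pdivlMr //.
apply: le_trans (ler_wpM2l (ltW gpos) nphi) _; apply: le_trans t4 _.
apply: le_trans t3 _; apply: le_trans (lerD t1 t2) _.
by rewrite [leRHS]mulrDl mulrA.
Qed.

End BlockApprox.

Theorem corollary5p1 (R : realType) (H : completeNormedModType R[i])
    (dot : {dot H for Num.conj})
    (dot_norm : forall u : H, dot u u = `|u| ^+ 2)
    (H_infdim : ~ findim_subspace [set: H])
    (A : {linear H -> H}) (A_bounded : bounded_on setT A)
    (A_normal : normal_op dot A)
    (L : nat -> set H) (L_Lambda : Lambda dot L)
    (z : R[i])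
    (z_spec : (spectrum A `\` quad_hull (essential_spectrum A)) z)
    (r : R) (r_adm : admissible_radius dot A z r)
    (z_ : nat -> R[i]) (z_spec_n : forall n, quad_spectrum dot A (L n) (z_ n))
    (z_cvg : (z_ : nat -> R[i]^o) @ \oo --> (z : R[i]^o))
    (s : bool) :
  let eps := fun n => gap (discrete_eigenspan A [set z; Num.conj z]) (L n) in
  let M := fun n => Mspace_pm dot s A (L n) z r in
  (* an infimum, shown to be attained (a minimum) in the second item *)
  let gamma := fun n => inf (residuals A (M n) (z_ n)) in
  [/\ \forall n \near \oo, exists2 phi, M n phi & phi != 0,
      forall n, (exists2 phi, M n phi & phi != 0) ->
        residuals A (M n) (z_ n) (gamma n) /\
        set_dist (z_ n) (spectrum A) <= gamma n,
      gamma =O_\oo eps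
    & \forall n \near \oo, nrm (z_ n - z) <= gamma n].
Proof.
move=> eps M gamma; have [zS nqh] := z_spec; have r0 : 0 < r by have [] := r_adm.
have [nz _] := quad_hull_not_essential nqh.
have zd : discrete_spectrum A z by apply: contrapT => nd; apply: nz.
have cvg (e : R) : 0 < e -> exists N, forall n, (N <= n)%N -> nrm (z_ n - z) < e.
  move=> e0; have [/(_ z_cvg e e0) [N hN] _] := nrm_cvgnP (V := R[i]^o) z_ z.
  by exists N => n hn; rewrite nrmBC; exact: hN.
have fM n : findim_subspace (M n)  by apply: findim_Mspace_pm.
have [kA kA0 hA] := bounded_pos A_bounded.
have Flin w : linear (fun x => A x - w *: x).
  move=> c x y; rewrite linearP scalerDr opprD addrACA scalerBr; congr (_ - _ + _).
  by rewrite !scalerA mulrC.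
have attained n : (exists2 phi, M n phi & phi != 0) ->
    exists2 phi, M n phi /\ nrm phi = 1 & gamma n = nrm (A phi - z_ n *: phi).
  move=> ne; have [|phi [Mphi n1] hphi] := sphere_min dot_norm (fM n) (Flin (z_ n)) _ ne.
    exists (kA + nrm (z_ n)) => [|x]; first by rewrite addr_ge0 ?nrm_ge0.
    by apply: le_trans (nrmB _ _) _; rewrite mulrDl nrmZ lerD2r.
  exists phi => //; apply/eqP; rewrite eq_le; apply/andP; split.
    by apply: ge_inf; [exists 0 => _ [x _ <-]; exact: nrm_ge0|exists phi].
  apply: lb_le_inf; first by exists (nrm (A phi - z_ n *: phi)), phi.
  by move=> _ [x [Mx x1] <-]; exact: hphi.
have nonzero : exists n0, forall n, (n0 <= n)%N -> exists2 phi, M n phi & phi != 0.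
  by apply: Mspace_pm_neq0.
split.
- by have [n0 hn0] := nonzero; exists n0 => // n /= hn; exact: hn0.
- move=> n /attained[phi [Mphi n1] gE]; split; first by rewrite gE; exists phi.
  (* The approximate point spectrum lies in the spectrum, so the distance from z_n to the latter is
     admissible in [dist_le]. *)
  rewrite gE -[leLHS]mulr1 -n1; apply: (dist_le dot_norm A_bounded A_normal (V := setT)) => //.
  + apply: lb_le_inf; first by exists (nrm (z_ n - z)), z.
    by move=> _ [x _ <-]; exact: nrm_ge0.
  + move=> mu /sap_spectrum mus; rewrite nrmBC; apply: ge_inf.
      by exists 0 => _ [x _ <-]; exact: nrm_ge0.
    by exists mu.
- have [K K0 [n0 hn0]] : exists2 K : R, 0 <= K &
      exists n0, forall n, (n0 <= n)%N -> gamma n <= K * eps n.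
    have [_ [u Au u0] _] := zd; have [c [_ _ c1]] := normalize u0.
    have Acu : A (c%:C *: u) = z *: (c%:C *: u).
      by rewrite linearZ /= Au !scalerA mulrC.
    (* The second case occurs only for z = 0 with the sign +. *)
    have [k0|k0] := ltP 0 (if s then nrm z else 1).
      by apply: gamma_rate_eigvec Acu c1 k0.
    apply: gamma_rate_zero => //.
    move: k0; case: (s) => k0; last by rewrite ler10 in k0.
    by apply/eqP; rewrite -nrm_eq0 eq_le k0 nrm_ge0.
  have [n1 hn1] := nonzero; apply/eqO_exP; exists (K + 1); first by rewrite ltr_wpDl.
  exists (maxn n0 n1) => // n /=; rewrite geq_max => /andP[h0 h1].
  (* The Landau symbol compares absolute values, so both sequences must be shown nonnegative. *)
  have e0 : 0 <= eps n by by apply: eps_ge0.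
  have g0 : 0 <= gamma n.
    have [phi hphi _] := attained n (hn1 n h1).
    apply: lb_le_inf => [|_ [x _ <-]]; last exact: nrm_ge0.
    by exists (nrm (A phi - z_ n *: phi)), phi.
  rewrite !ger0_norm //; apply: le_trans (hn0 n h0) _.
  by apply: ler_wpM2r => //; rewrite lerDl.
(* For z_n near the isolated point z every unit vector has residual at least |z_n - z|, in
   particular the minimizer. *)
- have [rho rho0 low] := shift_low dot_norm A_bounded A_normal (discrete_isolated zd).
  have [n0 hn0] := cvg rho rho0; have [n1 hn1] := nonzero.
  exists (maxn n0 n1) => // n /=; rewrite geq_max => /andP[h0 h1].
  have [phi [_ n2] ->] := attained n (hn1 n h1).
  by have := low (z_ n) (ltW (hn0 n h0)) phi; rewrite n2 mulr1.
Qed.
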